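(* Let $p$ be a prime and $G$ a ramification group at $p$. Then the rational group algebra $\mathbf{Q}[G]$ has the following properties: (i) $\mathbf{Q}[G]$ is quasi-split outside $p$; (ii) if $E$ is a simple factor of $\mathbf{Q}[G]$, then the center $Z(E)$ of $E$ is a CM field or a subfield of $\mathbf{Q}(\mu_{p^\infty})$. Furthermore, if $\operatorname{Card} G$ is odd then no simple factor of $\mathbf{Q}[G]$ is of type III.
   Context: A ramification group at $p$ is a finite group of the form $\Gamma_p\rtimes\mathbf{Z}/n\mathbf{Z}$ with $\Gamma_p$ a $p$-group and $n$ prime to $p$. A finite-dimensional semisimple $\mathbf{Q}$-algebra is quasi-split outside $p$ if for each simple factor $E$ (with center $F$) the local invariants of $E$ vanish at all finite places of $F$ not above $p$, i.e. $E\otimes_{\mathbf{Q}}\mathbf{Q}_\ell$ is a product of matrix algebras over fields for all primes $\ell\neq p$. $\mathbf{Q}(\mu_{p^\infty})$ is the union of the cyclotomic fields $\mathbf{Q}(\mu_{p^k})$. The algebra $\mathbf{Q}[G]$ carries the positive involution $g\mapsto g^{-1}$, inducing positive involutions on its simple factors. A simple $\mathbf{Q}$-algebra $E\simeq \mathrm{M}_n(D)$ ($D$ a division algebra with center $F$) with positive involution is of type III if $D$ is a quaternion algebra over a totally real field $F$ with $D\otimes_{F,\sigma}\mathbf{R}\simeq\mathbf{H}$ (Hamilton quaternions) for every embedding $\sigma\colon F\to\mathbf{R}$; equivalently $E\otimes_{\mathbf{Q}}\mathbf{R}$ is a product of matrix algebras over $\mathbf{H}$. *)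

(* Defs.v *)
From HB Require Import structures.
From mathcomp Require Import all_boot all_order all_fingroup all_algebra.
From mathcomp Require Import all_solvable all_field ring_quotient.
From mathcomp Require Import boolp classical_sets functions reals.

Set Implicit Arguments.
Unset Strict Implicit.
Unset Printing Implicit Defensive.

Import Order.TTheory GRing.Theory Num.Theory.
Local Open Scope ring_scope.

Definition ramification_group (p : nat) (gT : finGroupType) (G : {group gT}) :=
  exists P C : {group gT},
    [/\ (P ><| C = G)%g, (p.-group P)%g, cyclic C & coprime #|C| p].

Section GroupAlgebra.
Variables (K : fieldType) (gT : finGroupType).

Definition group_algebra := {ffun gT -> K^o}.

HB.instance Definition _ := Vector.on group_algebra.

Implicit Types x y z : group_algebra.

Definition galg_one : group_algebra := [ffun g => (g == 1%g)%:R].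

(* convolution: (\sum_g x_g g) (\sum_h y_h h) *)
Definition galg_mul x y : group_algebra :=
  [ffun g => \sum_(h : gT) x h * y (h^-1 * g)%g].

Fact galg_mulA : associative galg_mul.
Proof.
move=> x y z; apply/ffunP => g; rewrite !ffunE.
under eq_bigr do rewrite ffunE mulr_sumr.
under [RHS]eq_bigr do rewrite ffunE mulr_suml.
rewrite [RHS]exchange_big /=; apply: eq_bigr => h _.
rewrite [RHS](reindex_inj (mulgI h)); apply: eq_bigr => k _.
by rewrite mulrA mulKg invMg mulgA.
Qed.

Fact galg_mul1 : left_id galg_one galg_mul.
Proof.
move=> x; apply/ffunP => g; rewrite ffunE (bigD1 1%g) //= big1 => [|h nh].
  by rewrite ffunE eqxx mul1r invg1 mul1g addr0.
by rewrite ffunE (negbTE nh) mul0r.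
Qed.

Fact galg_mulr1 : right_id galg_one galg_mul.
Proof.
move=> x; apply/ffunP => g; rewrite ffunE (bigD1 g) //= big1 => [|h nh].
  by rewrite ffunE mulVg eqxx mulr1 addr0.
by rewrite ffunE -eq_mulVg1 (negbTE nh) mulr0.
Qed.

Fact galg_mulDl : left_distributive galg_mul +%R.
Proof.
move=> x y z; apply/ffunP => g; rewrite !ffunE -big_split /=.
by apply: eq_bigr => h _; rewrite ffunE mulrDl.
Qed.

Fact galg_mulDr : right_distributive galg_mul +%R.
Proof.
move=> x y z; apply/ffunP => g; rewrite !ffunE -big_split /=.
by apply: eq_bigr => h _; rewrite ffunE mulrDr.
Qed.

Fact galg_oner_neq0 : galg_one != 0.
Proof.
by apply/eqP => /ffunP/(_ 1%g)/eqP; rewrite !ffunE eqxx oner_eq0.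
Qed.

HB.instance Definition _ := GRing.Zmodule_isNzRing.Build group_algebra
  galg_mulA galg_mul1 galg_mulr1 galg_mulDl galg_mulDr galg_oner_neq0.

Fact galg_scaleAl (a : K) (x y : group_algebra) : a *: (x * y) = a *: x * y.
Proof.
apply/ffunP => g; rewrite !ffunE scaler_sumr; apply: eq_bigr => h _.
by rewrite ffunE scalerAl.
Qed.

HB.instance Definition _ :=
  GRing.Lmodule_isLalgebra.Build K group_algebra galg_scaleAl.

Fact galg_scaleAr (a : K) (x y : group_algebra) : a *: (x * y) = x * (a *: y).
Proof.
apply/ffunP => g; rewrite !ffunE scaler_sumr; apply: eq_bigr => h _.
by rewrite ffunE [RHS]mulrCA.
Qed.

HB.instance Definition _ :=
  GRing.Lalgebra_isAlgebra.Build K group_algebra galg_scaleAr.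

HB.instance Definition _ := Algebra_isFalgebra.Build K group_algebra.

End GroupAlgebra.

Definition two_sided_ideal (K : fieldType) (A : falgType K) (I : {vspace A}) :=
  ({:A} * I <= I)%VS && (I * {:A} <= I)%VS.

Definition simple_algebra (K : fieldType) (A : falgType K) :=
  forall I : {vspace A}, two_sided_ideal I -> I = 0%VS \/ I = fullv.

(* A term of {aspace A} has its own identity element [algid E], which need not
   be 1. When E is also an ideal, [algid E] is a central idempotent, so that A
   is the product of the algebras E and (1 - algid E) * A. *)
Definition simple_factor (K : fieldType) (A : falgType K) (E : {aspace A}) :=
  two_sided_ideal E /\ simple_algebra (subvs_of E).

Definition identifies_center (K : fieldType) (A : falgType K)
    (F : fieldExtType K) (i : {lrmorphism F -> A}) :=
  injective i /\ forall z : A, (z \in 'Z({:A})%VS) <-> exists a, z = i a.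

(* The map A (x)_{K, sigma} L -> B, x (x) b |-> b *: phi x, is an isomorphism
   of L-algebras. *)
Definition scalar_extension (K L : fieldType) (sigma : {rmorphism K -> L})
    (A : falgType K) (B : falgType L) (phi : {rmorphism A -> B}) :=
  (forall a x, phi (a *: x) = sigma a *: phi x)
  /\ basis_of {:B} [seq phi x | x <- vbasis {:A}].

Definition product_of_matrix_algebras (K : fieldType) (B : falgType K) :=
  exists (r : nat) (L : 'I_r -> fieldExtType K) (n : 'I_r -> nat)
    (f : forall i, {rmorphism B -> 'M[L i]_((n i).+1)}),
    (forall i a x, f i (a *: x) = a%:A *: f i x)
    /\ (forall y : (forall i, 'M[L i]_((n i).+1)),
          exists! x : B, forall i, f i x = y i).

(* |x|_l = l ^ (- v_l(x)), normalized so that |l|_l = 1 / l. *)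
Definition padic_norm (l : nat) (x : rat) : rat :=
  if x == 0 then 0
  else l%:R ^ ((logn l `|denq x|)%:Z - (logn l `|numq x|)%:Z).

Section Padic.
Variables (l : nat) (l_pr : prime l).
Local Notation normp := (padic_norm l).

Let l_gt0 : 0 < l%:R :> rat. Proof. by rewrite ltr0n prime_gt0. Qed.
Let l_neq0 : l%:R != 0 :> rat. Proof. by rewrite lt0r_neq0. Qed.

Fact padic_norm0 : normp 0 = 0. Proof. by rewrite /padic_norm eqxx. Qed.

Fact padic_norm_gt0 x : (0 < normp x) = (x != 0).
Proof. by rewrite /padic_norm; case: eqP => //= _; rewrite exprz_gt0. Qed.

Fact padic_norm_ge0 x : 0 <= normp x.
Proof.
by have [->|x0] := eqVneq x 0; rewrite ?padic_norm0 // ltW // padic_norm_gt0.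
Qed.

Fact padic_norm_frac (a b : int) : a != 0 -> b != 0 ->
  normp (a%:~R / b%:~R) = l%:R ^ ((logn l `|b|)%:Z - (logn l `|a|)%:Z).
Proof.
move=> a0 b0; set x := _ / _.
have x0 : x != 0 by rewrite mulf_neq0 ?invr_eq0 ?intr_eq0.
rewrite /padic_norm (negbTE x0); congr (_ ^ _).
have : a * denq x = numq x * b.
  apply: (@intr_inj rat); rewrite !rmorphM /= numqE.
  by rewrite mulrAC divfK // intr_eq0.
move=> /(congr1 absz); rewrite !abszM => /(congr1 (logn l)).
rewrite !lognM ?absz_gt0 ?denq_neq0 ?numq_eq0 // => h.
by apply/eqP; rewrite subr_eq addrAC eq_sym subr_eq -!PoszD addnC -h addnC.
Qed.

Fact padic_normM x y : normp (x * y) = normp x * normp y.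
Proof.
have [->|x0] := eqVneq x 0; first by rewrite mul0r padic_norm0 mul0r.
have [->|y0] := eqVneq y 0; first by rewrite mulr0 padic_norm0 mulr0.
rewrite -{1}[x]divq_num_den -{1}[y]divq_num_den mulf_div -!rmorphM /=.
rewrite padic_norm_frac ?mulf_neq0 ?numq_eq0 ?denq_neq0 //.
rewrite /padic_norm (negbTE x0) (negbTE y0) -expfzDr //; congr (_ ^ _).
rewrite !abszM !lognM ?absz_gt0 ?numq_eq0 ?denq_neq0 // !PoszD.
by rewrite opprD addrACA.
Qed.

Fact padic_norm1 : normp 1 = 1.
Proof.
have h : normp 1 != 0 by rewrite lt0r_neq0 // padic_norm_gt0 oner_neq0.
by apply: (mulfI h); rewrite -padic_normM !mulr1.
Qed.

Fact padic_normV x : normp x^-1 = (normp x)^-1.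
Proof.
have [->|x0] := eqVneq x 0; first by rewrite !(invr0, padic_norm0).
have h : normp x != 0 by rewrite lt0r_neq0 // padic_norm_gt0.
by apply: (mulfI h); rewrite -padic_normM !mulfV // padic_norm1.
Qed.

Fact padic_normN x : normp (- x) = normp x.
Proof. by rewrite /padic_norm oppr_eq0 numqN denqN abszN. Qed.

Fact padic_norm_intD (a b : int) :
  normp (a + b)%:~R <= Num.max (normp a%:~R) (normp b%:~R).
Proof.
have l_ge1 : 1 <= l%:R :> rat by rewrite ler1n prime_gt0.
have normZ (c : int) : c != 0 -> normp c%:~R = l%:R ^ (- (logn l `|c|)%:Z).
  move=> c0; rewrite -[c%:~R]divr1 -[1]/(1%:~R) padic_norm_frac //.
  by rewrite logn1 sub0r.
have [->|ab0] := eqVneq (a + b) 0.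
  by rewrite padic_norm0 le_max padic_norm_ge0.
have [->|a0] := eqVneq a 0; first by rewrite add0r le_max lexx orbT.
have [->|b0] := eqVneq b 0; first by rewrite addr0 le_max lexx.
wlog ab : a b a0 b0 ab0 / (logn l `|a| <= logn l `|b|)%N => [wl|].
  have [|/ltnW] := leqP (logn l `|a|) (logn l `|b|); first exact: wl.
  by rewrite addrC maxC; apply: wl; rewrite // addrC.
rewrite le_max; apply/orP; left.
rewrite !normZ // ler_weXz2l // lerN2 lez_nat.
rewrite -pfactor_dvdn ?absz_gt0 //.
have da : (l ^ logn l `|a| %| `|a|)%N by rewrite pfactor_dvdnn.
have db : (l ^ logn l `|a| %| `|b|)%N by rewrite pfactor_dvdn ?absz_gt0.
have: ((l ^ logn l `|a|)%N %| a + b)%Z by rewrite rpredD.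
by rewrite dvdzE.
Qed.

Fact padic_normD x y : normp (x + y) <= Num.max (normp x) (normp y).
Proof.
have d0 z : (denq z)%:~R != 0 :> rat by rewrite intr_eq0 denq_neq0.
have [a [b [d [-> ->]]]] : exists a b d : int,
    x = a%:~R / d%:~R /\ y = b%:~R / d%:~R.
  exists (numq x * denq y), (denq x * numq y), (denq x * denq y).
  by rewrite !rmorphM /= -!mulf_div !mulfV // mulr1 mul1r !divq_num_den.
rewrite -mulrDl -rmorphD /= !padic_normM -maxr_pMl ?padic_norm_ge0 //.
by rewrite ler_wpM2r ?padic_norm_ge0 // padic_norm_intD.
Qed.

Fact padic_normB x y : normp (x - y) <= Num.max (normp x) (normp y).
Proof. by rewrite -[X in Num.max _ X]padic_normN padic_normD. Qed.

Fact padic_normB_lt x y e : normp x < e -> normp y < e -> normp (x - y) < e.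
Proof.
by move=> xe ye; rewrite (le_lt_trans (padic_normB x y)) // gt_max xe.
Qed.

Definition padic_cauchy : {pred nat -> rat} := fun u => `[<
  forall e : rat, 0 < e ->
  exists N, forall m n, (N <= m)%N -> (N <= n)%N -> normp (u m - u n) < e >].

Definition padic_null_seq (u : nat -> rat) :=
  forall e : rat, 0 < e -> exists N, forall n, (N <= n)%N -> normp (u n) < e.

Fact padic_cauchy_bounded u : u \in padic_cauchy ->
  exists2 B : rat, 0 < B & exists N, forall n, (N <= n)%N -> normp (u n) < B.
Proof.
move=> /asboolP/(_ _ ltr01)[N hN]; exists (Num.max 1 (normp (u N)) + 1).
  by rewrite addr_gt0 // lt_max ltr01.
exists N => n nN; rewrite -[u n](subrK (u N)).
rewrite (le_lt_trans (padic_normD _ _)) //.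
rewrite (@le_lt_trans _ _ (Num.max 1 (normp (u N)))) ?ltrDl //.
by rewrite ge_max le_max ltW ?hN //= le_max lexx orbT.
Qed.

Fact padic_cauchy_subring : subring_closed padic_cauchy.
Proof.
split=> [|u v /asboolP hu /asboolP hv|u v cu cv]; apply/asboolP => e e0.
- by exists 0 => m n _ _; rewrite subrr padic_norm0.
- have [M hM] := hu _ e0; have [N hN] := hv _ e0.
  exists (maxn M N) => m n; rewrite !geq_max => /andP[Mm Nm] /andP[Mn Nn].
  by rewrite addrfctE opprD addrACA -opprD padic_normB_lt ?hM ?hN.
have [B B0 [N1 hN1]] := padic_cauchy_bounded cu.
have [C C0 [N2 hN2]] := padic_cauchy_bounded cv.
have [N3 hN3] := asboolP _ cu _ (divr_gt0 e0 C0).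
have [N4 hN4] := asboolP _ cv _ (divr_gt0 e0 B0).
exists (maxn (maxn N1 N2) (maxn N3 N4)) => m n; rewrite !geq_max.
move=> /andP[/andP[m1 m2] /andP[m3 m4]] /andP[/andP[n1 n2] /andP[n3 n4]].
have -> : (u * v) m - (u * v) n = u m * (v m - v n) - (u n - u m) * v n.
  by rewrite !mulrfctE mulrBr mulrBl opprB addrA subrK.
apply: padic_normB_lt; rewrite padic_normM.
  rewrite -[e](mulfVK (lt0r_neq0 B0)) mulrC.
  by apply: ltr_pM; rewrite ?padic_norm_ge0 ?hN1 ?hN4.
rewrite -[e](mulfVK (lt0r_neq0 C0)).
by apply: ltr_pM; rewrite ?padic_norm_ge0 ?hN2 ?hN3.
Qed.

HB.instance Definition _ :=
  GRing.isSubringClosed.Build (nat -> rat) padic_cauchy padic_cauchy_subring.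

Record padic_seq := PadicSeq
  { padic_seq_val :> nat -> rat; _ : padic_seq_val \in padic_cauchy }.

HB.instance Definition _ := [isSub of padic_seq for padic_seq_val].
HB.instance Definition _ := [Choice of padic_seq by <:].
HB.instance Definition _ := [SubChoice_isSubComNzRing of padic_seq by <:].

Definition padic_null : {pred padic_seq} := fun u => `[< padic_null_seq u >].

Fact padic_null_ideal : idealr_closed padic_null.
Proof.
split.
- by apply/asboolP => e e0; exists 0%N => n _; rewrite padic_norm0.
- apply/negP => /asboolP/(_ _ ltr01)[N /(_ _ (leqnn N))].
  by rewrite padic_norm1 ltxx.
move=> a u v /asboolP hu /asboolP hv; apply/asboolP => e e0.
have [B B0 [N hN]] := padic_cauchy_bounded (valP a).
have [M1 hM1] := hu _ (divr_gt0 e0 B0); have [M2 hM2] := hv _ e0.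
exists (maxn N (maxn M1 M2)) => n; rewrite !geq_max => /and3P[n1 n2 n3].
rewrite (le_lt_trans (padic_normD _ _)) // gt_max hM2 // andbT.
rewrite padic_normM -[e](mulfVK (lt0r_neq0 B0)) mulrC.
by apply: ltr_pM; rewrite ?padic_norm_ge0 ?hN ?hM1.
Qed.

HB.instance Definition _ :=
  isIdealr.Build padic_seq padic_null padic_null_ideal.

(* The completion of rat for |.|_l: Cauchy sequences modulo null sequences. *)
Definition padic := {ideal_quot padic_null}.
HB.instance Definition _ := GRing.ComNzRing.on padic.

Fact padic_inv_ex (x : padic) : x != 0 -> exists y : padic, y * x == 1.
Proof.
pose pi : {rmorphism padic_seq -> padic} :=
  (\pi_{ideal_quot padic_null})%qT.
have pi_eq0 u : (pi u == 0) = (u \in padic_null).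
  by rewrite -[0](rmorph0 pi) -[u in RHS]subr0 Quotient.idealrBE.
have [u ->] : exists u, x = pi u by elim/quotW: x => u; exists u.
rewrite pi_eq0 => /asboolP nu.
have [e e0 [N hN]] : exists2 e : rat, 0 < e &
    exists N, forall n, (N <= n)%N -> e <= normp (u n).
  move: nu => /existsNP[e /not_implyP[e0 hu]]; exists e => //.
  have [N hN] := asboolP _ (valP u) _ e0.
  move: hu => /forallNP/(_ N)/existsNP[m /not_implyP[Nm /negP]].
  rewrite -leNgt => em; exists N => n Nn; rewrite leNgt; apply/negP => en.
  suff : normp (u m) < e by rewrite ltNge em.
  rewrite -[u m](subrK (u n)) (le_lt_trans (padic_normD _ _)) //.
  by rewrite gt_max hN.
have u0 n : (N <= n)%N -> u n != 0.
  by move=> /hN un; rewrite -padic_norm_gt0 (lt_le_trans e0).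
have cv : (fun n => (u n)^-1) \in padic_cauchy.
  apply/asboolP => d d0.
  have [M hM] := asboolP _ (valP u) _ (mulr_gt0 d0 (mulr_gt0 e0 e0)).
  exists (maxn M N) => m n; rewrite !geq_max => /andP[Mm Nm] /andP[Mn Nn].
  have -> : (u m)^-1 - (u n)^-1 = (u n - u m) / (u m * u n).
    by rewrite mulrBl invfM mulrCA mulfV ?u0 // mulr1 mulrA mulfV ?u0 // mul1r.
  rewrite padic_normM padic_normV padic_normM.
  rewrite ltr_pdivrMr ?mulr_gt0 ?padic_norm_gt0 ?u0 //.
  rewrite (lt_le_trans (hM _ _ Mn Mm)) // ler_pM2l //.
  by apply: ler_pM; rewrite ?(ltW e0) ?hN.
exists (pi (PadicSeq cv)).
rewrite -subr_eq0 -rmorphM -[1](rmorph1 pi) -rmorphB pi_eq0.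
apply/asboolP => d d0; exists N => n Nn.
have -> : (PadicSeq cv * u - 1) n = (u n)^-1 * u n - 1 by [].
by rewrite mulVf ?u0 // subrr padic_norm0.
Qed.

Definition padic_inv (x : padic) : padic :=
  if pselect (exists y, y * x == 1) is left yx1 then xchoose yx1 else 0.

Fact padic_mulV (x : padic) : x != 0 -> padic_inv x * x = 1.
Proof.
move=> /padic_inv_ex x0; rewrite /padic_inv; case: pselect => // yx1.
exact/eqP/(xchooseP yx1).
Qed.

Fact padic_inv0 : padic_inv 0 = 0.
Proof.
rewrite /padic_inv; case: pselect => // yx1.
by have [y] := yx1; rewrite mulr0 eq_sym oner_eq0.
Qed.

HB.instance Definition _ :=
  GRing.ComNzRing_isField.Build padic padic_mulV padic_inv0.

Fact padic_cst_cauchy (x : rat) : cst x \in padic_cauchy.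
Proof. by apply/asboolP => e e0; exists 0%N => *; rewrite subrr padic_norm0. Qed.

Definition padic_of_rat (x : rat) : padic :=
  (\pi_{ideal_quot padic_null} (PadicSeq (padic_cst_cauchy x)))%qT.

Fact padic_of_rat_zmod : zmod_morphism padic_of_rat.
Proof.
move=> x y; rewrite /padic_of_rat -rmorphB.
by congr (\pi_ _ _)%qT; apply: val_inj.
Qed.

Fact padic_of_rat_monoid : monoid_morphism padic_of_rat.
Proof.
split=> [|x y]; rewrite /padic_of_rat.
  rewrite -(rmorph1 (\pi_{ideal_quot padic_null})%qT).
  by congr (\pi_ _ _)%qT; apply: val_inj.
by rewrite -rmorphM; congr (\pi_ _ _)%qT; apply: val_inj.
Qed.

HB.instance Definition _ :=
  GRing.isZmodMorphism.Build rat padic padic_of_rat padic_of_rat_zmod.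
HB.instance Definition _ :=
  GRing.isMonoidMorphism.Build rat padic padic_of_rat padic_of_rat_monoid.
End Padic.

Definition quasi_split_outside (p : nat) (A : falgType rat) :=
  forall E : {aspace A}, simple_factor E ->
  forall (l : nat) (l_pr : prime l), l != p ->
  exists (B : falgType (padic l_pr)) (phi : {rmorphism subvs_of E -> B}),
    scalar_extension (padic_of_rat l_pr) phi /\ product_of_matrix_algebras B.

(* The embeddings of a number field in the complex numbers take values in the
   algebraic numbers. *)
Definition totally_real (F : fieldExtType rat) :=
  forall (s : {rmorphism F -> algC}) (x : F), s x \is Num.real.

Definition totally_imaginary (F : fieldExtType rat) :=
  forall s : {rmorphism F -> algC}, ~ (forall x : F, s x \is Num.real).

Definition CM_field (F : fieldExtType rat) :=
  exists F0 : {subfield F},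
    [/\ totally_real (subvs_of F0), \dim_F0 {:F} = 2%N & totally_imaginary F].

(* Each Q(mu_{p^k}) is the set of rational polynomials in a primitive root. *)
Definition in_Qmu_pinfty (p : nat) (z : algC) :=
  exists (k : nat) (w : algC) (q : {poly rat}),
    (p ^ k)%N.-primitive_root w /\ z = (map_poly ratr q).[w].

Definition subfield_of_Qmu_pinfty (p : nat) (F : fieldExtType rat) :=
  exists s : {rmorphism F -> algC}, forall x : F, in_Qmu_pinfty p (s x).

Definition Hamilton_quaternions (K : fieldType) (H : falgType K) :=
  exists i j : H,
    [/\ i * i = -1, j * j = -1, j * i = - (i * j)
      & basis_of {:H} [:: 1; i; j; i * j]].

Definition division_algebra (K : fieldType) (D : falgType K) :=
  forall x : D, x != 0 -> x \is a GRing.unit.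

(* A central division algebra of dimension 4 is a quaternion algebra. *)
Definition quaternion_division_algebra (F : fieldType) (D : falgType F) :=
  [/\ division_algebra D, 'Z({:D})%VS = 1%VS & \dim {:D} = 4%N].

(* The condition only involves the algebra E, not its positive involution. *)
Definition type_III (R : realType) (E : falgType rat) :=
  exists (F : fieldExtType rat) (D : falgType F) (n : nat)
    (f : {rmorphism E -> 'M[D]_n.+1}),
    [/\ bijective f, totally_real F, quaternion_division_algebra D
      & forall s : {rmorphism F -> R},
          exists (H : falgType R) (phi : {rmorphism D -> H}),
            scalar_extension s phi /\ Hamilton_quaternions H].

(* Main.v *)
(** (i) Let l <> p be prime. The normal subgroup H of G generated by P and the
    prime-to-l part of C has order prime to l, and G / H is a cyclic l-group. So
    F_l[H] is semisimple, with matrix blocks over finite fields by Wedderburn, and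
    F_l[G] is built from these by adjoining one element. A trace argument produces
    finitely many idempotents e of F_l[G] that generate the unit ideal and whose
    corners e F_l[G] e are generated by one element. They lift to idempotents E of
    Q_l[G] that generate the unit ideal and have commutative corners, which rules
    out noncommutative division algebras in Q_l[G].

    (ii) The involution g |-> g^-1 of Q[G] is positive, so it preserves each simple
    factor and its center F. If it is not the identity on F, then F is CM.
    Otherwise the characters belonging to the factor are real; by Clifford theory
    over P their values are then fixed by the automorphisms that fix the p-power
    roots of unity.

    (iii) In type III the involution is trivial on the totally real center, so the
    character is real, hence trivial when |G| is odd: the factor is Q. *)

Require Import Defs.
From HB Require Import structures.
From mathcomp Require Import all_boot all_order all_fingroup all_algebra.
From mathcomp Require Import all_solvable all_field all_character ring_quotient.
From mathcomp Require Import boolp reals ring.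

Set Implicit Arguments.
Unset Strict Implicit.
Unset Printing Implicit Defensive.

Import Order.TTheory GRing.Theory Num.Theory.
Local Open Scope ring_scope.

(** When l divides |G|, F_l[G] is not semisimple and the simple components of Q_l[G] cannot be read
    off modulo l. A weaker structure survives lifting: idempotents with commutative corners that
    together generate the unit ideal. Every simple component c of Q_l[G] is met by one of them, say
    E; the corner of E c is commutative inside a simple algebra, hence a field, and Morita
    equivalence turns the component into a matrix algebra over it.

    Commutativity alone does not lift from F_l to Z_l, whereas generation by one element does: by
    successive approximation the lifted corner consists, modulo each l^n, of polynomials in a single
    element. This is why the modular part aims at corners generated by one element. The condition l
    <> p ensures that P has order prime to l, so that the obstruction to semisimplicity is confined
    to a cyclic quotient.

    The integral structure is carried by congruences modulo l^n Z[G] inside Q[G], and the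
    idempotents of Q_l[G] arise as limits of sequences in Q[G]. *)

Section CommutativeDivisionFalgebra.
Variables (K : fieldType) (D : falgType K).
Hypothesis D_comm : commutative (@GRing.mul D).
Hypothesis D_div : division_algebra D.

Lemma division_algebra_domain : GRing.integral_domain_axiom D.
Proof.
move=> x y xy0; have [//|x0] := eqVneq x 0.
by rewrite -[y]mul1r -(mulVr (D_div x0)) -mulrA xy0 mulr0 eqxx.
Qed.

(** The field structure is packed on the carrier of D itself, so that the isomorphism with D is the
    identity. *)
Definition falg_fieldExt : fieldExtType K :=
 let cC := GRing.PzRing_hasCommutativeMul.Build D D_comm in
 let cR : comUnitRingType := HB.pack (D : Type) cC (Falgebra.class D) in
 let iC := GRing.ComUnitRing_isIntegral.Build cR division_algebra_domain in
 let iR : idomainType := HB.pack (D : Type) cC (Falgebra.class D) iC in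
 let fC := GRing.UnitRing_isField.Build iR D_div in
 HB.pack (D : Type) cC (Falgebra.class D) iC fC.

Lemma falg_fieldExt_exists :
  exists (F : fieldExtType K) (i : {lrmorphism F -> D}), bijective i.
Proof.
exists falg_fieldExt.
by exists (idfun : {lrmorphism D -> D}), id.
Qed.
End CommutativeDivisionFalgebra.

Lemma aspace_field_exists (K : fieldType) (A : falgType K) (U : {aspace A}) :
    {in U &, commutative *%R} ->
    (forall x, x \in U -> x != 0 -> exists2 y, y \in U & x * y = algid U) ->
  exists (F : fieldExtType K) (i : {lrmorphism F -> subvs_of U}), bijective i.
Proof.
move=> Uc Uinv; apply: falg_fieldExt_exists => [x y|x x0].
  by apply: val_inj; rewrite /= Uc ?subvsP.
have [||y yU xy] := Uinv (val x); rewrite ?subvsP //.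
apply/unitrP; exists (Subvs yU); split; apply: val_inj => //=.
by rewrite Uc ?subvsP.
Qed.

(** * Corner algebras, two-sided ideals and Morita equivalence *)

Section Corner.
Variables (K : fieldType) (A : falgType K) (B : {aspace A}) (e : A).
Hypotheses (eB : e \in B) (ee : e * e = e) (e0 : e != 0).

Definition corner_map (x : A) := e * x * e.

Fact corner_map_linear : linear corner_map.
Proof.
by move=> a x y; rewrite /corner_map mulrDr mulrDl -scalerAr -scalerAl.
Qed.

HB.instance Definition _ :=
  GRing.isLinear.Build K A A _ corner_map corner_map_linear.

Definition corner : {vspace A} := (linfun corner_map @: B)%VS.

Lemma cornerM x y : e * x * e * (e * y * e) = e * x * e * y * e.
Proof. by rewrite !mulrA -(mulrA _ e e) ee. Qed.

Lemma cornerP x : reflect (x \in B /\ e * x * e = x) (x \in corner).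
Proof.
apply: (iffP memv_imgP) => [[y yB ->]|[xB <-]].
  by rewrite lfunE /= /corner_map !mulrA ee -!mulrA ee !memvM.
by exists x; rewrite ?lfunE.
Qed.

Lemma corner_aspace_subproof : is_aspace corner.
Proof.
apply/andP; split.
  apply/has_algidP; exists e; split=> // [|x /cornerP[_ <-]].
    by apply/cornerP; rewrite !ee.
  by rewrite !mulrA ee -!mulrA ee.
apply/prodvP => x y /cornerP[xB <-] /cornerP[yB <-]; apply/cornerP.
by rewrite !mulrA ee -!mulrA ee !memvM.
Qed.

Definition corner_aspace : {aspace A} := ASpace corner_aspace_subproof.

Lemma algid_corner : algid corner_aspace = e.
Proof.
have eC : e \in corner_aspace by apply/cornerP; rewrite !ee.
have /cornerP[_ <-] := memv_algid corner_aspace.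
by rewrite -mulrA algidl // ee.
Qed.

(** Inverses are only asked for in B: for x in the corner, x y = e implies x (e y e) = e. *)
Lemma corner_field_exists :
    {in B &, forall x y, e * x * e * y * e = e * y * e * x * e} ->
    {in B, forall x, e * x * e = x -> x != 0 -> exists2 y, y \in B & x * y = e} ->
  exists (F : fieldExtType K) (i : {lrmorphism F -> subvs_of corner_aspace}),
    bijective i.
Proof.
move=> Ce inv_e; apply: aspace_field_exists.
- move=> x y /cornerP[xB xE] /cornerP[yB yE].
  by rewrite -xE -yE !cornerM Ce.
move=> x /cornerP[xB xE] x0; have [y yB xy] := inv_e x xB xE x0.
exists (e * y * e); first by apply/cornerP; rewrite !mulrA ee -!mulrA ee !memvM.
by rewrite algid_corner -{1}xE !mulrA -!(mulrA _ e e) ee xE xy ee.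
Qed.

End Corner.

(** For x in a unital B this is the two-sided ideal of B generated by x. *)
Definition ideal_of (K : fieldType) (A : falgType K) (B : {vspace A}) (x : A) :
  {vspace A} := (B * <[x]> * B)%VS.

Section IdealOf.
Variables (K : fieldType) (A : falgType K).
Implicit Types (x y : A) (I B : {vspace A}).

Lemma mem_ideal_of B x a b : a \in B -> b \in B -> a * x * b \in ideal_of B x.
Proof. by move=> aB bB; rewrite !memv_mul ?memv_line. Qed.

Lemma mem_prodvP (U V : {vspace A}) y : y \in (U * V)%VS ->
  exists2 s : seq (A * A), {in s, forall p, p.1 \in U /\ p.2 \in V}
    & y = \sum_(p <- s) p.1 * p.2.
Proof.
rewrite [@prodv _ _]unlock; set X := (X in span X); move/(@coord_span _ _ _ (in_tuple X)) => ->.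
have Xs (i : 'I_(size X)) : exists p : A * A,
    [/\ p.1 \in U, p.2 \in V & X`_i = p.1 * p.2].
  have /allpairsP[[u v] /= [/vbasis_mem uU /vbasis_mem vV ->]] : X`_i \in X.
    by rewrite mem_nth.
  by exists (u, v).
have [f fE] := fin_all_exists Xs.
exists [seq (coord (in_tuple X) i y *: (f i).1, (f i).2) | i <- enum 'I_(size X)].
  by move=> p /mapP[i _ ->] /=; have [? ? _] := fE i; rewrite memvZ.
rewrite big_map big_enum /=; apply: eq_bigr => i _.
have [_ _ ->] := fE i.
by rewrite scalerAl.
Qed.

Lemma ideal_ofP B x y : y \in ideal_of B x ->
  exists s : seq (A * A), y = \sum_(p <- s) p.1 * x * p.2.
Proof.
move=> /mem_prodvP[s s_in ->].
elim: s s_in => [|p s IHs] s_in; first by exists [::]; rewrite !big_nil.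
have [|q qE] := IHs; first by move=> r rs; apply: s_in; rewrite inE rs orbT.
have [/mem_prodvP[r r_in rE] _] := s_in p (mem_head _ _).
have [f fE] : {f : A * A -> K & forall t, t \in r -> t.2 = f t *: x}.
  apply: (@choice _ _ (fun t k => t \in r -> t.2 = k *: x)) => t.
  have [tr|] := boolP (t \in r); last by exists 0.
  by have [_ /vlineP[k ->]] := r_in t tr; exists k.
exists ([seq (f t *: t.1, p.2) | t <- r] ++ q).
rewrite big_cons big_cat -qE big_map rE mulr_suml; congr (_ + _).
apply: eq_big_seq => t tr /=; rewrite fE //.
by rewrite -scalerAr -!scalerAl.
Qed.

End IdealOf.

Lemma finite_division_algebra_comm (K : finFieldType) (D : falgType K) :
  division_algebra D -> commutative (@GRing.mul D).
Proof.
move=> Dd; exact: (@finDomain_mulrC (finvect_type D) (division_algebra_domain Dd)).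
Qed.

(** In a rank factorization P = U V, U cancels on the left and V on the right, so P P = P gives V U
    = 1. Nonzero P makes the size a successor, as the matrix ring requires. *)
Lemma idempotent_mx_split (F : fieldType) N (P : 'M[F]_N) :
    P *m P = P -> P != 0 ->
  exists n (U : 'M_(N, n.+1)) (V : 'M_(n.+1, N)), P = U *m V /\ V *m U = 1%:M.
Proof.
move=> PP P0.
have: exists (U : 'M_(N, \rank P)) (V : 'M_(\rank P, N)),
    P = U *m V /\ V *m U = 1%:M.
  exists (col_base P), (row_base P).
  move: (mulmx_base P) (row_base_free P) (col_base_full P).
  move: (col_base P) (row_base P) => U V UV freeV fullU; split=> //.
  apply: (row_free_inj freeV); apply: (row_full_inj fullU).
  by rewrite mul1mx !mulmxA UV -mulmxA UV PP.
have: (0 < \rank P)%N by rewrite lt0n mxrank_eq0.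
by case: (\rank P) => // n _ [U [V UV]]; exists n, U, V.
Qed.

(* Morita equivalence: if c = sum_i x_i e y_i, the matrices (e y_i x x_j e)_ij
   over the field e A e form a corner P M_N P, and P splits by rank. *)
Section MatrixComponent.
Variables (K : fieldType) (A : falgType K) (c e : A).
Hypotheses (cC : forall x, c * x = x * c) (cc : c * c = c).
Hypothesis c_simple : forall x, x * c != 0 -> c \in ideal_of {:A} (x * c).
Hypotheses (ee : e * e = e) (e0 : e != 0) (ec : e * c = e).
Hypothesis e_comm : forall x y, e * x * e * y * e = e * y * e * x * e.

Lemma simple_component_matrix :
  exists (L : fieldExtType K) (n : nat) (f : A -> 'M[L]_n.+1),
    [/\ zmod_morphism f, {morph f : x y / x * y} & f c = 1]
    /\ [/\ forall a x, f (a *: x) = a%:A *: f x,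
           forall x, f x = 0 -> x * c = 0 & forall M, exists x, f x = M].
Proof.
pose eAe := corner_aspace (memvf e : e \in {:A}%AS) ee e0.
have eAeP x : e * x * e \in eAe.
  apply/(cornerP (memvf e : e \in {:A}%AS) ee); split; first exact: memvf.
  by rewrite !mulrA ee -!mulrA ee.
have [||L [phi [phi' phiK phi'K]]] := corner_field_exists (memvf e : e \in {:A}%AS) ee e0.
- by move=> x y _ _; apply: e_comm.
- move=> x _ xE x0; have xc : x * c = x by rewrite -xE -mulrA ec.
  have: c \in ideal_of {:A} (x * c) by rewrite c_simple ?xc.
  rewrite xc => /ideal_ofP[s cE].
  (* From c = sum p.1 x p.2, compression by e gives e as a sum of products of corner elements with x
     in the middle; commutativity of the corner pulls x to the front. *)
  exists (\sum_(p <- s) e * p.1 * e * (e * p.2 * e)); first exact: memvf.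
  transitivity (e * c * e); last by rewrite ec ee.
  rewrite cE mulr_sumr [in RHS]mulr_sumr mulr_suml; apply: eq_bigr => p _.
  have xx : x * e = x by rewrite -xE -mulrA ee.
  have -> : e * (p.1 * x * p.2) * e = e * p.1 * e * x * e * p.2 * e.
    by rewrite -{1}xE !mulrA.
  by rewrite e_comm xE cornerM // !mulrA xx.
have [j [j_inj jM j1 j_surj]] : exists j : {linear L -> A},
    [/\ injective j, {morph j : a b / a * b}, j 1 = e
      & forall x, exists a, j a = e * x * e].
  exists (vsval \o phi); split=> [a b /val_inj /(can_inj phiK)|a b||x] //=.
  - by rewrite rmorphM.
  - by rewrite rmorph1 /= algid_corner ?memvf.
  by exists (phi' (Subvs (eAeP x))); rewrite phi'K.
have [s cE] : exists s : seq (A * A), c = \sum_(p <- s) p.1 * e * p.2.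
  by apply: (@ideal_ofP _ _ {:A}); rewrite -ec c_simple ?ec.
pose N := size s; pose x_ (i : 'I_N) := (s`_i).1; pose y_ (i : 'I_N) := (s`_i).2.
have {}cE : c = \sum_i x_ i * e * y_ i.
  by rewrite cE (big_nth 0) big_mkord.
have [ji jiK] : {ji : A -> L & forall x, j (ji x) = e * x * e}.
  exact: (@choice _ _ (fun x a => j a = e * x * e)).
pose f0 x : 'M[L]_N := \matrix_(i, k) ji (y_ i * x * x_ k).
have f0M x y : f0 (x * y) = f0 x *m f0 y.
  apply/matrixP => i k; rewrite !mxE; apply: j_inj; rewrite jiK linear_sum /=.
  transitivity (e * y_ i * x * c * y * x_ k * e).
    have ecC z : e * c * z = e * z * c by rewrite -mulrA cC mulrA.
    by rewrite -(mulrA e (y_ i)) -ecC ec !mulrA.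
  rewrite cE !(mulr_sumr, mulr_suml); apply: eq_bigr => h _.
  by rewrite !mxE jM !jiK !mulrA -(mulrA _ e e) ee.
have f0B : zmod_morphism f0.
  move=> x y; apply/matrixP => i k; rewrite !mxE; apply: j_inj.
  by rewrite linearB /= !jiK mulrBr mulrBl mulrBr mulrBl.
have f0Z a x : f0 (a *: x) = a%:A *: f0 x.
  apply/matrixP => i k; rewrite !mxE; apply: j_inj.
  rewrite mulr_algl linearZ /= !jiK.
  by rewrite -(scalerAr, scalerAl) -!(scalerAr, scalerAl).
have c_corner x : c * x * c = \sum_i \sum_k x_ i * j (f0 x i k) * y_ k.
  rewrite {1}cE cE !mulr_suml; apply: eq_bigr => i _.
  rewrite mulr_sumr; apply: eq_bigr => k _.
  by rewrite mxE jiK !mulrA.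
have cxc x : c * x * c = x * c by rewrite cC -mulrA cc.
have f0inj x : f0 x = 0 -> x * c = 0.
  move=> fx0; rewrite -cxc c_corner big1 // => i _; rewrite big1 // => k _.
  by rewrite fx0 mxE linear0 mulr0 mul0r.
(* The image of [f0] is only the corner cut out by the idempotent [f0 1]; a preimage is obtained by
   putting the entries of M back between the x_i and the y_k. *)
have f0surj M : exists x, f0 x = f0 1 *m M *m f0 1.
  have jE a : j a = e * j a * e by rewrite -j1 -!jM mul1r mulr1.
  exists (\sum_i \sum_k x_ i * j (M i k) * y_ k).
  apply/matrixP => a b; rewrite !mxE; apply: j_inj; rewrite jiK linear_sum /=.
  under [RHS]eq_bigr => k _.
    rewrite mxE jM linear_sum /= mulr_suml.
    under eq_bigr => i _ do rewrite jM !mxE !jiK !mulr1.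
    over.
  rewrite exchange_big !(mulr_sumr, mulr_suml); apply: eq_bigr => i _.
  rewrite !(mulr_sumr, mulr_suml); apply: eq_bigr => k _.
  by rewrite [in LHS]jE !mulrA.
have f01 : f0 1 != 0.
  by apply: contra_neq e0 => /f0inj; rewrite mul1r -ec => ->; rewrite mulr0.
have [|n [U [V [fUV VU]]]] := idempotent_mx_split _ f01.
  by rewrite -f0M mulr1.
exists L, n, (fun x => V *m f0 x *m U); split; split.
- by move=> x y; rewrite f0B mulmxBr mulmxBl.
- move=> x y; have f0P : f0 x = f0 x *m (U *m V) by rewrite -fUV -f0M mulr1.
  by rewrite f0M {1}f0P -mulmxE !mulmxA.
- have -> : f0 c = f0 1.
    apply/matrixP => i k; rewrite !mxE; apply: j_inj; rewrite !jiK mulr1.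
    by rewrite -cC !mulrA ec.
  by rewrite fUV !mulmxA VU mul1mx VU.
- by move=> a x; rewrite f0Z -scalemxAr -scalemxAl.
- move=> x fx; apply: f0inj.
  have -> : f0 x = U *m (V *m f0 x *m U) *m V.
    by rewrite !mulmxA -fUV -f0M mul1r -mulmxA -fUV -f0M mulr1.
  by rewrite fx mulmx0 mul0mx.
move=> M; have [x fx] := f0surj (U *m M *m V).
exists x; rewrite fx fUV !mulmxA VU mul1mx VU mul1mx -!mulmxA.
by rewrite VU mulmx1 VU mulmx1.
Qed.
End MatrixComponent.

(** * Semisimplicity of group algebras *)

Section CentralDecomposition.
Variables (K : fieldType) (A : falgType K) (B : {aspace A}).
Implicit Types (c f x : A) (V : {vspace A}).
Hypothesis B1 : 1 \in B.

Definition central_idempotent c :=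
  [/\ c \in B, c * c = c & {in B, forall x, c * x = x * c}].

(** Primitivity is stated as simplicity of the block B f, not as indecomposability of f, because
    simplicity is what Morita equivalence uses. *)
Definition primitive_central f := [/\ central_idempotent f, f != 0
  & {in B, forall x, x * f != 0 -> f \in ideal_of B (x * f)}].

Hypothesis B_ss : forall V, (V <= B)%VS -> (B * V <= V)%VS -> (V * B <= V)%VS ->
  exists2 c, central_idempotent c & c \in V /\ {in V, forall x, x * c = x}.

(** Induction on dim (c B). If c is not primitive, the ideal generated by some nonzero x c misses c;
    by semisimplicity that ideal has a central identity c1, and c = c1 + (c - c1) splits c B into
    two strictly smaller blocks. *)
Lemma central_decomposition c : central_idempotent c ->
  exists2 s : seq A, uniq s /\ c = \sum_(f <- s) f
    & {in s, forall f, primitive_central f /\ f * c = f}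
      /\ {in s &, forall f g, f != g -> f * g = 0}.
Proof.
have [n] := ubnP (\dim (<[c]> * B)); elim: n c => // n IHn c dim_c cI.
have [cB cc cC] := cI.
have [->|c0] := eqVneq c 0; first by exists [::]; split; rewrite ?big_nil.
have [c_simple|] :=
    pselect {in B, forall x, x * c != 0 -> c \in ideal_of B (x * c)}.
  exists [:: c]; rewrite ?big_seq1 //; split=> [f|f g].
    by rewrite inE => /eqP ->; rewrite cc.
  by rewrite !inE => /eqP -> /eqP ->; rewrite eqxx.
move=> /existsNP[x /not_implyP[xB /not_implyP[xc0 /negP cI'']]].
set I := ideal_of B _ in cI''.
have IB : (I <= B)%VS.
  apply: prodv_sub => //; apply: prodv_sub => //.
  by rewrite -memvE memvM.
have [||c1 c1I [c1V c1r]] := B_ss IB.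
  by rewrite /I /ideal_of !prodvA prodv_id.
  by rewrite /I /ideal_of -prodvA prodv_id.
have [c1B c1c1 c1C] := c1I.
have xcI : x * c \in I by rewrite -[x * c]mul1r -[_ * _]mulr1 mem_ideal_of.
have c1c : c1 * c = c1.
  pose U := lker (amulr c - \1)%VF.
  have UP y : reflect (y * c = y) (y \in U).
    by rewrite memv_ker !lfun_simp subr_eq0; apply: eqP.
  suff /subvP/(_ _ c1V)/UP : (I <= U)%VS by [].
  apply/prodvP => u v uX vB; apply/UP; rewrite -mulrA -cC // mulrA.
  congr (_ * _); apply/UP; move: u uX; apply/subvP/prodvP => u w uB.
  by move=> /vlineP[k ->]; apply/UP; rewrite -mulrA -scalerAl -mulrA cc.
have cc1 : c * c1 = c1 by rewrite cC.
have c1_neq0 : c1 != 0.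
  by apply: contra_neq xc0 => c10; rewrite -(c1r _ xcI) c10 mulr0.
have c1_neqc : c1 != c by apply: contraNneq cI'' => <-.
pose c2 := c - c1.
have c2I : central_idempotent c2.
  split; first by rewrite rpredB.
    by rewrite mulrBl !mulrBr cc cc1 c1c c1c1 subrr subr0.
  by move=> y yB; rewrite mulrBl mulrBr cC // c1C.
have [c2B c2c2 c2C] := c2I.
have c12 : c1 * c2 = 0 by rewrite mulrBr c1c c1c1 subrr.
have c21 : c2 * c1 = 0 by rewrite mulrBl cc1 c1c1 subrr.
have c2c : c2 * c = c2 by rewrite mulrBl cc c1c.
have cc2 : c * c2 = c2 by rewrite cC.
have dimlt d : d \in B -> c * d = d -> d * c = d -> d * d = d -> d != c ->
    (\dim (<[d]> * B) < n)%N.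
  move=> dB cd dc dd d_neqc; rewrite -ltnS (leq_trans _ dim_c) // ltnS.
  have dcB : (<[d]> * B <= <[c]> * B)%VS.
    apply/prodvP => _ y /vlineP[k ->] yB; rewrite -cd -scalerAl.
    by rewrite -mulrA memvZ ?memv_mul ?memv_line ?memvM.
  rewrite ltn_neqAle dimvS // (dimv_leqif_sup dcB) andbT.
  apply: contra_neqN d_neqc => /subvP/(_ c); rewrite -{1}[c]mulr1.
  rewrite memv_mul ?memv_line // => /(_ isT) c_dB.
  suff /subvP/(_ _ c_dB) : (<[d]> * B <= lker (amull d - \1)%VF)%VS.
    by rewrite memv_ker !lfun_simp subr_eq0 /= dc => /eqP.
  apply/prodvP => _ y /vlineP[k ->] _.
  by rewrite memv_ker !lfun_simp subr_eq0 /= -!scalerAl -scalerAr mulrA dd.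
have [s1 [s1u s1E] [s1P s1O]] := IHn c1 (dimlt _ c1B cc1 c1c c1c1 c1_neqc) c1I.
have c2_neqc : c2 != c by rewrite /c2 -subr_eq0 addrAC subrr sub0r oppr_eq0.
have [s2 [s2u s2E] [s2P s2O]] := IHn c2 (dimlt _ c2B cc2 c2c c2c2 c2_neqc) c2I.
have s12O f g : f \in s1 -> g \in s2 -> f * g = 0.
  move=> /s1P[[[fB _ fC] _ _] fc1] /s2P[[[gB _ gC] _ _] gc2].
  by rewrite -fc1 -gc2 gC // mulrA -(mulrA f) c12 mulr0 mul0r.
exists (s1 ++ s2); split.
- rewrite cat_uniq s1u s2u andbT; apply/hasPn => f fs2; apply/negP => fs1.
  have [[[_ ff _] f0 _] _] := s1P f fs1.
  by case/eqP: f0; rewrite -ff s12O.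
- by rewrite big_cat -s1E -s2E /= addrC subrK.
- move=> f; rewrite mem_cat => /orP[/s1P|/s2P] [fP ff]; split=> //.
    by rewrite -ff -mulrA c1c.
  by rewrite -ff -mulrA c2c.
move=> f g; rewrite !mem_cat => /orP[fs|fs] /orP[gs|gs] fg.
- exact: s1O.
- exact: s12O.
- have [[[fB _ fC] _ _] _] := s2P f fs.
  have [[[gB _ _] _ _] _] := s1P g gs.
  by rewrite fC // s12O.
exact: s2O.
Qed.
End CentralDecomposition.

Section GroupElements.
Variables (K : fieldType) (gT : finGroupType).
Local Notation A := (group_algebra K gT).
Implicit Types (g h : gT) (x y : A) (V : {vspace A}) (H : {group gT}).

Definition gelt g : A := [ffun h => (h == g)%:R].

Lemma gelt1 : gelt 1%g = 1. Proof. by []. Qed.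

Lemma geltM g h : gelt (g * h)%g = gelt g * gelt h.
Proof.
apply/ffunP => k; rewrite !ffunE (bigD1 g) //= big1 => [|j /negbTE jg].
  by rewrite !ffunE eqxx mul1r addr0 -(inj_eq (mulgI g^-1%g)) mulKg.
by rewrite ffunE jg mul0r.
Qed.

Lemma geltKV g : gelt g * gelt g^-1 = 1.
Proof. by rewrite -geltM mulgV. Qed.

Lemma geltVK g : gelt g^-1 * gelt g = 1.
Proof. by rewrite -geltM mulVg. Qed.

Lemma gelt_sum x : x = \sum_g x g *: gelt g.
Proof.
apply/ffunP => h; rewrite sum_ffunE (bigD1 h) //= big1 => [|g gh].
  by rewrite !ffunE eqxx addr0 [_ *: _]mulr1.
by rewrite !ffunE eq_sym (negbTE gh) [_ *: _]mulr0.
Qed.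

(** The group algebra of H, realized inside that of the ambient group so that elements outside H can
    act on it by conjugation. *)
Definition gspan H : {vspace A} := <<[seq gelt h | h in H]>>%VS.

Lemma mem_gspan H h : h \in H -> gelt h \in gspan H.
Proof. by move=> hH; rewrite memv_span // image_f. Qed.

Lemma gspan_ind H (P : A -> Prop) : P 0 -> (forall a x y, P x -> P y -> P (a *: x + y)) ->
  (forall h, h \in H -> P (gelt h)) -> forall x, x \in gspan H -> P x.
Proof.
move=> P0 PD Pg x; rewrite /gspan => /(@coord_span _ _ _ (in_tuple _)) ->.
elim/big_rec: _ => // i y _ Py; apply: PD => //.
have: [seq gelt h | h in H]`_i \in [seq gelt h | h in H] by rewrite mem_nth.
by case/imageP => h hH ->; apply: Pg.
Qed.

Lemma gspanP H x : reflect (forall g, g \notin H -> x g = 0) (x \in gspan H).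
Proof.
apply: (iffP idP) => [xH g gH|x0].
  move: x xH; apply: gspan_ind => [|a x y xg yg|h hH]; rewrite !ffunE //.
    by rewrite xg yg scaler0 addr0.
  by have [gh|//] := eqVneq g h; rewrite gh hH in gH.
rewrite [x]gelt_sum (bigID (mem H)) /= [X in _ + X]big1 ?addr0 => [|g /x0 ->].
  by rewrite rpred_sum // => h hH; rewrite memvZ ?mem_gspan.
by rewrite scale0r.
Qed.

Lemma gspanT : gspan [set: gT]%G = fullv.
Proof.
apply/eqP; rewrite eqEsubv subvf; apply/subvP => x _.
by apply/gspanP => g; rewrite inE.
Qed.

Lemma gspan_aspace_subproof H : is_aspace (gspan H).
Proof.
apply/andP; split; first by rewrite has_algid1 // -gelt1 mem_gspan.
apply/prodvP => x y xH yH; move: x xH; apply: gspan_ind => [|a x z xyH zyH|h hH].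
- by rewrite mul0r mem0v.
- by rewrite mulrDl -scalerAl memvD ?memvZ.
move: y yH; apply: gspan_ind => [|a x z xyH zyH|k kH].
- by rewrite mulr0 mem0v.
- by rewrite mulrDr -scalerAr memvD ?memvZ.
by rewrite -geltM mem_gspan ?groupM.
Qed.

Definition gspan_aspace H : {aspace A} := ASpace (gspan_aspace_subproof H).

Lemma gspan1 H : 1 \in gspan H. Proof. by rewrite -gelt1 mem_gspan. Qed.

Section Maschke.
Variables (H : {group gT}) (V : {vspace A}).
Hypotheses (nzH : #|H|%:R != 0 :> K) (VH : (V <= gspan H)%VS).

(** Maschke: averaging a linear projector onto V over H makes it right H-linear, and such a map is
    left multiplication by its value at 1. *)
Lemma right_ideal_idempotent :
  {in V & H, forall x h, x * gelt h \in V} ->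
  exists2 c, c \in V & {in V, forall x, c * x = x}.
Proof.
move=> V_r; pose pi := projv V.
pose P x := #|H|%:R^-1 *: \sum_(h in H) pi (x * gelt h) * gelt h^-1.
have P_linear : linear P.
  move=> a x y; rewrite /P scalerA mulrC -scalerA -scalerDr; congr (_ *: _).
  rewrite scaler_sumr -big_split; apply: eq_bigr => h _ /=.
  by rewrite mulrDl linearD -scalerAl linearZ mulrDl -scalerAl.
have PV x : P x \in V.
  rewrite memvZ // rpred_sum // => h hH.
  by rewrite V_r ?groupV // memv_proj.
have PM x k : k \in H -> P (x * gelt k) = P x * gelt k.
  move=> kH; rewrite /P -scalerAl mulr_suml; congr (_ *: _).
  rewrite [RHS](reindex_inj (mulgI k)) /=; apply: eq_big => [h|h _].
    by rewrite groupMl.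
  by rewrite -!mulrA -!geltM invMg mulgKV.
have P_id x : x \in V -> P x = x.
  move=> xV; rewrite /P (eq_bigr (fun _ => x)) => [|h hH].
    by rewrite sumr_const -scaler_nat scalerA mulVf // scale1r.
  by rewrite projv_id ?V_r // -mulrA geltKV mulr1.
exists (P 1); first exact: PV.
move=> x xV; rewrite -[RHS]P_id //; have {xV} := subvP VH _ xV; move: x.
pose pP := GRing.isLinear.Build K A A _ P P_linear.
pose lP : {linear A -> A} := HB.pack P pP.
apply: gspan_ind => [|a x y xE yE|h hH].
- by rewrite mulr0 -[P]/(lP : _ -> _) linear0.
- by rewrite mulrDr -scalerAr xE yE P_linear.
by rewrite -PM // mul1r.
Qed.
End Maschke.

(** The linear extension of g |-> g^-1, that is, the positive involution of the group algebra when K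
    is the field of rationals. *)
Definition star x : A := [ffun g => x g^-1%g].

Fact star_is_linear : linear star.
Proof. by move=> a x y; apply/ffunP => g; rewrite !ffunE. Qed.

HB.instance Definition _ := GRing.isLinear.Build K A A _ star star_is_linear.

Lemma starK : involutive star.
Proof. by move=> x; apply/ffunP => g; rewrite !ffunE invgK. Qed.

Lemma starM x y : star (x * y) = star y * star x.
Proof.
apply/ffunP => g; rewrite !ffunE [RHS](reindex_inj (mulgI g)) /=.
apply: eq_bigr => h _; rewrite !ffunE mulrC !invMg !invgK.
by rewrite mulKg.
Qed.

Lemma star_gelt g : star (gelt g) = gelt g^-1.
Proof. by apply/ffunP => h; rewrite !ffunE -eq_invg_sym. Qed.

Lemma star_gspan H x : x \in gspan H -> star x \in gspan H.
Proof. by move/gspanP => x0; apply/gspanP => g gH; rewrite ffunE x0 ?groupV. Qed.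

Lemma left_ideal_idempotent H V : #|H|%:R != 0 :> K -> (V <= gspan H)%VS ->
    {in V & H, forall x h, gelt h * x \in V} ->
  exists2 c, c \in V & {in V, forall x, x * c = x}.
Proof.
move=> nzH VH V_l.
have [||c] := @right_ideal_idempotent H (linfun star @: V)%VS nzH.
- by apply/subvP => _ /memv_imgP[x /(subvP VH) xH ->]; rewrite lfunE star_gspan.
- move=> _ h /memv_imgP[x xV ->] hH; rewrite lfunE /=.
  apply/memv_imgP; exists (gelt h^-1 * x); first by rewrite V_l ?groupV.
  by rewrite lfunE /= starM star_gelt invgK.
move=> /memv_imgP[d dV ->] dP; exists d => // x xV; apply: (inv_inj starK).
rewrite starM -[star d](lfunE star) dP //.
by apply/memv_imgP; exists x; rewrite ?lfunE.
Qed.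

(** A two-sided ideal has a left identity d and a right identity c. Then d = d c = c, and c x = c x
    c = x c shows that c is central. *)
Lemma gspan_semisimple H V : #|H|%:R != 0 :> K ->
    (V <= gspan H)%VS -> (gspan H * V <= V)%VS -> (V * gspan H <= V)%VS ->
  exists2 c, central_idempotent (gspan_aspace H) c
    & c \in V /\ {in V, forall x, x * c = x}.
Proof.
move=> nzH VH Vl Vr; have {}Vl x y : x \in gspan H -> y \in V -> x * y \in V.
  by move=> xH yV; rewrite (subvP Vl) ?memv_mul.
have {}Vr x y : x \in gspan H -> y \in V -> y * x \in V.
  by move=> xH yV; rewrite (subvP Vr) ?memv_mul.
have [|d dV dP] := @right_ideal_idempotent H V nzH VH.
  by move=> x h xV hH; rewrite Vr ?mem_gspan.
have [|c cV cP] := @left_ideal_idempotent H V nzH VH.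
  by move=> x h xV hH; rewrite Vl ?mem_gspan.
have dc : d = c by rewrite -[LHS]cP // dP.
exists c => //; split=> [||x xH]; first by rewrite (subvP VH).
  exact: cP.
by rewrite -[LHS]cP ?Vr // -mulrA -{1}dc dP ?Vl.
Qed.

End GroupElements.

Lemma memv_line_mulP (K : fieldType) (A : falgType K) (U : {vspace A}) (v w : A) :
  reflect (exists2 u, u \in U & w = v * u) (w \in (<[v]> * U)%VS).
Proof.
apply: (iffP idP) => [/mem_prodvP[s sP ->]|[u uU ->]]; last first.
  by rewrite memv_mul ?memv_line.
rewrite big_seq; elim/big_rec: _ => [|p _ ps [u uU ->]].
  by exists 0; rewrite ?mem0v ?mulr0.
have [/vlineP[k ->] p2U] := sP p ps; exists (k *: p.2 + u).
  by rewrite memvD ?memvZ.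
by rewrite mulrDr -scalerAr scalerAl.
Qed.

(** Take e below f with dim (e B) minimal. For a = e x e nonzero, the right ideal a B is generated
    by an idempotent c of e B, and minimality forces c B = e B, so e lies in a B. The corner e B e
    is thus a division ring. *)
Lemma minimal_idempotent (K : fieldType) (A : falgType K) (B : {aspace A}) (f : A) :
    1 \in B ->
    (forall V : {vspace A}, (V <= B)%VS -> (V * B <= V)%VS ->
       exists2 c, c \in V & {in V, forall x, c * x = x}) ->
    central_idempotent B f -> f != 0 ->
  exists e, [/\ e \in B, e * e = e, e != 0, e * f = e
    & {in B, forall x, e * x * e != 0 -> exists2 y, y \in B & e * x * e * y = e}].
Proof.
move=> B1 Bss [fB ff fC] f0.
pose P n := `[< exists e, [/\ e \in B, e * e = e, e != 0, e * f = e
  & \dim (<[e]> * B) = n] >].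
have [|n /asboolP[e [eB ee e0 ef dim_e]] n_min] := @ex_minnP P.
  by exists (\dim (<[f]> * B)); apply/asboolP; exists f.
exists e; split=> // x xB exe0; set a := e * x * e in exe0 *.
have aB : a \in B by rewrite !memvM.
have VB : (<[a]> * B <= B)%VS by rewrite prodv_sub // -memvE.
have [|c cV cP] := Bss _ VB; first by rewrite -prodvA prodv_id.
have cB := subvP VB _ cV.
have aV : a \in (<[a]> * B)%VS by rewrite -{1}[a]mulr1 memv_mul ?memv_line.
have c0 : c != 0 by apply: contra_neq exe0 => c0; rewrite -[a]cP // c0 mul0r.
have /memv_line_mulP[b bB cE] := cV.
have cf : c * f = c.
  by rewrite cE -mulrA -fC // mulrA -[a * f]mulrA ef.
have cB_eB : (<[c]> * B <= <[e]> * B)%VS.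
  apply/prodvP => _ y /vlineP[k ->] yB; rewrite -scalerAl cE /a -!mulrA.
  by rewrite memvZ ?memv_mul ?memv_line ?memvM.
have cc : c * c = c by rewrite cP.
have: (n <= \dim (<[c]> * B))%N by apply: n_min; apply/asboolP; exists c.
rewrite -dim_e (geq_leqif (dimv_leqif_sup cB_eB)) => /subvP/(_ e).
rewrite -{1}[e]mulr1 memv_mul ?memv_line // => /(_ isT) /memv_line_mulP[y yB eE].
by exists (b * y); rewrite ?memvM // mulrA -cE.
Qed.

(** * Idempotents of crossed products over finite fields *)

Section IdealOfMul.
Variables (K : fieldType) (A : falgType K) (B : {aspace A}).

Lemma ideal_ofMr a x y : x \in ideal_of B a -> y \in B -> x * y \in ideal_of B a.
Proof.
move=> xI yB; have: x * y \in (ideal_of B a * B)%VS by rewrite memv_mul.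
by rewrite /ideal_of -prodvA prodv_id.
Qed.

Lemma ideal_ofMl a x y : x \in ideal_of B a -> y \in B -> y * x \in ideal_of B a.
Proof.
move=> xI yB; have: y * x \in (B * ideal_of B a)%VS by rewrite memv_mul.
by rewrite /ideal_of !prodvA prodv_id.
Qed.
End IdealOfMul.

(** Here f = 3 e^2 - 2 e^3 is the Newton step for X^2 - X, and the identity shows that it squares
    the error. Since D may be noncommutative, the computation is done in K[X] and specialized at
    e. *)
Lemma newton_idempotent_identity (K : fieldType) (D : falgType K) (e : D) :
  let r := e * e - e in let f := e + r * (1 - 2%:R * e) in
  f * f - f = r * r * (4%:R * r - 3%:R).
Proof.
pose r : {poly K} := 'X * 'X - 'X.
pose f := 'X + r * (1 - 2%:R * 'X); pose h := 4%:R * r - 3%:R.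
have rE : horner_alg e r = e * e - e by rewrite rmorphB rmorphM /= horner_algX.
have fE : horner_alg e f = e + (e * e - e) * (1 - 2%:R * e).
  rewrite rmorphD rmorphM /= horner_algX rE rmorphB rmorph1 rmorphM /=.
  by rewrite horner_algX rmorph_nat.
have hE : horner_alg e h = 4%:R * (e * e - e) - 3%:R.
  by rewrite rmorphB rmorphM /= rE !rmorph_nat.
move=> r' f'; rewrite -/r' in rE fE hE; rewrite -/f' in fE.
rewrite -hE -rE -fE -!rmorphM -rmorphB; congr (horner_alg e _).
rewrite /f /h /r; ring.
Qed.

(** Each Newton step squares the error, but only one more factor n is recorded per round. The n of
    the application is nilpotent, so finitely many rounds give an exact idempotent congruent to e0
    modulo n. *)
Lemma idempotent_lift (K : fieldType) (D : falgType K) (n e0 : D) k :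
    (forall x, n * x = x * n) -> (exists w, e0 * e0 - e0 = n * w) ->
  exists e, (exists w, e = e0 + n * w) /\ (exists w, e * e - e = n ^+ k.+1 * w).
Proof.
move=> nC e0E; elim: k => [|k [e [[w eE] [v reE]]]].
  by exists e0; split; first by exists 0; rewrite mulr0 addr0.
have := newton_idempotent_identity e; cbv zeta.
set r := e * e - e; set g := 1 - _ * e; set f := e + r * g; set h := _ - 3%:R => rfE.
clearbody g; exists f; split.
  exists (w + n ^+ k * v * g); rewrite /f /r reE eE mulrDr addrA exprS !mulrA.
  by [].
have nkC x : n ^+ k.+1 * x = x * n ^+ k.+1 by apply/esym/commrX; rewrite /GRing.comm nC.
exists (n ^+ k * v * v * h); rewrite rfE /r reE !mulrA; congr (_ * _).
rewrite -(mulrA _ v) -nkC !mulrA -!exprD; congr (_ ^+ _ * _ * _).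
by rewrite addSnnS addnC.
Qed.

(** The generator x commutes with e but may lie outside the corner: every element of e D e is a
    polynomial in x times e. *)
Definition monogenic_corner (K : fieldType) (D : falgType K) (e x : D) :=
  x * e = e * x /\ forall y, e * y * e \in (agenv <[x]> * <[e]>)%VS.

(* D is a crossed product of the finite field F by a cyclic l-group. If sigma has
   order d, then z = s ^ d is central and unipotent; modulo the nilpotent z - 1
   the element j a * N, with N = 1 + s + ... + s ^ (d - 1) and a of trace 1, is
   an idempotent whose corner is the fixed field of sigma. *)
Section SkewCyclic.
Variables (K : fieldType) (D : falgType K) (F : finFieldType).
Variables (j : {rmorphism F -> D}) (s : D) (sigma : {rmorphism F -> F}).
Variables (l b : nat).
Hypotheses (l_pr : prime l) (charK : l \in [pchar K]).
Local Notation M := (l ^ b)%N.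
Hypotheses (sj : forall a, s * j a = j (sigma a) * s) (sM : s ^+ M = 1).
Hypothesis D_gen : forall y, exists c : 'I_M -> F, y = \sum_i j (c i) * s ^+ i.

Let M_gt0 : (0 < M)%N. Proof. by rewrite expn_gt0 prime_gt0. Qed.

Let charD : l \in [pchar D].
Proof. by rewrite pchar_lalg. Qed.

Let charF : l \in [pchar F].
Proof. by rewrite -(fmorph_pchar j). Qed.

Lemma skew_exp i a : s ^+ i * j a = j (iter i sigma a) * s ^+ i.
Proof.
elim: i a => [|i IHi] a; first by rewrite expr0 mul1r mulr1.
by rewrite exprSr -mulrA sj mulrA IHi -mulrA -exprSr iterSr.
Qed.

Let sigmaM a : iter M sigma a = a.
Proof. by apply: (fmorph_inj j); have := skew_exp M a; rewrite sM mul1r mulr1. Qed.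

Let d := ex_minn (ex_intro (fun n => (0 < n)%N && [forall a, iter n sigma a == a])
  M (introT andP (conj M_gt0 (introT forallP (fun a => introT eqP (sigmaM a)))))).

Let d_gt0 : (0 < d)%N.
Proof. by rewrite /d; case: ex_minnP => m /andP[]. Qed.

Let sigmad a : iter d sigma a = a.
Proof. by rewrite /d; case: ex_minnP => m /andP[_ /forallP/(_ a)/eqP]. Qed.

Let sigma_min i : (0 < i < d)%N -> exists a, iter i sigma a != a.
Proof.
rewrite /d; case: ex_minnP => m /andP[_ _] m_min /andP[i0 im].
apply/existsP; rewrite -negb_forall; apply: contraL im => all_i.
by rewrite -leqNgt m_min // i0.
Qed.

Let z := s ^+ d.
Let n := locked (z - 1).
Let N := \sum_(i < d) s ^+ i.

Let nE : n = z - 1. Proof. by rewrite /n -lock. Qed.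

Let zC x : z * x = x * z.
Proof.
have [c ->] := D_gen x; rewrite mulr_sumr mulr_suml; apply: eq_bigr => i _.
by rewrite mulrA skew_exp sigmad -!mulrA -!exprD addnC.
Qed.

Let nC x : n * x = x * n. Proof. by rewrite nE mulrBl mulrBr zC mulr1 mul1r. Qed.

Let zM : z ^+ M = 1. Proof. by rewrite -exprM mulnC exprM sM expr1n. Qed.

(** Iterated Frobenius: in characteristic l, (z - 1)^(l^b) = z^(l^b) - 1. *)
Let nM : n ^+ M = 0.
Proof.
suff -> : n ^+ M = z ^+ M - 1 by rewrite zM subrr.
rewrite nE; elim: (b) => [|k IHk]; first by rewrite !expr1.
rewrite expnSr !exprM IHk -!(pFrobenius_autE charD).
by rewrite pFrobenius_autB_comm ?pFrobenius_aut1 //; apply: commr1.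
Qed.

Let sN : s * N = N + n.
Proof.
rewrite nE /z subrX1 -/N.
by rewrite mulrBl mul1r addrC subrK.
Qed.

Let in_n x y := exists w, x = y + n * w.

Let siN i : in_n (s ^+ i * N) N.
Proof.
elim: i => [|i [w IHi]]; first by exists 0; rewrite mulr0 addr0 mul1r.
exists (1 + s * w); rewrite exprS -mulrA IHi mulrDr sN mulrDr mulr1 -[N + n + _]addrA.
by rewrite [s * (n * w)]mulrA -nC -[n * s * w]mulrA.
Qed.

Let Tr a := \sum_(i < d) iter i sigma a.

Let NaN a : in_n (N * j a * N) (j (Tr a) * N).
Proof.
have /fin_all_exists[w wE] (i : 'I_d) := siN i.
exists (\sum_(i < d) j (iter i sigma a) * w i).
rewrite {1}/N !mulr_suml rmorph_sum mulr_suml mulr_sumr -big_split /=.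
apply: eq_bigr => i _; rewrite skew_exp -mulrA wE mulrDr.
by rewrite !mulrA nC.
Qed.

(* Commutators with F kill the terms of N one by one until a single unit of F is
   left, because the iterates sigma ^ i, i < d, are distinct. *)
Let N_full : 1 \in ideal_of {:D} N.
Proof.
have kill k : (k < d)%N -> exists c : nat -> F, [/\ c 0%N != 0,
    forall i, (0 < i <= k)%N -> c i = 0
    & \sum_(i < d) j (c i) * s ^+ i \in ideal_of {:D} N].
  elim: k => [_|k IHk kd].
    exists (fun=> 1); split=> [|i|]; rewrite ?oner_eq0 //.
      by case/andP => i0; rewrite leqNgt i0.
    under eq_bigr do rewrite rmorph1 mul1r.
    by rewrite -/N -[X in X \in _]mulr1 -[X in X * 1]mul1r mem_ideal_of ?memvf.
  have [c [c0 ck cI]] := IHk (ltnW kd).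
  have [a aE] : exists a, iter k.+1 sigma a != a by apply: sigma_min.
  exists (fun i => c i * (iter k.+1 sigma a - iter i sigma a)); split.
  - by rewrite mulf_neq0 // subr_eq0.
  - move=> i /andP[i0]; rewrite leq_eqVlt => /predU1P[->|ik].
      by rewrite subrr mulr0.
    by rewrite ck ?mul0r // i0.
  set X := \sum_(i < d) _ in cI.
  suff -> : \sum_(i < d) j (c i * (iter k.+1 sigma a - iter i sigma a)) * s ^+ i
      = j (iter k.+1 sigma a) * X - X * j a.
    by rewrite memvB ?(ideal_ofMr cI) ?(ideal_ofMl cI) ?memvf.
  rewrite /X mulr_sumr mulr_suml -sumrB; apply: eq_bigr => i _.
  rewrite -mulrA skew_exp !mulrA -mulrBl -!rmorphM -rmorphB /=.
  by congr (j _ * _); ring.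
have [|c [c0 ck cI]] := kill d.-1; first by rewrite prednK.
have: \sum_(i < d) j (c i) * s ^+ i = j (c 0%N).
  rewrite (bigD1 (Ordinal d_gt0)) //= mulr1 big1 ?addr0 // => i i0.
  rewrite ck ?rmorph0 ?mul0r // lt0n -ltnS prednK // ltn_ord andbT.
  by apply: contra_neq i0 => i0; apply: val_inj.
move=> cE; rewrite cE in cI.
by rewrite -(rmorph1 j) -(mulfV c0) rmorphM (ideal_ofMr cI) ?memvf.
Qed.

Let sigma_Tr a : sigma (Tr a) = Tr a.
Proof.
apply: (addIr (iter 0 sigma a)); rewrite rmorph_sum /= addrC.
rewrite -(big_ord_recl d (fun i => iter i sigma a)) big_ord_recr /=.
by rewrite sigmad.
Qed.

Let NyN y : exists2 t, sigma t = t & in_n (N * y * N) (j t * N).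
Proof.
have [c ->] := D_gen y; exists (\sum_i Tr (c i)).
  by rewrite rmorph_sum; apply: eq_bigr => i _; apply: sigma_Tr.
have step (i : 'I_M) : in_n (N * (j (c i) * s ^+ i) * N) (j (Tr (c i)) * N).
  have [w wE] := siN i; have [v vE] := NaN (c i).
  exists (v + N * j (c i) * w); rewrite -!mulrA wE mulrDr mulrDr !mulrA vE.
  by rewrite -!nC -!mulrA -addrA -mulrDr.
have [w wE] := fin_all_exists step; exists (\sum_i w i).
rewrite mulr_sumr mulr_suml rmorph_sum mulr_suml mulr_sumr -big_split /=.
by apply: eq_bigr => i _; rewrite wE.
Qed.

Let not_in_n : ~ in_n 1 0.
Proof.
case=> w; rewrite add0r => nw; have /eqP := oner_neq0 D; apply.
by rewrite -(expr1n _ M) nw exprMn_comm ?nM ?mul0r //; apply: nC.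
Qed.

(** If all traces vanished, N y N would lie in n D for every y. As 1 is a sum of terms p N q, the
    product 1 * 1 would then lie in n D, which is impossible because n is central and nilpotent. A
    nonzero trace is normalized by dividing by it, since it is fixed by [sigma]. *)
Let Tr1 : exists a, Tr a = 1.
Proof.
have [[a a0]|Tr0] := pselect (exists a, Tr a != 0).
  have TrS : sigma (Tr a) = Tr a by apply: sigma_Tr.
  exists (a / Tr a); rewrite /Tr -[RHS](mulfV a0) mulr_suml.
  apply: eq_bigr => i _; elim: (i : nat) => //= k ->.
  by rewrite rmorphM fmorphV TrS.
have {Tr0} NaN0 c : in_n (N * j c * N) 0.
  have [w ->] := NaN c; exists w; rewrite (_ : Tr c = 0) ?rmorph0 ?mul0r //.
  by apply: contrapT => /eqP c0; apply: Tr0; exists c.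
have NyN0 y : in_n (N * y * N) 0.
  have [c ->] := D_gen y.
  have step (i : 'I_M) : in_n (N * (j (c i) * s ^+ i) * N) 0.
    have [w wE] := siN i; have [v vE] := NaN0 (c i).
    exists (v + N * j (c i) * w); rewrite -!mulrA wE !mulrA mulrDr vE !add0r.
    by rewrite !mulrA -(nC (N * j (c i))) -!mulrA -mulrDr.
  have [w wE] := fin_all_exists step; exists (\sum_i w i).
  rewrite mulr_sumr mulr_suml mulr_sumr add0r.
  by apply: eq_bigr => i _; rewrite wE add0r.
case: not_in_n; have [r r1] := ideal_ofP N_full.
have in_n_sum (I : Type) (u : seq I) (f : I -> D) :
    (forall i, in_n (f i) 0) -> in_n (\sum_(i <- u) f i) 0.
  move=> fE; have [w wE] := @choice _ _ (fun i w => f i = 0 + n * w) fE.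
  exists (\sum_(i <- u) w i); rewrite mulr_sumr add0r.
  by apply: eq_bigr => i _; rewrite wE add0r.
have -> : 1 = (\sum_(p <- r) p.1 * N * p.2) * (\sum_(p <- r) p.1 * N * p.2).
  by rewrite -r1 mulr1.
rewrite mulr_suml; apply: (in_n_sum) => p; rewrite mulr_sumr.
apply: (in_n_sum) => q.
have [w wE] := NyN0 (p.2 * q.1); exists (p.1 * w * q.2).
rewrite add0r in wE; rewrite add0r.
transitivity (p.1 * (N * (p.2 * q.1) * N) * q.2); first by rewrite !mulrA.
by rewrite wE !mulrA -(nC p.1).
Qed.

Let fixed_unit_generator :
  exists g, [/\ sigma g = g, g != 0
    & forall c, sigma c = c -> c != 0 -> exists i, c = g ^+ i].
Proof.
pose G := [set u : {unit F} | sigma (val u) == val u].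
have G_grp : group_set G.
  apply/group_setP; split=> [|u v]; rewrite !inE ?rmorph1 //.
  by move=> /eqP uE /eqP vE; rewrite rmorphM uE vE.
have /cyclicP[g gE] := field_unit_group_cyclic (group G_grp).
have gG : g \in G by rewrite -[G]/(gval (group G_grp)) gE cycle_id.
exists (val g); split=> [||c cS c0]; first by move: gG; rewrite inE => /eqP.
  by rewrite -unitfE (valP g).
have cU : c \is a GRing.unit by rewrite unitfE.
have : FinRing.unit F cU \in G by rewrite inE /= cS.
rewrite -[G]/(gval (group G_grp)) gE => /cycleP[i cE]; exists i.
by have := congr1 val cE; rewrite /= FinRing.val_unitX.
Qed.

Lemma skew_cyclic_monogenic_idempotent :
  exists e x, [/\ e * e = e, monogenic_corner e x & 1 \in ideal_of {:D} e].
Proof.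
have [a Tra] := Tr1.
pose e0 := j a * N.
have e0E y : exists2 t, sigma t = t & in_n (e0 * y * e0) (j t * e0).
  have [t tE [w wE]] := NyN (y * j a); exists t => //; exists (j a * w).
  rewrite /e0 -!mulrA (mulrA y) (mulrA N) wE mulrDr !mulrA -rmorphM mulrC.
  by rewrite rmorphM -nC.
have e0_idem : in_n (e0 * e0) e0.
  have [w wE] := NaN a; exists (j a * w).
  rewrite /e0 -mulrA (mulrA N) wE Tra rmorph1 mul1r mulrDr.
  by rewrite [j a * (n * w)]mulrA -(nC (j a)) -[n * j a * w]mulrA.
have [|e [[w1 eE] [w2 e_idem]]] := @idempotent_lift _ _ n e0 M nC.
  by have [w wE] := e0_idem; exists w; rewrite wE addrC addKr.
have ee : e * e = e.
  by apply/eqP; rewrite -subr_eq0 e_idem exprS nM mulr0 mul0r.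
have [g [gS g0 g_gen]] := fixed_unit_generator.
(* g has order prime to l and z has order a power of l, so that by the Chinese
   remainder theorem the powers of x include every g ^ i * z ^ k. *)
pose x := j g * z.
have jC t : sigma t = t -> forall y, j t * y = y * j t.
  move=> tS y; have [c ->] := D_gen y; rewrite mulr_sumr mulr_suml.
  apply: eq_bigr => i _; rewrite -mulrA skew_exp mulrA -rmorphM mulrC rmorphM.
  by rewrite mulrA; congr (_ * j _ * _); elim: (i : nat) => //= k <-.
have xC y : x * y = y * x by rewrite /x -mulrA zC !mulrA jC // -mulrA -zC.
have xX i : x ^+ i = j (g ^+ i) * z ^+ i.
  by rewrite exprMn_comm -?rmorphXn //; apply: jC.
pose q := #|F|.-1.
have co_q : coprime q M.
  rewrite coprime_sym coprimeXl // prime_coprime //; apply/negP => lq.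
  have: (#[(1 : F)%R]%g %| #|[set: F]|)%N by rewrite order_dvdG ?inE.
  rewrite (@nt_prime_order _ l) //; first last.
  - exact: oner_neq0.
  - by rewrite FinRing.zmodXgE; exact: (pcharf0 charF).
  rewrite cardsT -[#|F|]prednK => [lq1|]; last by apply/card_gt0P; exists 0.
  move: lq1; rewrite -/q -addn1 dvdn_addr // dvdn1 => /eqP l1.
  by have := prime_gt1 l_pr; rewrite l1.
have gq : g ^+ q = 1.
  apply: (mulfI g0); rewrite mulr1 -exprS prednK ?expf_card //.
  by apply/card_gt0P; exists 0.
have jz_in t k : sigma t = t -> j t * z ^+ k \in agenv <[x]>%VS.
  move=> tS; have [->|t0] := eqVneq t 0; first by rewrite rmorph0 mul0r mem0v.
  have [i ->] := g_gen t tS t0.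
  have -> : j (g ^+ i) * z ^+ k = x ^+ (chinese q M i k).
    rewrite xX -(expr_mod _ gq) -(chinese_modl co_q i k) (expr_mod _ gq).
    by rewrite -(expr_mod _ zM) -(chinese_modr co_q i k) (expr_mod _ zM).
  apply: (subvP (subX_agenv _ (chinese q M i k))).
  by rewrite expv_line memv_line.
have xA1 : 1 \in agenv <[x]>%VS by rewrite memvE sub1_agenv.
have n_in k : n ^+ k \in agenv <[x]>%VS.
  elim: k => [|k IHk]; first exact: xA1.
  rewrite exprS (memvM (A := agenv_aspace <[x]>%VS)) //= nE memvB //.
  by rewrite -[z]mul1r -(rmorph1 j) (jz_in _ 1%N) ?rmorph1.
have eye1 y : exists2 t, sigma t = t & in_n (e * y * e) (j t * e).
  have [t tS [w wE]] := e0E y; exists t => //.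
  exists (w + w1 * y * e0 + e * y * w1 - j t * w1).
  have -> : e * y * e = e0 * y * e0 + n * (w1 * y * e0) + n * (e * y * w1).
    transitivity ((e0 + n * w1) * y * e0 + e * y * (n * w1)).
      by rewrite -eE -mulrDr -eE.
    by rewrite !mulrDl !mulrA -(nC (e * y)) !mulrA.
  have jte : j t * e = j t * e0 + n * (j t * w1).
    by rewrite eE mulrDr [j t * (n * _)]mulrA -(nC (j t)) -[n * j t * _]mulrA.
  rewrite wE jte mulrBr -[RHS]addrA [X in _ = _ + X]addrC subrK.
  by rewrite !mulrDr !addrA.
(* Successive approximation: the error left by [eye1] is n times an element of the same corner, so
   each round gains a factor n, and after M rounds n^M = 0 removes the error. *)
have eye k y : exists u w, u \in agenv <[x]>%VS /\ e * y * e = u * e + n ^+ k * (e * w * e).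
  elim: k => [|k [u [w [uA IHk]]]].
    by exists 0, y; rewrite mem0v mul0r add0r mul1r.
  have [t tS [v vE]] := eye1 w.
  exists (u + n ^+ k * j t), v; split.
    rewrite memvD // (memvM (A := agenv_aspace <[x]>%VS)) //= -[j t]mulr1.
    exact: (jz_in t 0%N).
  have ewe : e * w * e = j t * e + n * (e * v * e).
    have <- : e * (e * w * e) * e = e * w * e by rewrite !mulrA ee -mulrA ee.
    rewrite vE mulrDr mulrDl !mulrA -(jC t) // -(nC e).
    by rewrite -!(mulrA (j t) e e) ee -!(mulrA (j t) e e) ee.
  by rewrite IHk ewe mulrDr mulrDl !mulrA -exprSr addrA.
exists e, x; split=> //.
  split=> // y; have [u [w [uA ->]]] := eye M y.
  by rewrite nM mul0r addr0 memv_mul ?memv_line.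
(* Modulo n, N e is N j(a) N, that is j(Tr a) N = N. *)
have NE : in_n N (N * e).
  have [w wE] := NaN a; exists (- (w + N * w1)).
  rewrite eE mulrDr /e0 mulrA wE Tra rmorph1 mul1r [N * (n * w1)]mulrA -(nC N).
  by rewrite -[n * N * w1]mulrA mulrN mulrDr -[N + _ + _]addrA addrK.
have [v NeE] := NE.
have [r r1] := ideal_ofP N_full.
(* Replacing N by N e in the expression of 1 gives an element i of the ideal of e with 1 - i in n D.
   Each 1 - (1 - i)^k stays in the ideal, and k = M yields 1. *)
pose i := \sum_(p <- r) p.1 * N * e * p.2.
have iI : i \in ideal_of {:D} e.
  by rewrite rpred_sum // => p _; rewrite mem_ideal_of ?memvf.
have i1 : 1 - i = n * \sum_(p <- r) p.1 * v * p.2.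
  rewrite {1}r1 -sumrB mulr_sumr; apply: eq_bigr => p _.
  rewrite {1}NeE !mulrDr !mulrDl !mulrA addrAC subrr add0r.
  by rewrite -(nC p.1).
have i1k k : 1 - (1 - i) ^+ k \in ideal_of {:D} e.
  elim: k => [|k IHk]; first by rewrite subrr mem0v.
  rewrite exprS mulrBl mul1r opprB addrCA memvD ?(ideal_ofMr iI) ?memvf //.
have <- : 1 - (1 - i) ^+ M = 1 by rewrite i1 exprMn_comm ?nM ?mul0r ?subr0 //; apply: nC.
exact: i1k.
Qed.

End SkewCyclic.

Lemma agenv_lineP (K : fieldType) (A : falgType K) (x w : A) :
  w \in agenv <[x]>%VS ->
  exists N (c : nat -> K), w = \sum_(i < N) c i *: x ^+ i.
Proof.
move=> /memv_sumP[v vx ->]; exists (\dim {:A}).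
have /fin_all_exists[c cE] (i : 'I_(\dim {:A})) : exists c, v i = c *: x ^+ i.
  by have := vx i isT; rewrite expv_line => /vlineP.
exists (fun i => if insub i is Some i' then c i' else 0).
by apply: eq_bigr => i _; rewrite valK cE.
Qed.

Lemma pchar_dvd_card (F : finFieldType) l : l \in [pchar F] -> (l %| #|F|)%N.
Proof.
move=> charF; rewrite -cardsT.
have: (#[(1 : F)%R]%g %| #|[set: F]|)%N by rewrite order_dvdG ?inE.
rewrite (@nt_prime_order _ l) ?(pcharf_prime charF) //.
  by rewrite FinRing.zmodXgE; exact: (pcharf0 charF).
exact: oner_neq0.
Qed.

Section CyclicExtension.
Variables (K : fieldType) (D : falgType K) (F : finFieldType).
Variables (j : {rmorphism F -> D}) (s : D) (l b : nat).
Hypotheses (charK : l \in [pchar K]).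
Local Notation M := (l ^ b)%N.
Hypotheses (sU : s \is a GRing.unit) (sj : forall a, exists a', s * j a = j a' * s).
Hypothesis sM : exists u, s ^+ M = j u.
Hypothesis D_gen : forall y, exists c : 'I_M -> F, y = \sum_i j (c i) * s ^+ i.

Lemma cyclic_extension_monogenic_idempotent :
  exists e x, [/\ e * e = e, monogenic_corner e x & 1 \in ideal_of {:D} e].
Proof.
have [f fE] := @choice _ _ _ sj.
have f_unique a c : s * j a = j c * s -> f a = c.
  by rewrite fE => /(mulIr sU)/fmorph_inj.
have f_zmod : zmod_morphism f.
  by move=> a c; apply: f_unique; rewrite !rmorphB mulrBr mulrBl !fE.
have f_mon : monoid_morphism f.
  split=> [|a c]; apply: f_unique; first by rewrite rmorph1 mulr1 mul1r.
  by rewrite !rmorphM mulrA fE -mulrA fE mulrA.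
pose sigma : {rmorphism F -> F} :=
  HB.pack f (GRing.isZmodMorphism.Build F F f f_zmod)
            (GRing.isMonoidMorphism.Build F F f f_mon).
have sigmaE a : s * j a = j (sigma a) * s by apply: fE.
have l_pr := pcharf_prime charK.
have [u sMu] := sM.
have u0 : u != 0.
  apply: contraTneq (unitrX M sU) => u0; by rewrite sMu u0 rmorph0 unitr0.
have us : sigma u = u by apply: f_unique; rewrite -sMu -exprSr -exprS.
have charF : l \in [pchar F].
  by rewrite -(fmorph_pchar j) pchar_lalg.
(* The power map with exponent |F|^b is the identity of F; hence, with r = |F|^b / M, raising to the
   power r inverts raising to the power M. *)
have /dvdnP[r rE] : (M %| #|F| ^ b)%N by rewrite dvdn_exp2r ?pchar_dvd_card.
(* x |-> x ^ M is bijective on F, so s can be rescaled to satisfy s ^ M = 1. *)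
pose v := u^-1 ^+ r.
have vM : v ^+ M = u^-1.
  rewrite -exprM -rE exprVn; congr _^-1.
  by elim: (b) => [|k IHk]; rewrite ?expr1 // expnS exprM expf_card.
have vs : sigma v = v by rewrite rmorphXn fmorphV us.
have v0 : v != 0 by rewrite expf_neq0 ?invr_neq0.
have jvs : j v * s = s * j v by rewrite sigmaE vs.
have s1X i : (j v * s) ^+ i = j (v ^+ i) * s ^+ i.
  by rewrite (exprMn_comm _ jvs) -(rmorphXn j).
apply: (@skew_cyclic_monogenic_idempotent K D F j (j v * s) sigma l b l_pr charK) => //.
- by move=> a; rewrite -mulrA sigmaE !mulrA -!rmorphM mulrC.
- by rewrite s1X sMu vM -rmorphM mulVf ?rmorph1.
move=> y; have [c ->] := D_gen y; exists (fun i => c i / v ^+ i).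
by apply: eq_bigr => i _; rewrite s1X mulrA -rmorphM divfK // expf_neq0.
Qed.

End CyclicExtension.

(** * Group algebras modulo l *)

Lemma memv_mul3 (K : fieldType) (A : falgType K) (B : {aspace A}) x y z :
  x \in B -> y \in B -> z \in B -> x * y * z \in B.
Proof. by move=> xB yB zB; rewrite !memvM. Qed.

Section CornerTransfer.
Variables (K : fieldType) (A : falgType K) (U : {aspace A}).

Lemma vsvalX1 (x : subvs_of U) (e : subvs_of U) i :
  vsval (x ^+ i * e) = vsval x ^+ i * vsval e.
Proof.
elim: i => [|i IHi]; first by rewrite !mul1r.
by rewrite !exprS -!mulrA -IHi.
Qed.

Lemma val_ideal_of (x y : subvs_of U) :
  y \in ideal_of {:subvs_of U} x -> val y \in ideal_of {:A} (val x).
Proof.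
move=> /ideal_ofP[r ->]; rewrite linear_sum rpred_sum // => p _.
by rewrite mem_ideal_of ?memvf.
Qed.

Lemma val_monogenic (e x : subvs_of U) : algid U * algid U = algid U ->
  (forall y, algid U * y * algid U \in U) ->
  monogenic_corner e x -> monogenic_corner (val e) (val x).
Proof.
move=> uu uU [xe eDe]; split; first by rewrite -[LHS]/(val (x * e)) xe.
move=> y; have := eDe (Subvs (uU y)).
have /(congr1 val) : e * 1 = e by rewrite mulr1.
have /(congr1 val) : 1 * e = e by rewrite mul1r.
move=> /= ue eu /mem_prodvP[r rP rE].
have -> : val e * y * val e = val (e * Subvs (uU y) * e).
  by rewrite /= !mulrA eu -!mulrA ue.
rewrite rE linear_sum big_seq rpred_sum // => p /rP[p1 /vlineP[k ->]].
have [N [c ->]] := agenv_lineP p1.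
rewrite -scalerAr mulr_suml linearZ linear_sum memvZ // rpred_sum // => i _.
rewrite -scalerAl linearZ memvZ // -[X in X \in _]/(vsval (x ^+ i * e)) vsvalX1.
rewrite memv_mul ?memv_line //.
apply: (subvP (subX_agenv _ i)); rewrite expv_line memv_line //.
Qed.

End CornerTransfer.

Lemma ideal_of_mul0 (K : fieldType) (A : falgType K) (B : {vspace A}) e x y :
    {in B, forall q, e * q * y = 0} -> x \in ideal_of B e -> x * y = 0.
Proof.
move=> ey0 /mem_prodvP[r rP ->]; rewrite mulr_suml big_seq big1 // => p /rP[].
by move=> /memv_cosetP[w _ ->] p2B; rewrite -!mulrA [e * _]mulrA ey0 ?mulr0.
Qed.

Lemma ideal_of_0mul (K : fieldType) (A : falgType K) (B : {vspace A}) e x y :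
    {in B, forall q, y * q * e = 0} -> x \in ideal_of B e -> y * x = 0.
Proof.
rewrite /ideal_of => ye0 /mem_prodvP[r rP ->].
rewrite mulr_sumr big_seq big1 // => p /rP[].
by move=> /memv_cosetP[w wB ->] _; rewrite !mulrA ye0 ?mul0r.
Qed.

Section ModularGroupAlgebra.
Variables (K : finFieldType) (gT : finGroupType) (H : {group gT}) (t : gT).
Variables (l b : nat).
Local Notation A := (group_algebra K gT).
Local Notation B := (gspan_aspace K H).
Hypotheses (charK : l \in [pchar K]) (nzH : #|H|%:R != 0 :> K).
Hypotheses (tH : t \in 'N(H)%g) (tb : (t ^+ (l ^ b) = 1)%g).
Hypothesis genHt : forall g, exists h k,
  [/\ h \in H, (k < l ^ b)%N & g = h * t ^+ k]%g.

Let T k : A := gelt K (t ^+ k)%g.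
Let T' k : A := gelt K (t ^- k)%g.
Let TT' k : T k * T' k = 1. Proof. exact: geltKV. Qed.
Let T'T k : T' k * T k = 1. Proof. exact: geltVK. Qed.
Let TD i k : T (i + k) = T i * T k. Proof. by rewrite /T expgD geltM. Qed.
Let T'D i k : T' (i + k) = T' k * T' i.
Proof. by rewrite /T' expgD invMg geltM. Qed.
Let T_M i : T (i * l ^ b) = 1.
Proof. by rewrite /T mulnC expgM tb expg1n gelt1. Qed.

Let tau k (x : A) := locked (T k * x * T' k).
Let tauE k x : tau k x = T k * x * T' k. Proof. by rewrite /tau -lock. Qed.

Let tauM k x y : tau k (x * y) = tau k x * tau k y.
Proof. by rewrite !tauE !mulrA -[_ * T' k * T k]mulrA T'T mulr1. Qed.

Let tau_inj k : injective (tau k).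
Proof.
move=> x y /(congr1 (fun z => T' k * z * T k)) /=; rewrite !tauE !mulrA T'T !mul1r.
by rewrite -!mulrA T'T !mulr1.
Qed.

Let tau0 k : tau k 0 = 0. Proof. by rewrite !tauE mulr0 mul0r. Qed.

Let tauD i k x : tau (i + k) x = tau i (tau k x).
Proof. by rewrite !tauE TD T'D !mulrA. Qed.

Let T_tau k x : T k * x = tau k x * T k.
Proof. by rewrite !tauE -[RHS]mulrA T'T mulr1. Qed.

Let tauB k x : x \in B -> tau k x \in B.
Proof.
move: x; apply: gspan_ind => [|a y z yB zB|h hH]; first by rewrite tau0 mem0v.
  by rewrite !tauE mulrDr mulrDl -scalerAr -scalerAl -!tauE memvD ?memvZ.
rewrite !tauE -!geltM mem_gspan //.
have -> : (t ^+ k * h * t ^- k = h ^ (t ^- k))%g by rewrite conjgE invgK mulgA.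
by rewrite memJ_norm // groupV groupX.
Qed.

Let tau'B k x : x \in B -> T' k * x * T k \in B.
Proof.
move: x; apply: gspan_ind => [|a y z yB zB|h hH].
- by rewrite mulr0 mul0r mem0v.
- by rewrite mulrDr mulrDl -scalerAr -scalerAl memvD ?memvZ.
by rewrite -!geltM mem_gspan // -mulgA -conjgE memJ_norm // groupX.
Qed.

Let B1 : 1 \in B. Proof. exact: gspan1. Qed.

(** At a minimal idempotent eps of the block f, the corner of K[H] is a finite field F. Let t^m be
    the least positive power of t that fixes f. Then eps and its conjugate by t^m are equivalent
    idempotents of the same block, which gives a unit s = bb t^m of eps A eps that normalizes F. The
    powers of s span eps A eps over F, so this corner is a cyclic extension of F. *)
Lemma block_monogenic_idempotent f : primitive_central B f ->
  exists e x : A, [/\ e * e = e, monogenic_corner e x & f \in ideal_of {:A} e].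
Proof.
move=> [fI f0 f_simple]; have [fB ff fC] := fI.
have [|eps [epsB ee e0 ef eps_inv]] := minimal_idempotent B1 _ fI f0.
  move=> V VB VBV; apply: (right_ideal_idempotent nzH VB) => x h xV hH.
  by apply: (subvP VBV); rewrite memv_mul ?mem_gspan.
have fe : f * eps = eps by rewrite fC.
have f_eps : f \in ideal_of B eps.
  by rewrite -ef f_simple // ef.
pose Ub := corner_aspace epsB ee e0.
pose U := corner_aspace (memvf eps : eps \in {:A}%AS) ee e0.
have UbP x : reflect (x \in B /\ eps * x * eps = x) (x \in Ub).
  exact: (cornerP epsB ee).
have UP x : reflect (eps * x * eps = x) (x \in U).
  apply: (iffP (cornerP (memvf eps : eps \in {:A}%AS) ee x)) => [[]//|xE].
  by split; first exact: memvf.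
have uUb : algid Ub = eps by exact: algid_corner.
have uU : algid U = eps by apply: algid_corner => //; exact: memvf.
have Ub_div : division_algebra (subvs_of Ub).
  have rinv (x : subvs_of Ub) : x != 0 -> exists y, x * y = 1.
    move=> x0; have /UbP[xB xE] := subvsP x.
    have [|y yB xy] := eps_inv (val x) xB; first by rewrite xE.
    have yU : eps * y * eps \in Ub.
      by apply/UbP; rewrite !memv_mul3 // !mulrA ee -!mulrA ee.
    exists (Subvs yU); apply: val_inj; rewrite /= uUb -{1}xE !mulrA.
    by rewrite -(mulrA _ eps eps) ee xy.
  move=> x /[dup] x0 /rinv[y xy]; apply/unitrP; exists y; split=> //.
  have /rinv[w yw] : y != 0.
    by apply: contra_eq_neq xy => ->; rewrite mulr0 eq_sym oner_eq0.
  by rewrite (_ : x = w) // -[x]mulr1 -yw mulrA xy mul1r.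
have Ub_comm := finite_division_algebra_comm Ub_div.
have [F0 [phi [phi' phiK phi'K]]] := falg_fieldExt_exists Ub_comm Ub_div.
have Ub_U x : x \in Ub -> x \in U by move=> /UbP[_ xE]; apply/UP.
pose j (a : finvect_type F0) : subvs_of U := Subvs (Ub_U _ (subvsP (phi a))).
have j_zmod : zmod_morphism j by move=> x y; apply: val_inj; rewrite /= rmorphB.
have j_mon : monoid_morphism j.
  split=> [|x y]; apply: val_inj; first by rewrite /= rmorph1 /= uU uUb.
  by rewrite /= rmorphM.
pose F : finFieldType := finvect_type F0.
pose jm : {rmorphism F -> subvs_of U} :=
  HB.pack (j : F -> subvs_of U) (GRing.isZmodMorphism.Build F (subvs_of U) j j_zmod)
            (GRing.isMonoidMorphism.Build F (subvs_of U) j j_mon).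
have jP x : x \in B -> exists a, val (jm a) = eps * x * eps.
  move=> xB; have xU : eps * x * eps \in Ub.
    by apply/UbP; rewrite !memv_mul3 // !mulrA ee -!mulrA ee.
  by exists (phi' (Subvs xU)); rewrite /= phi'K.
have tau_lb x i : tau (i * l ^ b) x = x.
  have := TT' (i * l ^ b); rewrite T_M mul1r => T'1.
  by rewrite !tauE T_M mul1r T'1 mulr1.
have l_pr := pcharf_prime charK.
have lb_gt0 : (0 < l ^ b)%N by rewrite expn_gt0 prime_gt0.
have ex_m : exists m, (0 < m)%N && (tau m f == f).
  by exists (l ^ b)%N; have := tau_lb f 1%N; rewrite mul1n lb_gt0 => ->; rewrite eqxx.
have tauX i k : tau k f = f -> tau (i * k) f = f.
  move=> tkf; elim: i => [|i IHi]; last by rewrite mulSn tauD IHi.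
  by have := tau_lb f 0%N; rewrite !mul0n.
have [m /andP[m_gt0 /eqP tau_m] m_min] := ex_minnP ex_m.
have m_dvd k : tau k f = f -> (m %| k)%N.
  move=> tkf; apply: contraTT isT => mk; have km : (0 < k %% m)%N by rewrite lt0n.
  suff: (m <= k %% m)%N by rewrite leqNgt ltn_pmod.
  apply: m_min; rewrite km /=; apply/eqP; apply: (@tau_inj (k %/ m * m)).
  by rewrite -tauD -divn_eq tkf tauX.
have [eps' eps'E] : {x | x = tau m eps} by exists (tau m eps).
have eps'B : eps' \in B by rewrite eps'E tauB.
have ee' : eps' * eps' = eps' by rewrite eps'E -tauM ee.
have fe' : f * eps' = eps' by rewrite eps'E -{1}tau_m -tauM fe.
have ef' : eps' * f = eps' by rewrite -fC.
have e'0 : eps' != 0 by rewrite eps'E -(tau0 m) (inj_eq (@tau_inj m)).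
(* Since eps and eps' lie in one simple block, some element bb links them; y will be its inverse,
   with bb y = eps and y bb = eps'. *)
have [bb [bbB bb0 bbe bbe']] :
    exists x, [/\ x \in B, x != 0, eps * x = x & x * eps' = x].
  have [q qB bq0] : exists2 q, q \in B & eps * q * eps' != 0.
    apply: contrapT => noq; case/eqP: e'0; rewrite -fe'.
    apply: (ideal_of_mul0 _ f_eps) => q qB; apply: contrapT => /eqP eq0.
    by apply: noq; exists q.
  exists (eps * q * eps'); split=> //; first by rewrite memv_mul3.
    by rewrite !mulrA ee.
  by rewrite -mulrA ee'.
have [r rB br0] : exists2 r, r \in B & bb * r * eps != 0.
  apply: contrapT => nor; case/eqP: bb0; rewrite -bbe' -ef' mulrA bbe'.
  apply: (ideal_of_0mul _ f_eps) => r rB; apply: contrapT => /eqP br0.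
  by apply: nor; exists r.
have [y [yB by_ ye ye']] :
    exists y, [/\ y \in B, bb * y = eps, y * eps = y & eps' * y = y].
  have [||y1 y1B y1E] := eps_inv (bb * r); first by rewrite memvM.
    by rewrite !mulrA bbe.
  rewrite !mulrA bbe in y1E; exists (eps' * r * eps * y1 * eps).
  split; first by rewrite !memvM.
  - by rewrite !mulrA bbe' y1E ee.
  - by rewrite -!mulrA ee.
  by rewrite !mulrA ee'.
(* Conjugating y bb back by t^m gives a nonzero idempotent of the division ring eps B eps, which can
   only be eps. *)
have yb : y * bb = eps'.
  have [w [wB tauw]] : exists w, w \in B /\ tau m w = y * bb.
    exists (T' m * (y * bb) * T m); rewrite tau'B ?memvM //; split=> //.
    by rewrite !tauE !mulrA TT' mul1r -!mulrA TT' mulr1.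
  have we : eps * w * eps = w.
    by apply: (@tau_inj m); rewrite !tauM tauw -eps'E !mulrA ye' -mulrA bbe'.
  have w0 : w != 0.
    rewrite -(inj_eq (@tau_inj m)) tau0 tauw; apply: (contra_neq _ e0) => yb0.
    by rewrite -by_ -[y]ye -by_ [y * _]mulrA yb0 mul0r mulr0.
  have ww : w * w = w.
    apply: (@tau_inj m); rewrite tauM tauw -!mulrA [bb * _]mulrA by_.
    by rewrite bbe.
  have [|z _ wz] := eps_inv w wB; first by rewrite we.
  rewrite we in wz; rewrite -tauw eps'E; congr (tau m _).
  have wee : w * eps = w by rewrite -we -mulrA ee.
  by rewrite -[RHS]wz -{2}ww -mulrA wz wee.
pose s := bb * T m; pose s' := T' m * y.
have sU : s \in U.
  apply/UP; rewrite /s !mulrA bbe -mulrA T_tau mulrA -eps'E bbe'.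
  by [].
have T'e : T' m * eps' = eps * T' m by rewrite eps'E !tauE !mulrA T'T mul1r.
have s'U : s' \in U.
  by apply/UP; rewrite /s' -!mulrA ye mulrA -T'e -mulrA ye'.
have ss' : s * s' = eps by rewrite /s /s' !mulrA -(mulrA bb) TT' mulr1.
have s's : s' * s = eps.
  by rewrite /s /s' mulrA -(mulrA _ y) yb T'e -mulrA T'T mulr1.
pose S := Subvs sU; pose S' := Subvs s'U.
have SS' : S * S' = 1 by apply: val_inj; rewrite /= uU.
have S'S : S' * S = 1 by apply: val_inj; rewrite /= uU.
have SU : S \is a GRing.unit by apply/unitrP; exists S'.
have jB a : val (jm a) \in B by have /UbP[] := subvsP (phi a).
have jC a : eps * val (jm a) * eps = val (jm a) by have /UbP[] := subvsP (phi a).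
have eU (x : subvs_of U) : eps * val x = val x.
  by have /UP xE : val x \in U := subvsP x; rewrite -{1}xE !mulrA ee xE.
have Ue (x : subvs_of U) : val x * eps = val x.
  by have /UP xE : val x \in U := subvsP x; rewrite -{1}xE -!mulrA ee mulrA xE.
clearbody jm.
have Sj a : exists a', S * jm a = jm a' * S.
  have [|a' a'E] := jP (bb * tau m (val (jm a)) * y).
    by rewrite memv_mul3 ?tauB.
  exists a'; apply: val_inj.
  transitivity (bb * tau m (val (jm a)) * T m).
    by rewrite /= /s -mulrA T_tau mulrA.
  rewrite -[RHS]/(val (jm a') * (bb * T m)) a'E !mulrA bbe -(mulrA _ y eps) ye.
  by rewrite -(mulrA _ y bb) yb eps'E -[bb * _ * tau m eps]mulrA -tauM Ue.
have T0 : T 0 = 1 by have := T_M 0.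
have SX i : exists2 beta, beta \in B & val (S ^+ i) = beta * T (m * i).
  elim: i => [|i [beta betaB IHi]].
    by exists eps => //; rewrite muln0 T0 mulr1 /= uU.
  exists (beta * tau (m * i) bb); first by rewrite memvM ?tauB.
  rewrite exprSr -[LHS]/(val (S ^+ i) * (bb * T m)) IHi mulnS addnC TD.
  by rewrite -!mulrA (mulrA (T _) bb) [T _ * bb]T_tau !mulrA.
have S'X i : T (m * i) * val (S' ^+ i) \in B.
  elim: i => [|i IHi]; first by rewrite muln0 T0 mul1r /= uU.
  rewrite exprSr -[val _]/(val (S' ^+ i) * (T' m * y)) mulnS TD.
  suff -> : T m * T (m * i) * (val (S' ^+ i) * (T' m * y))
      = tau m (T (m * i) * val (S' ^+ i)) * y by rewrite memvM ?tauB.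
  by rewrite !tauE !mulrA.
have SM : exists u, S ^+ (l ^ b) = jm u.
  have [beta betaB SE] := SX (l ^ b)%N.
  have [u uE] := jP beta betaB; exists u; apply: val_inj; rewrite uE.
  by rewrite T_M mulr1 in SE; rewrite -SE eU Ue.
pose P (x : A) := exists c : 'I_(l ^ b) -> F, x = val (\sum_i jm (c i) * S ^+ i).
have P0 : P 0.
  exists (fun=> 0); rewrite big1 // => i _.
  by rewrite rmorph0 mul0r.
have PD x z : P x -> P z -> P (x + z).
  move=> [c ->] [d ->]; exists (fun i => c i + d i); rewrite -linearD -big_split.
  by congr (val _); apply: eq_bigr => i _; rewrite rmorphD mulrDl.
(* Distinct conjugates of the block are orthogonal. If f meets its conjugate f', simplicity gives f
   f' = f; repeating this around the orbit, which closes after l^b steps, gives f' f = f', hence f'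
   = f. *)
have f_tau i : tau i f <> f -> f * tau i f = 0.
  move=> tif; apply: contrapT => /eqP ff_i; apply: tif.
  have tfB : tau i f \in B by rewrite tauB.
  have f_le : f * tau i f = f.
    suff: f \in ideal_of B (tau i f * f).
      move=> f_in; apply/eqP; rewrite -subr_eq0 -[X in _ - X]mulr1 -mulrBr.
      apply/eqP/(ideal_of_mul0 _ f_in) => u uB.
      have tfu : tau i f * u = u * tau i f.
        have := congr1 (tau i) (fC _ (tau'B i uB)).
        rewrite tauM [in RHS]tauM.
        have -> : tau i (T' i * u * T i) = u.
          by rewrite tauE !mulrA TT' mul1r -!mulrA TT' mulr1.
        by [].
      rewrite -[tau i f * f]fC // -(mulrA f) tfu -mulrA -mulrA mulrBr mulr1.
      by rewrite -tauM ff subrr !mulr0.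
    by apply: f_simple; rewrite // -fC.
  have f_chain n : f * tau (n * i) f = f.
    elim: n => [|n IHn]; first by have := tau_lb f 0%N; rewrite !mul0n => ->.
    by rewrite -{1}IHn mulSn addnC tauD -mulrA -tauM f_le IHn.
  have := congr1 (tau i) (f_chain (l ^ b).-1).
  rewrite tauM -tauD -mulSn prednK // mulnC tau_lb -fC // f_le.
  by [].
(* If t^i moves f, the two blocks are orthogonal and the compressed element vanishes. Otherwise m
   divides i, and h t^i, rewritten with s^(-i/m) and s^(i/m), contributes the single monomial of
   degree i/m, with coefficient coming from B. *)
have Pg k g : P (k *: (eps * gelt K g * eps)).
  have [h [i [hH ilb ->]]] := genHt g.
  have [ti|ti] := eqVneq (tau i f) f; last first.
    suff -> : eps * gelt K (h * t ^+ i) * eps = 0 by rewrite scaler0.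
    have te : T i * eps = tau i f * tau i eps * T i by rewrite -tauM fe T_tau.
    have eh : eps * gelt K h = eps * gelt K h * f.
      by rewrite -{1}ef -mulrA fC ?mem_gspan // mulrA.
    rewrite geltM -/(T i) mulrA -mulrA te eh !mulrA -(mulrA _ f (tau i f)).
    by rewrite f_tau ?mulr0 ?mul0r //; apply/eqP.
  have /dvdnP[i' i'E] := m_dvd i ti.
  have i'lb : (i' < l ^ b)%N.
    by rewrite (leq_ltn_trans _ ilb) // i'E leq_pmulr.
  have [|a aE] := jP (k *: (gelt K h * (T (m * i') * val (S' ^+ i')))).
    by rewrite memvZ // memvM ?mem_gspan.
  exists (fun n => if n == Ordinal i'lb then a else 0).
  rewrite (bigD1 (Ordinal i'lb)) //= eqxx big1 => [|n /negbTE ->]; last first.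
    by rewrite rmorph0 mul0r.
  rewrite addr0 -[RHS]/(val (jm a) * val (S ^+ i')) aE -(mulrA _ eps) eU.
  have S'SX : val (S' ^+ i') * val (S ^+ i') = eps.
    rewrite -uU -[RHS]/(val (1 : subvs_of U)) -[LHS]/(val (S' ^+ i' * S ^+ i')).
    rewrite -exprMn_comm ?S'S ?expr1n //.
    by rewrite /GRing.comm S'S SS'.
  rewrite geltM -/(T i) i'E mulnC -scalerAr -scalerAl; congr (k *: _).
  by rewrite -[RHS]mulrA -!(mulrA (gelt K h)) -(mulrA (T _)) S'SX !mulrA.
have D_gen (x : subvs_of U) : exists c : 'I_(l ^ b) -> F, x = \sum_i jm (c i) * S ^+ i.
  suff [c cE] : P (val x) by exists c; apply: val_inj.
  have /UP <- : val x \in U := subvsP x; rewrite [val x]gelt_sum mulr_sumr mulr_suml.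
  elim/big_ind: _ => // g _; rewrite -scalerAr -scalerAl.
  exact: Pg.
have [e [x [e_idem e_mono e_full]]] :=
  cyclic_extension_monogenic_idempotent charK SU Sj SM D_gen.
exists (val e), (val x); split.
- by rewrite -[LHS]/(val (e * e)) e_idem.
- apply: val_monogenic e_mono; rewrite uU // => z.
  by apply/UP; rewrite !mulrA ee -!mulrA ee.
have := val_ideal_of e_full; rewrite /= uU => eps_e.
have [r' ->] := ideal_ofP f_eps; rewrite rpred_sum // => p _.
apply: (ideal_ofMr (B := {:A}%AS)); last exact: memvf.
by apply: (ideal_ofMl (B := {:A}%AS)); last exact: memvf.
Qed.

(** The blocks f of K[H] add up to 1 and each lies in the ideal of its idempotent e1; the family
    repeats e1 once for each term of an expression f = sum a e1 c. *)
Lemma modular_monogenic_idempotents : exists N (a e x c : 'I_N -> A),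
  (forall i, e i * e i = e i /\ monogenic_corner (e i) (x i))
  /\ 1 = \sum_i a i * e i * c i.
Proof.
have I1 : central_idempotent B 1.
  by split=> [||x _]; rewrite ?mulr1 ?mul1r //; apply: gspan1.
have [s [_ s1] [sP _]] :=
  central_decomposition B1 (fun V => gspan_semisimple nzH (V := V)) I1.
have {sP} [sP _] : (forall f, f \in s -> primitive_central B f) /\ True.
  by split=> // f /sP[].
rewrite s1 => {s1}; elim: s sP => [|f s IHs] sP.
  by exists 0%N, (fun=> 0), (fun=> 0), (fun=> 0), (fun=> 0); split=> [[]|] //; rewrite big_nil big_ord0.
have [|N [a [e [x [c [eP sE]]]]]] := IHs.
  by move=> g gs; apply: sP; rewrite inE gs orbT.
have [e1 [x1 [e1e1 e1m /ideal_ofP[r fE]]]] := block_monogenic_idempotent (sP f (mem_head _ _)).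
exists (size r + N)%N.
exists (fun i => match split i with inl k => (r`_k).1 | inr k => a k end).
exists (fun i => match split i with inl k => e1 | inr k => e k end).
exists (fun i => match split i with inl k => x1 | inr k => x k end).
exists (fun i => match split i with inl k => (r`_k).2 | inr k => c k end).
split=> [i|]; first by case: (split i).
rewrite big_cons big_split_ord /=; congr (_ + _).
  rewrite fE (big_nth 0) big_mkord; apply: eq_bigr => i _.
  by rewrite -[lshift _ i]/(unsplit (inl i)) unsplitK.
by rewrite sE; apply: eq_bigr => i _; rewrite -[rshift _ i]/(unsplit (inr i)) unsplitK.
Qed.

End ModularGroupAlgebra.

(** * Lifting to the l-adic group algebra *)

Section Congruence.
Variables (l : nat) (gT : finGroupType).
Hypothesis l_pr : prime l.
Local Notation A := (group_algebra rat gT).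
Local Notation kA := (group_algebra 'F_l gT).
Implicit Types x y : A.

Definition galg_intr (R : fieldType) (z : {ffun gT -> int}) : group_algebra R gT :=
  [ffun g => (z g)%:~R].

Definition integral x := exists z, x = galg_intr rat z.

Definition cong n x y := exists2 z, integral z & x - y = (l ^ n)%:R *: z.

(** Reduction modulo l is a relation because it makes sense only on Z[G]; the common integral
    preimage z witnesses both sides. *)
Definition reduces x (xb : kA) := exists2 z, x = galg_intr rat z & xb = galg_intr 'F_l z.

Let conv (z w : {ffun gT -> int}) : {ffun gT -> int} :=
  [ffun g => \sum_h z h * w (h^-1 * g)%g].

Let galg_intrM R z w : galg_intr R (conv z w) = galg_intr R z * galg_intr R w.
Proof.
apply/ffunP => g; rewrite !ffunE rmorph_sum; apply: eq_bigr => h _.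
by rewrite !ffunE rmorphM.
Qed.

Let galg_intrD R (z w : {ffun gT -> int}) : galg_intr R [ffun g => z g + w g] = galg_intr R z + galg_intr R w.
Proof. by apply/ffunP => g; rewrite !ffunE rmorphD. Qed.

Let galg_intrN R (z : {ffun gT -> int}) : galg_intr R [ffun g => - z g] = - galg_intr R z.
Proof. by apply/ffunP => g; rewrite !ffunE rmorphN. Qed.

Let galg_intrZ R (a : int) (z : {ffun gT -> int}) : galg_intr R [ffun g => a * z g] = a%:~R *: galg_intr R z.
Proof. by apply/ffunP => g; rewrite !ffunE rmorphM. Qed.

Lemma galg_intr_gelt R g : galg_intr R [ffun h => (h == g)%:R] = gelt R g.
Proof. by apply/ffunP => h; rewrite !ffunE; case: eqP. Qed.

Lemma reducesM x xb y yb : reduces x xb -> reduces y yb -> reduces (x * y) (xb * yb).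
Proof. by move=> [z -> ->] [w -> ->]; exists (conv z w); rewrite galg_intrM. Qed.

Lemma reducesD x xb y yb : reduces x xb -> reduces y yb -> reduces (x + y) (xb + yb).
Proof. by move=> [z -> ->] [w -> ->]; exists [ffun g => z g + w g]; rewrite galg_intrD. Qed.

Lemma reducesN x xb : reduces x xb -> reduces (- x) (- xb).
Proof. by move=> [z -> ->]; exists [ffun g => - z g]; rewrite galg_intrN. Qed.

Lemma reducesB x xb y yb : reduces x xb -> reduces y yb -> reduces (x - y) (xb - yb).
Proof. by move=> rx ry; apply/reducesD/reducesN. Qed.

Lemma reducesZ (a : int) x xb : reduces x xb -> reduces (a%:~R *: x) (a%:~R *: xb).
Proof. by move=> [z -> ->]; exists [ffun g => a * z g]; rewrite galg_intrZ. Qed.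

Lemma reduces1 : reduces 1 1.
Proof. by exists [ffun h => (h == 1%g)%:R]; rewrite galg_intr_gelt. Qed.

Lemma reduces0 : reduces 0 0.
Proof. by have := reducesB reduces1 reduces1; rewrite !subrr. Qed.

Lemma reducesX x xb i : reduces x xb -> reduces (x ^+ i) (xb ^+ i).
Proof.
by move=> rx; elim: i => [|i IHi]; [exact: reduces1 | rewrite !exprS; apply: reducesM].
Qed.

Lemma reduces_sum (I : finType) (x : I -> A) (xb : I -> kA) :
  (forall i, reduces (x i) (xb i)) -> reduces (\sum_i x i) (\sum_i xb i).
Proof.
move=> rx; apply: (big_ind2 reduces) => //; first exact: reduces0.
by move=> *; apply: reducesD.
Qed.

Lemma reduces_ex xb : exists x, reduces x xb.
Proof.
exists (galg_intr rat [ffun g => (xb g : nat)%:Z]).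
exists [ffun g => (xb g : nat)%:Z] => //.
by apply/ffunP => g; rewrite !ffunE; rewrite -pmulrn natr_Zp.
Qed.

Lemma reduces_integral x xb : reduces x xb -> integral x.
Proof. by case=> z -> _; exists z. Qed.

Lemma integral_reduces x : integral x -> exists xb, reduces x xb.
Proof. by case=> z ->; exists (galg_intr 'F_l z); exists z. Qed.

Lemma cong1_reduces x xb y : reduces x xb -> reduces y xb -> cong 1 x y.
Proof.
move=> rx ry; have := reducesB rx ry; rewrite subrr => -[z zE z0].
have z_dvd g : exists w : int, z g = l%:Z * w.
  move/ffunP/(_ g): z0; rewrite !ffunE => z0.
  have: (l %| `|z g|)%N.
    have charl : l \in [pchar 'F_l] by rewrite pchar_Fp.
    rewrite (dvdn_pcharf charl); apply/eqP; case: (z g) z0 => n /= n0 //.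
    by apply/esym/oppr_inj; rewrite oppr0 n0 NegzE mulrNz.
  by move=> lz; exists (z g %/ l)%Z; rewrite mulrC divzK.
have [w wE] := @choice _ _ _ z_dvd.
exists (galg_intr rat [ffun g => w g]); first by eexists.
by rewrite zE; apply/ffunP => g; rewrite !ffunE wE rmorphM.
Qed.

Lemma integralM x y : integral x -> integral y -> integral (x * y).
Proof. by case=> z -> [w ->]; eexists; rewrite -galg_intrM. Qed.

Lemma integralD x y : integral x -> integral y -> integral (x + y).
Proof. by case=> z -> [w ->]; eexists; rewrite -galg_intrD. Qed.

Lemma integralN x : integral x -> integral (- x).
Proof. by case=> z ->; eexists; rewrite -galg_intrN. Qed.

Lemma integralB x y : integral x -> integral y -> integral (x - y).
Proof. by move=> ix iy; apply/integralD/integralN. Qed.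

Lemma integralZ (a : int) x : integral x -> integral (a%:~R *: x).
Proof. by case=> z ->; eexists; rewrite -galg_intrZ. Qed.

Lemma integral1 : integral 1.
Proof. by exists [ffun h => (h == 1%g)%:R]; rewrite galg_intr_gelt. Qed.

Lemma integral0 : integral 0.
Proof. by exists [ffun=> 0]; apply/ffunP => g; rewrite !ffunE. Qed.

Lemma integral_gelt g : integral (gelt rat g).
Proof. by eexists; rewrite -galg_intr_gelt. Qed.

Lemma integralMn x n : integral x -> integral (x *+ n).
Proof.
by move=> ix; rewrite -scaler_nat pmulrn; apply: integralZ.
Qed.

Lemma integral_nat n : integral n%:R. Proof. exact: integralMn integral1. Qed.

Lemma integralX x i : integral x -> integral (x ^+ i).
Proof.
by move=> ix; elim: i => [|i IHi]; [exact: integral1 | rewrite exprS; apply: integralM].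
Qed.

Lemma integral_sum (I : Type) (r : seq I) (x : I -> A) :
  (forall i, integral (x i)) -> integral (\sum_(i <- r) x i).
Proof.
move=> ix; elim/big_ind: _ => //; [exact: integral0|move=> *; exact: integralD].
Qed.

Lemma cong_refl n x : cong n x x.
Proof. by exists 0; [exact: integral0 | rewrite subrr scaler0]. Qed.

Lemma cong_sym n x y : cong n x y -> cong n y x.
Proof.
by case=> z iz E; exists (- z); [exact: integralN | rewrite scalerN -E opprB].
Qed.

Lemma congD n x y x' y' : cong n x x' -> cong n y y' -> cong n (x + y) (x' + y').
Proof.
case=> z iz zE [w iw wE]; exists (z + w); first exact: integralD.
by rewrite opprD addrACA zE wE scalerDr.
Qed.

Lemma congB n x y x' y' : cong n x x' -> cong n y y' -> cong n (x - y) (x' - y').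
Proof.
case=> z iz zE [w iw wE]; exists (z - w); first exact: integralB.
by rewrite scalerBr -zE -wE !opprD !opprK addrACA.
Qed.

Lemma cong_trans n x y z : cong n x y -> cong n y z -> cong n x z.
Proof.
by move=> xy yz; have := congB (congD xy yz) (cong_refl n y); rewrite addrK addrAC subrr add0r.
Qed.

Lemma congMl n a x y : integral a -> cong n x y -> cong n (a * x) (a * y).
Proof.
move=> ia [z iz zE]; exists (a * z); first exact: integralM.
by rewrite -mulrBr zE scalerAr.
Qed.

Lemma congMr n a x y : integral a -> cong n x y -> cong n (x * a) (y * a).
Proof.
move=> ia [z iz zE]; exists (z * a); first exact: integralM.
by rewrite -mulrBl zE scalerAl.
Qed.

Lemma congM n x y x' y' : integral y -> integral x' ->
  cong n x x' -> cong n y y' -> cong n (x * y) (x' * y').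
Proof. by move=> iy ix' xx' yy'; apply: cong_trans (congMr iy xx') (congMl ix' yy'). Qed.

Lemma congZ n (a : int) x y : cong n x y -> cong n (a%:~R *: x) (a%:~R *: y).
Proof.
case=> z iz zE; exists (a%:~R *: z); first exact: integralZ.
by rewrite -scalerBr zE scalerA mulrC -scalerA.
Qed.

Lemma cong_sum n (I : Type) (r : seq I) (x y : I -> A) :
  (forall i, cong n (x i) (y i)) -> cong n (\sum_(i <- r) x i) (\sum_(i <- r) y i).
Proof.
move=> xy; apply: (big_ind2 (cong n)) => //; first exact: cong_refl.
by move=> *; apply: congD.
Qed.

Lemma congS m n x y : cong m x y -> cong n ((l ^ n)%:R *: x) ((l ^ n)%:R *: y) /\
  cong (n + m) ((l ^ n)%:R *: x) ((l ^ n)%:R *: y).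
Proof.
case=> z iz zE; split.
  exists ((l ^ m)%:R *: z); last by rewrite -scalerBr zE.
  by rewrite pmulrn; apply: integralZ.
by exists z => //; rewrite -scalerBr zE scalerA -natrM expnD.
Qed.

Lemma cong_leq m n x y : (m <= n)%N -> cong n x y -> cong m x y.
Proof.
move=> mn [z iz zE]; exists ((l ^ (n - m))%:R *: z).
  by rewrite pmulrn; apply: integralZ.
by rewrite zE scalerA -natrM -expnD subnKC.
Qed.

Lemma cong_mul0 m n x y : cong m x 0 -> cong n y 0 -> cong (m + n) (x * y) 0.
Proof.
case=> z iz; rewrite subr0 => -> [w iw]; rewrite subr0 => ->.
exists (z * w); first exact: integralM.
by rewrite subr0 -scalerAl -scalerAr scalerA -natrM -expnD.
Qed.

Lemma cong0 x y : integral x -> integral y -> cong 0 x y.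
Proof. by move=> ix iy; exists (x - y); rewrite ?scale1r //; apply: integralB. Qed.

End Congruence.

Section PadicLimit.
Variables (l : nat) (l_pr : prime l) (gT : finGroupType).
Local Notation A := (group_algebra rat gT).
Local Notation LA := (group_algebra (padic l_pr) gT).
Local Notation S := (Defs_padic_seq__canonical__GRing_ComNzRing l_pr).

Definition padic_class : {rmorphism S -> padic l_pr} :=
  (\pi_{ideal_quot (padic_null (l := l) : {pred S})})%qT.

Lemma padic_class_eq0 (u : S) : (padic_class u == 0) = (u \in @padic_null l).
Proof.
by rewrite -[0](rmorph0 padic_class) -[u in RHS]subr0 Quotient.idealrBE.
Qed.

(** Convergence coefficient by coefficient: as [padic] consists of classes of Cauchy sequences of
    rationals, the limit is the class of the sequence itself. *)
Definition padic_tends (u : nat -> A) (X : LA) :=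
  exists U : gT -> S, (forall n g, u n g = (U g : padic_seq l) n) /\
                      forall g, X g = padic_class (U g).

Lemma padic_tends_cst (x : A) : padic_tends (fun=> x) [ffun g => padic_of_rat l_pr (x g)].
Proof.
by exists (fun g => PadicSeq (padic_cst_cauchy l (x g)) : S); split=> // g; rewrite ffunE.
Qed.

Lemma padic_tendsB u v X Y : padic_tends u X -> padic_tends v Y ->
  padic_tends (fun n => u n - v n) (X - Y).
Proof.
move=> [U [uU XU]] [V [vV YV]]; exists (fun g => U g - V g); split=> [n g|g].
  by rewrite !ffunE uU vV.
by rewrite !ffunE XU YV -rmorphB.
Qed.

Lemma padic_tendsM u v X Y : padic_tends u X -> padic_tends v Y ->
  padic_tends (fun n => u n * v n) (X * Y).
Proof.
move=> [U [uU XU]] [V [vV YV]].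
exists (fun g => \sum_h U h * V (h^-1 * g)%g); split=> [n g|g].
  rewrite !ffunE.
  have sumE (I : Type) (r : seq I) (W : I -> S) :
      (\sum_(i <- r) W i : padic_seq l) n = \sum_(i <- r) (W i : padic_seq l) n.
    by elim/big_rec2: _ => // i y x _ <-.
  by rewrite sumE; apply: eq_bigr => h _; rewrite uU vV.
rewrite !ffunE rmorph_sum; apply: eq_bigr => h _.
by rewrite XU YV -rmorphM.
Qed.

Lemma padic_norm_int (z : int) : padic_norm l z%:~R <= 1.
Proof.
have [->|z0] := eqVneq z 0; first by rewrite padic_norm0 ler01.
have := padic_norm_frac l z0 (oner_neq0 _); rewrite divr1 => ->.
rewrite logn1 sub0r -[X in _ <= X](expr0z l%:R).
by rewrite ler_weXz2l ?ler1n ?prime_gt0 // oppr_le0.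
Qed.

Lemma padic_norm_pow n : padic_norm l (l ^ n)%:R <= 2%:R^-1 ^+ n.
Proof.
elim: n => [|n IHn]; first by rewrite expn0 padic_norm1.
rewrite expnS natrM padic_normM // exprS ler_pM ?padic_norm_ge0 //.
have l0 : (l : int) != 0 by rewrite eqz_nat -lt0n prime_gt0.
have := padic_norm_frac l l0 (oner_neq0 _); rewrite divr1 => ->.
rewrite logn1 sub0r /= (pfactorK 1 l_pr) exprN1 lef_pV2 ?posrE ?ltr0n ?prime_gt0 //.
by rewrite ler_nat prime_gt1.
Qed.

Lemma cong_norm n (x y : A) g : cong l n x y -> padic_norm l (x g - y g) <= 2%:R^-1 ^+ n.
Proof.
move=> [_ [z ->] /ffunP/(_ g)]; rewrite !ffunE => ->.
rewrite -[_ *: _]/(_ * _) padic_normM //.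
by rewrite -[X in _ <= X]mulr1 ler_pM ?padic_norm_ge0 ?padic_norm_pow ?padic_norm_int.
Qed.

Lemma half_pow_lt (e : rat) : 0 < e -> exists N, forall n, (N <= n)%N -> 2%:R^-1 ^+ n < e.
Proof.
move=> e0; exists (Num.bound e^-1) => n Nn.
rewrite exprVn -[e]invrK ltf_pV2 ?posrE ?exprn_gt0 ?invr_gt0 ?ltr0n //.
rewrite (lt_trans (archi_boundP _)) ?invr_ge0 ?ltW // -natrX ltr_nat.
by rewrite (leq_ltn_trans Nn) // ltn_expl.
Qed.

(** The device by which identities in Q_l[G] are reduced to congruences modulo l^n at stage n. *)
Lemma padic_tends0 (u : nat -> A) X : padic_tends u X -> (forall n, cong l n (u n) 0) -> X = 0.
Proof.
move=> [U [uU XU]] u0; apply/ffunP => g; rewrite XU ffunE.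
have: U g \in @padic_null l.
  apply/asboolP => e /half_pow_lt[N hN]; exists N => n /hN; apply: le_lt_trans.
  by have := cong_norm g (u0 n); rewrite ffunE subr0 uU.
by rewrite -padic_class_eq0 => /eqP.
Qed.

Lemma padic_tends_ex (u : nat -> A) : (forall n, cong l n (u n.+1) (u n)) -> exists X, padic_tends u X.
Proof.
move=> uc.
have cu g : (fun n => u n g) \in padic_cauchy l.
  apply/asboolP => e /half_pow_lt[N hN]; exists N => m n Nm Nn.
  have step k : (N <= k)%N -> cong l N (u k) (u N).
    elim: k => [|k IHk]; first by rewrite leqn0 => /eqP ->; exact: cong_refl.
    rewrite leq_eqVlt => /predU1P[<-|Nk]; first exact: cong_refl.
    by apply: cong_trans (IHk Nk); apply: cong_leq (uc k); rewrite -ltnS.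
  have umn : cong l N (u m) (u n) := cong_trans (step m Nm) (cong_sym (step n Nn)).
  exact: le_lt_trans (cong_norm g umn) (hN N (leqnn N)).
exists [ffun g => padic_class (PadicSeq (cu g))].
by exists (fun g => PadicSeq (cu g)); split=> // g; rewrite ffunE.
Qed.

End PadicLimit.

(** Bilinearity reduces commutativity of a corner to group elements, which are integral, so that
    congruences apply to them. *)
Lemma corner_comm_gelt (K : fieldType) (gT : finGroupType) (e : group_algebra K gT) :
    (forall g h, e * gelt K g * e * gelt K h * e = e * gelt K h * e * gelt K g * e) ->
  forall x y, e * x * e * y * e = e * y * e * x * e.
Proof.
move=> ec x y; have: x \in gspan K [set: gT]%G by rewrite gspanT memvf.
move: x; apply: gspan_ind => [|a x z xE zE|g _]; first by rewrite !(mulr0, mul0r).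
  by rewrite !(mulrDr, mulrDl) -!(scalerAr, scalerAl) xE zE.
have: y \in gspan K [set: gT]%G by rewrite gspanT memvf.
move: y; apply: gspan_ind => [|a x z xE zE|h _]; first by rewrite !(mulr0, mul0r).
  by rewrite !(mulrDr, mulrDl) -!(scalerAr, scalerAl) xE zE.
exact: ec.
Qed.

Section Lifting.
Variables (l : nat) (l_pr : prime l) (gT : finGroupType).
Local Notation A := (group_algebra rat gT).
Local Notation kA := (group_algebra 'F_l gT).
Local Notation LA := (group_algebra (padic l_pr) gT).

(** The sequence consists of the Newton iterates of an integral lift. At stage n the error u^2 - u
    is divisible by l^(n+1), which controls both idempotence and the next increment, so the limit is
    an idempotent. *)
Lemma lift_idempotent (eb : kA) : eb * eb = eb ->
  exists (u : nat -> A) (E : LA), [/\ padic_tends u E, E * E = E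
    & forall n, [/\ reduces (u n) eb, cong l n (u n * u n) (u n)
                  & cong l n (u n.+1) (u n)]].
Proof.
move=> ebb; have [e0 re0] := reduces_ex eb.
pose r (e : A) := e * e - e; pose f (e : A) := e + r e * (1 - 2%:R * e).
pose u n := iter n f e0.
have int_g (e : A) : integral e -> integral (1 - 2%:R * e).
  by move=> ie; apply: integralB (integral1 _) (integralM (integral_nat _ _) ie).
have uP n : [/\ reduces (u n) eb, cong l n.+1 (r (u n)) 0 & integral (u n)].
  elim: n => [|n [run rn iun]].
    split=> //; last exact: reduces_integral re0.
    have := reducesB (reducesM re0 re0) re0; rewrite ebb subrr => r0.
    by apply: (cong1_reduces l_pr r0); apply: reduces0.
  have rr0 : reduces (r (u n)) (0 : kA).
    have := reducesB (reducesM run run) run; rewrite ebb subrr => h; exact: h.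
  have [gb rg] := integral_reduces l (int_g _ iun).
  have ruS : reduces (u n.+1) eb.
    have := reducesD run (reducesM rr0 rg); rewrite mul0r addr0 => h; exact: h.
  split=> //; last exact: reduces_integral ruS.
  have -> : r (u n.+1) = r (u n) * r (u n) * (4%:R * r (u n) - 3%:R).
    exact: (newton_idempotent_identity (u n)).
  rewrite -[0](mul0r (4%:R * r (u n) - 3%:R)); apply: congMr.
    apply: integralB (integral_nat _ _).
    by apply: integralM (integral_nat _ _) (reduces_integral rr0).
  apply: (@cong_leq _ _ _ (n.+1 + n.+1)); last exact: cong_mul0.
  by rewrite addSnnS leq_addl.
have uS n : cong l n (u n.+1) (u n).
  have [_ rn iun] := uP n; rewrite -[X in cong _ _ _ X]addr0.
  apply: congD; first exact: cong_refl.
  rewrite -[0](mul0r (1 - 2%:R * u n)); apply: congMr; first exact: int_g.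
  exact: cong_leq (leqnSn n) rn.
have uu n : cong l n (u n * u n) (u n).
  have [_ rn _] := uP n; have := congD (cong_leq (leqnSn n) rn) (cong_refl l n (u n)).
  by rewrite subrK add0r.
have [E uE] := padic_tends_ex l_pr uS.
exists u, E; split=> // [|n]; last by have [] := uP n.
apply/eqP; rewrite -subr_eq0; apply/eqP.
apply: (padic_tends0 (padic_tendsB (padic_tendsM uE uE) uE)) => n.
by have [_ rn _] := uP n; apply: cong_leq (leqnSn n) rn.
Qed.

(* A corner of F_l[G] generated by one element lifts to a corner that is generated
   by one element modulo every power of l, hence commutative in the limit. *)
Lemma monogenic_comm_cong (eb xb : kA) (e : A) n :
    eb * eb = eb -> monogenic_corner eb xb -> reduces e eb -> cong l n (e * e) e ->
  forall y w, integral y -> integral w -> cong l n (e * y * e * w * e) (e * w * e * y * e).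
Proof.
move=> ebb [xe eDe] re ee; have [x rx] := reduces_ex xb.
have ie := reduces_integral re; have ix := reduces_integral rx.
pose X := e * x * e.
have iX : integral X by do !apply: integralM.
have rX : reduces X (xb * eb).
  by have := reducesM (reducesM re rx) re; rewrite -xe -(mulrA xb) ebb.
have iXe i : integral (X ^+ i * e) by apply: integralM ie; apply: integralX.
have rXe i : reduces (X ^+ i * e) (xb ^+ i * eb).
  have -> : xb ^+ i * eb = (xb * eb) ^+ i * eb.
    elim: i => [|i IHi]; first by rewrite !expr0.
    have xie : xb ^+ i * eb = eb * xb ^+ i by apply/esym/commrX; rewrite /GRing.comm xe.
    rewrite [in RHS]exprS -[RHS]mulrA -IHi xie mulrA -(mulrA xb eb eb) ebb.
    by rewrite -mulrA -xie mulrA -exprS.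
  exact: reducesM (reducesX i rX) re.
pose comb N (c : nat -> int) := \sum_(i < N) (c i)%:~R *: (X ^+ i * e).
have icomb N c : integral (comb N c).
  by apply: integral_sum => i; apply: integralZ.
have combD N c N' c' : exists M d, comb N c + comb N' c' = comb M d.
  pose ext N c := fun i => if (i < N)%N then c i else 0 : int.
  have extE k c0 M : (k <= M)%N -> comb k c0 = comb M (ext k c0).
    move=> kM; rewrite /comb (big_ord_widen M (fun i => (c0 i)%:~R *: (X ^+ i * e))) //.
    by rewrite big_mkcond; apply: eq_bigr => i _; rewrite /ext; case: ifP; rewrite ?scale0r.
  exists (maxn N N'), (fun i => ext N c i + ext N' c' i).
  rewrite (extE _ _ _ (leq_maxl N N')) (extE _ _ _ (leq_maxr N N')) -big_split.
  by apply: eq_bigr => i _; rewrite rmorphD scalerDl.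
have combZ a N c : a%:~R *: comb N c = comb N (fun i => a * c i).
  rewrite scaler_sumr; apply: eq_bigr => i _.
  by rewrite rmorphM scalerA.
have Xe : cong l n (X * e) X by rewrite /X -mulrA; apply: congMl ee; apply: integralM.
have eX : cong l n (e * X) X.
  by rewrite /X !mulrA; do 2![apply: congMr => //].
have eXie i : cong l n (e * (X ^+ i * e)) (X ^+ i * e).
  case: i => [|i]; first by rewrite mul1r.
  rewrite exprS -[X * _ * e]mulrA mulrA; apply: congMr => //.
have XieX i j : cong l n (X ^+ i * e * (X ^+ j * e)) (X ^+ (i + j) * e).
  by rewrite -mulrA exprD -mulrA; apply: congMl; first exact: integralX.
have base y : integral y -> exists N c, cong l 1 (e * y * e) (comb N c).
  move=> iy; have [yb ry] := integral_reduces l iy.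
  have /mem_prodvP[r rP rE] := eDe yb.
  have [N [c cE]] : exists N (c : nat -> 'F_l),
      eb * yb * eb = \sum_(i < N) c i *: (xb ^+ i * eb).
    have: eb * yb * eb \in (agenv <[xb]> * <[eb]>)%VS by apply: eDe.
    move=> /memv_cosetP[v /agenv_lineP[N [c ->]] ->]; exists N, c.
    by rewrite mulr_suml; apply: eq_bigr => i _; rewrite scalerAl.
  exists N, (fun i => (c i : nat)%:Z).
  apply: (@cong1_reduces l gT l_pr _ (eb * yb * eb)).
    exact: reducesM (reducesM re ry) re.
  rewrite cE; apply: reduces_sum => i.
  have ciE : ((c i : nat)%:Z)%:~R = c i :> 'F_l by rewrite -pmulrn natr_Zp.
  by rewrite -[X in reduces _ (X *: _)]ciE; apply: reducesZ.
(* From l^k to l^(k+1): the error is l^k z with z integral, and e z e is itself a combination modulo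
   l by [base]. The bound k <= n is there because e is idempotent only modulo l^n. *)
have step k : (k <= n)%N -> forall y, integral y -> exists N c, cong l k (e * y * e) (comb N c).
  elim: k => [_ y iy|k IHk kn y iy].
    by exists 0%N, (fun=> 0); apply: cong0 => //; do !apply: integralM.
  have [N [c [z iz yE]]] := IHk (ltnW kn) y iy.
  have [N' [c' zE]] := base z iz.
  have [M [d dE]] := combD N c N' (fun i => (l ^ k)%:Z * c' i).
  exists M, d; rewrite -dE -combZ.
  have iye : integral (e * y * e) by do !apply: integralM.
  have ee' := cong_leq kn ee.
  have t1 : cong l k.+1 (e * (e * y * e) * e) (e * y * e).
    rewrite !mulrA -!(mulrA _ e e); apply: cong_trans (_ : cong _ _ (e * y * (e * e)) _).
      by do 2![apply: congMr; first by do ?apply: integralM].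
    by apply: congMl ee'; apply: integralM.
  have yE' : e * y * e = comb N c + (l ^ k)%:R *: z by rewrite -yE addrC subrK.
  apply: cong_trans (cong_sym t1) _; rewrite {1}yE' mulrDr mulrDl.
  apply: congD.
    rewrite /comb mulr_sumr mulr_suml; apply: cong_sum => i.
    rewrite -scalerAr -scalerAl; apply: congZ.
    apply: cong_leq kn _; apply: cong_trans (eXie i).
    rewrite -!mulrA; apply: congMl => //.
    by apply: congMl => //; exact: integralX.
  rewrite -scalerAr -scalerAl -[(l ^ k)%:Z%:~R]pmulrn.
  by have [_] := congS k zE; rewrite addn1.
move=> y w iy iw.
have [N [c yE]] := step n (leqnn n) y iy; have [M [d wE]] := step n (leqnn n) w iw.
have split2 y' w' : integral y' -> integral w' ->
    cong l n (e * y' * e * w' * e) ((e * y' * e) * (e * w' * e)).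
  move=> iy' iw'; rewrite !mulrA -(mulrA (e * y') e e); do 2![apply: congMr => //].
  by apply: congMl; [apply: integralM | apply: cong_sym].
apply: cong_trans (split2 y w iy iw) _; apply: cong_trans (cong_sym (split2 w y iw iy)).
have iye : integral (e * y * e) by do !apply: integralM.
have iwe : integral (e * w * e) by do !apply: integralM.
apply: cong_trans (congM iwe (icomb N c) yE wE) _.
apply: cong_trans (cong_sym (congM iye (icomb M d) wE yE)).
rewrite /comb !mulr_suml.
under eq_bigr do rewrite mulr_sumr.
under [X in cong _ _ _ X]eq_bigr do rewrite mulr_sumr.
rewrite [X in cong _ _ _ X]exchange_big; apply: cong_sum => i; apply: cong_sum => j.
rewrite -!(scalerAl, scalerAr) !scalerA mulrC -!scalerA.
apply: congZ; apply: congZ; apply: cong_trans (XieX i j) _.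
by rewrite addnC; apply: cong_sym; apply: XieX.
Qed.

Definition padic_map (x : A) : LA := [ffun g => padic_of_rat l_pr (x g)].

Lemma padic_map_gelt g : padic_map (gelt rat g) = gelt _ g.
Proof. by apply/ffunP => h; rewrite !ffunE; case: (h == g); rewrite ?rmorph1 ?rmorph0. Qed.

Lemma padic_tends_sum (I : Type) (r : seq I) (u : I -> nat -> A) (X : I -> LA) :
  (forall i, padic_tends (u i) (X i)) ->
  padic_tends (fun n => \sum_(i <- r) u i n) (\sum_(i <- r) X i).
Proof.
move=> uX; elim: r => [|i r IHr].
  have := padic_tends_cst l_pr (0 : A).
  rewrite (_ : [ffun g => _] = 0 :> LA); last by apply/ffunP => g; rewrite !ffunE rmorph0.
  by case=> U [UE XE]; exists U; split=> [n g|g]; rewrite big_nil ?UE ?XE.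
have := padic_tendsB (uX i) (padic_tendsB (padic_tends_cst l_pr 0) IHr).
rewrite (_ : [ffun g => _] = 0 :> LA); last by apply/ffunP => g; rewrite !ffunE rmorph0.
rewrite sub0r opprK -[X i + _](big_cons _ _ i r xpredT X).
by case=> U [UE XE]; exists U; split=> // n g; rewrite big_cons -UE sub0r opprK.
Qed.

(** The lifted sum s is only congruent to 1 modulo l. Its right inverse v is the limit of the
    partial sums of the geometric series in 1 - s, for which s v = 1 - (1 - s)^n. *)
Lemma padic_commuting_idempotents N (a e x c : 'I_N -> kA) :
    (forall i, e i * e i = e i /\ monogenic_corner (e i) (x i)) ->
    1 = \sum_i a i * e i * c i ->
  exists (E b d : 'I_N -> LA) (v : LA),
    (forall i, E i * E i = E i
       /\ forall y w, E i * y * E i * w * E i = E i * w * E i * y * E i)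
    /\ (\sum_i b i * E i * d i) * v = 1.
Proof.
move=> eP sum1.
have /fin_all_exists[u uP] (i : 'I_N) := lift_idempotent (proj1 (eP i)).
have [E EP] := fin_all_exists uP.
have /fin_all_exists[a' aP] (i : 'I_N) := reduces_ex (a i).
have /fin_all_exists[c' cP] (i : 'I_N) := reduces_ex (c i).
have iu i n : integral (u i n) by have [_ _ /(_ n)[/reduces_integral]] := EP i.
have ia i : integral (a' i) := reduces_integral (aP i).
have ic i : integral (c' i) := reduces_integral (cP i).
pose s n := \sum_i a' i * u i n * c' i.
have ints n : integral (s n) by apply: integral_sum => i; do !apply: integralM.
have sS n : cong l n (s n.+1) (s n).
  apply: cong_sum => i; apply: congMr => //; apply: congMl => //.
  by have [_ _ /(_ n)[]] := EP i.
have s1 n : cong l 1 (1 - s n) 0.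
  apply: (cong1_reduces l_pr (xb := 0)); last exact: reduces0.
  rewrite -(subrr 1) {2}sum1; apply: reducesB; first exact: reduces1.
  apply: reduces_sum => i; apply: reducesM (cP i); apply: reducesM (aP i) _.
  by have [_ _ /(_ n)[]] := EP i.
have i1s n : integral (1 - s n) by apply: integralB (integral1 _) _.
have s1X n k : cong l k ((1 - s n) ^+ k) 0.
  elim: k => [|k IHk]; first by apply: cong0; [exact: integral1 | exact: integral0].
  by rewrite exprS -add1n; apply: cong_mul0.
have congX k m y z : integral y -> integral z -> cong l m y z -> cong l m (y ^+ k) (z ^+ k).
  move=> iy iz yz; elim: k => [|k IHk]; first exact: cong_refl.
  by rewrite !exprS; apply: congM => //; apply: integralX.
pose v n := \sum_(j < n) (1 - s n) ^+ j.
have vS n : cong l n (v n.+1) (v n).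
  apply: (@cong_trans _ _ _ _ (\sum_(j < n.+1) (1 - s n) ^+ j)).
    apply: cong_sum => j; apply: congX => //.
    by apply: congB (sS n); apply: cong_refl.
  rewrite big_ord_recr -[X in cong _ _ _ X]addr0; apply: congD; first exact: cong_refl.
  exact: s1X.
have [V vV] := padic_tends_ex l_pr vS.
exists E, (fun i => padic_map (a' i)), (fun i => padic_map (c' i)), V; split.
  move=> i; have [uE EE uPi] := EP i; split=> // y w.
  have Egh g h : E i * gelt _ g * E i * gelt _ h * E i = E i * gelt _ h * E i * gelt _ g * E i.
    have tg k : padic_tends (fun=> gelt rat k) (gelt _ k : LA).
      by rewrite -padic_map_gelt; apply: padic_tends_cst.
    have T1 k1 k2 := padic_tendsM (padic_tendsM (padic_tendsM (padic_tendsM uE (tg k1)) uE) (tg k2)) uE.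
    apply/eqP; rewrite -subr_eq0; apply/eqP.
    apply: (padic_tends0 (padic_tendsB (T1 g h) (T1 h g))) => n.
    rewrite -(subrr (u i n * gelt rat h * u i n * gelt rat g * u i n)).
    apply: congB; last exact: cong_refl.
    have [run uun _] := uPi n.
    by apply: (monogenic_comm_cong _ (proj2 (eP i))) => //; [have [] := eP i|exact: integral_gelt|exact: integral_gelt].
  exact: corner_comm_gelt.
have sE : padic_tends s (\sum_i padic_map (a' i) * E i * padic_map (c' i)).
  apply: padic_tends_sum => i; have [uE _ _] := EP i.
  by do 2?[apply: padic_tendsM]; rewrite ?/padic_map //; apply: padic_tends_cst.
apply/eqP; rewrite -subr_eq0; apply/eqP.
have one : padic_tends (fun=> 1) (1 : LA).
  by rewrite -!gelt1 -padic_map_gelt; apply: padic_tends_cst.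
apply: (padic_tends0 (padic_tendsB (padic_tendsM sE vV) one)) => n.
have svE : s n * v n = 1 - (1 - s n) ^+ n.
  have := subrX1 (1 - s n) n; rewrite -/(v n) [1 - s n - 1]addrAC subrr sub0r mulNr => h.
  by rewrite -[LHS]opprK -h opprB.
rewrite svE addrAC subrr sub0r -[X in cong _ _ X]sub0r -[X in cong _ _ _ X](subrr 0).
by apply: congB (s1X n n); apply: cong_refl.
Qed.

End Lifting.

(** * Splitting outside p *)

Section GalgMap.
Variables (K L : fieldType) (sigma : {rmorphism K -> L}) (gT : finGroupType).
Local Notation A := (group_algebra K gT).
Local Notation LA := (group_algebra L gT).

Definition galg_map (x : A) : LA := [ffun g => sigma (x g)].

Fact galg_map_zmod : zmod_morphism galg_map.
Proof. by move=> x y; apply/ffunP => g; rewrite !ffunE rmorphB. Qed.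

Fact galg_map_monoid : monoid_morphism galg_map.
Proof.
split=> [|x y]; apply/ffunP => g; rewrite !ffunE ?rmorph_nat //.
by rewrite rmorph_sum; apply: eq_bigr => h _; rewrite !ffunE rmorphM.
Qed.

HB.instance Definition _ := GRing.isZmodMorphism.Build A LA galg_map galg_map_zmod.
HB.instance Definition _ := GRing.isMonoidMorphism.Build A LA galg_map galg_map_monoid.

Lemma galg_mapZ a x : galg_map (a *: x) = sigma a *: galg_map x.
Proof. by apply/ffunP => g; rewrite !ffunE rmorphM. Qed.

Lemma galg_map_gelt g : galg_map (gelt K g) = gelt L g.
Proof. by apply/ffunP => h; rewrite !ffunE rmorph_nat. Qed.

Lemma galg_map_span (X : seq A) x :
  x \in <<X>>%VS -> galg_map x \in <<[seq galg_map y | y <- X]>>%VS.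
Proof.
move=> /(@coord_span _ _ _ (in_tuple X)) ->; rewrite rmorph_sum /= rpred_sum // => i _.
by rewrite galg_mapZ memvZ // memv_span // map_f // mem_nth.
Qed.

Lemma galg_map_central x : (forall y, x * y = y * x) ->
  forall y, galg_map x * y = y * galg_map x.
Proof.
move=> xC y; rewrite [y]gelt_sum mulr_sumr mulr_suml; apply: eq_bigr => g _.
by rewrite -scalerAl -scalerAr -galg_map_gelt -!rmorphM xC.
Qed.

Lemma dim_limg_galg_map (u : A) :
  (\dim (limg (amull (galg_map u))) <= \dim (limg (amull u)))%N.
Proof.
suff uU : (limg (amull (galg_map u)) <=
    <<[seq galg_map y | y <- vbasis (limg (amull u))]>>)%VS.
  by rewrite (leq_trans (dimvS uU)) // (leq_trans (dim_span _)) // size_map size_tuple.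
apply/subvP => _ /memv_imgP[x _ ->]; rewrite lfunE /= [x]gelt_sum mulr_sumr.
rewrite rpred_sum // => g _; rewrite -scalerAr memvZ // -galg_map_gelt -rmorphM.
apply: galg_map_span; rewrite (span_basis (vbasisP _)).
by apply/memv_imgP; exists (gelt K g); rewrite ?memvf ?lfunE.
Qed.

Lemma dim_galg_map : \dim {:A} = \dim {:LA}.
Proof. by rewrite !dimvf. Qed.

(** After scalar extension the image of multiplication by u is still spanned by the image of a
    basis, so the rank cannot grow and the kernel cannot shrink. *)
Lemma dim_lker_galg_map (u : A) :
  (\dim (lker (amull u)) <= \dim (lker (amull (galg_map u))))%N.
Proof.
have := limg_ker_dim (amull u) {:A}; have := limg_ker_dim (amull (galg_map u)) {:LA}.
rewrite !capfv -dim_galg_map => <- /eqP; rewrite -(leq_add2r (\dim (limg (amull u)))).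
by move/eqP ->; rewrite leq_add2l dim_limg_galg_map.
Qed.

End GalgMap.

Lemma algid_ideal_central (K : fieldType) (A : falgType K) (E : {aspace A}) :
  two_sided_ideal E -> forall x, algid E * x = x * algid E.
Proof.
move=> /andP[El Er] x; have eE := memv_algid E.
have xe : x * algid E \in E by rewrite (subvP El) ?memv_mul ?memvf.
have ex : algid E * x \in E by rewrite (subvP Er) ?memv_mul ?memvf.
by rewrite -[LHS](algidr ex) -mulrA algidl.
Qed.

Lemma mem_ideal_algid (K : fieldType) (A : falgType K) (E : {aspace A}) :
  two_sided_ideal E -> forall x, (x \in E) = (algid E * x == x).
Proof.
move=> /andP[_ Er] x; apply/idP/eqP => [xE|<-]; first by rewrite algidl.
by rewrite (subvP Er) ?memv_mul ?memvf ?memv_algid.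
Qed.

Section ScalarExtension.
Variables (K L : fieldType) (sigma : {rmorphism K -> L}) (gT : finGroupType).
Local Notation A := (group_algebra K gT).
Local Notation LA := (group_algebra L gT).
Local Notation map := (@galg_map K L sigma gT).
Variable E : {aspace A}.
Hypothesis E_ideal : two_sided_ideal E.

Let e := map (algid E).
Let eid : algid E * algid E = algid E. Proof. by rewrite algidl ?memv_algid. Qed.
Let ee : e * e = e. Proof. by rewrite -rmorphM eid. Qed.
Let e0 : e != 0.
Proof.
apply: contra_neq (algid_neq0 E) => /ffunP e_eq0; apply/ffunP => g.
rewrite [RHS]ffunE; apply/eqP; rewrite -(fmorph_eq0 sigma).
by have := e_eq0 g; rewrite !ffunE => ->.
Qed.
Let eC x : e * x = x * e.
Proof. exact: galg_map_central (algid_ideal_central E_ideal) x. Qed.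

(** The scalar extension of E, realized inside L[G] as the ideal cut out by the image of the central
    idempotent of E. *)
Definition ideal_extension : {aspace LA} :=
  corner_aspace (memvf e : e \in {:LA}%AS) ee e0.

Lemma mem_ideal_extension x : (x \in ideal_extension) = (e * x == x).
Proof.
apply/idP/eqP => [/(cornerP (memvf e : e \in {:LA}%AS) ee)[_ <-]|ex].
  by rewrite !mulrA ee.
apply/(cornerP (memvf e : e \in {:LA}%AS) ee); split; first exact: memvf.
by rewrite ex -eC.
Qed.

Lemma algid_ideal_extension : algid ideal_extension = e.
Proof. exact: algid_corner. Qed.

Lemma ideal_extension_map x : x \in E -> map x \in ideal_extension.
Proof. by move=> xE; rewrite mem_ideal_extension -rmorphM algidl. Qed.

Definition ideal_extension_fun (x : subvs_of E) : subvs_of ideal_extension :=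
  Subvs (ideal_extension_map (subvsP x)).

Fact ideal_extension_fun_zmod : zmod_morphism ideal_extension_fun.
Proof. by move=> x y; apply: val_inj; rewrite /= rmorphB. Qed.

Fact ideal_extension_fun_monoid : monoid_morphism ideal_extension_fun.
Proof.
split=> [|x y]; apply: val_inj; rewrite /= ?rmorphM //.
by rewrite algid_ideal_extension.
Qed.

HB.instance Definition _ := GRing.isZmodMorphism.Build _ _ ideal_extension_fun
  ideal_extension_fun_zmod.
HB.instance Definition _ := GRing.isMonoidMorphism.Build _ _ ideal_extension_fun
  ideal_extension_fun_monoid.

Lemma ideal_extensionP : scalar_extension sigma ideal_extension_fun.
Proof.
split=> [a x|]; first by apply: val_inj; rewrite /= galg_mapZ.
set X := [seq _ | _ <- _]; rewrite basisEdim; apply/andP; split.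
  apply/subvP => y _.
  have mapX x : ideal_extension_fun x \in <<X>>%VS.
    have /(@coord_vbasis _ _ _) -> := memvf x; rewrite rmorph_sum /= rpred_sum // => i _.
    have -> a w : ideal_extension_fun (a *: w) = sigma a *: ideal_extension_fun w.
      by apply: val_inj; rewrite /= galg_mapZ.
    by rewrite memvZ // memv_span // map_f // mem_nth ?size_tuple.
  have eg g : algid E * gelt K g \in E.
    by rewrite mem_ideal_algid // mulrA eid.
  have -> : y = \sum_g (val y g : L) *: ideal_extension_fun (Subvs (eg g)).
    apply: val_inj; rewrite linear_sum /=.
    have := subvsP y; rewrite mem_ideal_extension => /eqP {1}<-.
    rewrite {1}[vsval y]gelt_sum mulr_sumr; apply: eq_bigr => g _.
    by rewrite rmorphM /= galg_map_gelt -scalerAr.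
  by rewrite rpred_sum // => g _; rewrite memvZ.
rewrite size_map size_tuple !dimvf /=.
(* Both ideals are kernels of multiplication by 1 - [algid E]; comparing kernel dimensions shows
   that the spanning family X has no more elements than the dimension, hence is a basis. *)
have lkE : lker (amull (1 - algid E)) = E.
  apply/vspaceP => x; rewrite memv_ker lfunE /= mulrBl mul1r subr_eq0 eq_sym.
  by rewrite mem_ideal_algid.
have lkL : lker (amull (map (1 - algid E))) = ideal_extension.
  apply/vspaceP => x; rewrite memv_ker lfunE /= rmorphB rmorph1 mulrBl mul1r.
  by rewrite subr_eq0 eq_sym mem_ideal_extension.
by have := dim_lker_galg_map sigma (1 - algid E); rewrite lkE lkL.
Qed.

End ScalarExtension.

Section MatrixProduct.
Variables (L : fieldType) (gT : finGroupType).
Local Notation A := (group_algebra L gT).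
Variables (N : nat) (E b d : 'I_N -> A) (v : A).
Hypotheses (nzG : #|[set: gT]|%:R != 0 :> L).
Hypothesis E_idem : forall i, E i * E i = E i.
Hypothesis E_comm :
  forall i y w, E i * y * E i * w * E i = E i * w * E i * y * E i.
Hypothesis E_full : (\sum_i b i * E i * d i) * v = 1.

(** As the E_i generate the unit ideal, some E_i c is nonzero. It is an idempotent of the simple
    component of c with commutative corner, which is what Morita equivalence requires. *)
Lemma primitive_central_matrix (c : A) : primitive_central (gspan_aspace L [set: gT]%G) c ->
  exists (F : fieldExtType L) (n : nat) (f : A -> 'M[F]_n.+1),
    [/\ zmod_morphism f, {morph f : x y / x * y} & f c = 1]
    /\ [/\ forall a x, f (a *: x) = a%:A *: f x,
           forall x, f x = 0 -> x * c = 0 & forall M, exists x, f x = M].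
Proof.
move=> [[_ cc cC] c0 c_simple].
have allA (x : A) : x \in gspan_aspace L [set: gT]%G by rewrite /= gspanT memvf.
have {}cC x : c * x = x * c by apply: cC.
have [i Eic0] : exists i, E i * c != 0.
  apply: contrapT => noi; case/eqP: c0; rewrite -[c]mul1r -E_full -mulrA -[v * c]cC.
  rewrite mulrA mulr_suml big1 ?mul0r // => i _.
  have [Eic|] := eqVneq (E i * c) 0; last by move=> ?; case: noi; exists i.
  by rewrite -mulrA -cC mulrA -(mulrA (b i)) Eic mulr0 mul0r.
have c_simple' x : x * c != 0 -> c \in ideal_of {:A} (x * c).
  by move=> xc; have := c_simple x (allA x) xc; rewrite /= gspanT.
apply: (@simple_component_matrix L A c (E i * c) cC cc c_simple') => //.
- by rewrite mulrA -(mulrA (E i)) cC -!mulrA cc mulrA E_idem.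
- by rewrite -mulrA cc.
move=> x y; have Ecx z : E i * c * z * (E i * c) = E i * z * E i * c.
  by rewrite -(mulrA (E i)) cC !mulrA -(mulrA (E i * z) c) [c * _]cC -!mulrA cc.
have cz z w u : z * c * w * (u * c) = z * w * u * c.
  by rewrite -(mulrA z) cC !mulrA -(mulrA (z * w) c) [c * u]cC -!mulrA cc.
by rewrite !Ecx !cz E_comm.
Qed.

Variables (e : A) (ee : e * e = e) (e0 : e != 0) (eC : forall x, e * x = x * e).
Let U := corner_aspace (memvf e : e \in {:A}%AS) ee e0.

(** Write e as a sum of orthogonal primitive central c_i. Preimages X_i are glued to sum c_i X_i,
    and an element of the corner killed by every f_i is killed by every c_i, hence by e. *)
Lemma corner_product_of_matrix_algebras : product_of_matrix_algebras (subvs_of U).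
Proof.
have allA (x : A) : x \in gspan_aspace L [set: gT]%G by rewrite /= gspanT memvf.
have UE x : (x \in U) = (e * x == x).
  apply/idP/eqP => [/(cornerP (memvf e : e \in {:A}%AS) ee)[_ <-]|ex].
    by rewrite !mulrA ee.
  apply/(cornerP (memvf e : e \in {:A}%AS) ee); split; first exact: memvf.
  by rewrite ex -eC.
have eI : central_idempotent (gspan_aspace L [set: gT]%G) e by split.
have [s [s_uniq eE] [sP s_orth]] := central_decomposition (allA 1)
  (fun V => gspan_semisimple nzG (V := V)) eI.
pose r := size s; pose c (i : 'I_r) := s`_i.
have cs i : c i \in s by rewrite mem_nth.
have {}eE : e = \sum_i c i by rewrite eE (big_nth 0) big_mkord.
have cP i : primitive_central (gspan_aspace L [set: gT]%G) (c i) by have [] := sP _ (cs i).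
have ce i : c i * e = c i by have [] := sP _ (cs i).
have c_orth i k : i != k -> c i * c k = 0.
  by move=> ik; rewrite s_orth ?cs // nth_uniq.
have /fin_all_exists[F FP] (i : 'I_r) := primitive_central_matrix (cP i).
have /fin_all_exists[n nP] (i : 'I_r) := FP i.
have /fin_all_exists[f fP] (i : 'I_r) := nP i.
pose f' i (x : subvs_of U) := f i (val x).
have f'_zmod i : zmod_morphism (f' i).
  by move=> x y; have [[fB _ _] _] := fP i; rewrite /f' /= fB.
have fe i : f i e = 1.
  by have [[_ fM f1] _] := fP i; rewrite -[LHS]mulr1 -f1 -fM eC ce.
have f'_monoid i : monoid_morphism (f' i).
  have [[_ fM f1] _] := fP i; split=> [|x y]; rewrite /f' /=; last exact: fM.
  by rewrite algid_corner // ?fe ?memvf.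
pose fm i : {rmorphism subvs_of U -> 'M[F i]_((n i).+1)} :=
  HB.pack (f' i) (GRing.isZmodMorphism.Build _ _ (f' i) (f'_zmod i))
                 (GRing.isMonoidMorphism.Build _ _ (f' i) (f'_monoid i)).
exists r, F, n, fm; split=> [i a x|y].
  by have [_ [fZ _ _]] := fP i; rewrite /= /f' /= fZ.
have /fin_all_exists[X XE] (i : 'I_r) : exists x, f i x = y i.
  by have [_ [_ _]] := fP i.
have xU : \sum_i c i * X i \in U.
  rewrite UE mulr_sumr; apply/eqP; apply: eq_bigr => i _.
  by rewrite mulrA eC ce.
have xE i : f i (\sum_i c i * X i) = y i.
  have [[fB fM f1] _] := fP i.
  have f0 : f i 0 = 0 by rewrite -(subrr 0) fB subrr.
  have fN u : f i (- u) = - f i u by rewrite -sub0r fB f0 sub0r.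
  have fD u w : f i (u + w) = f i u + f i w by rewrite -{1}[w]opprK fB fN opprK.
  rewrite (big_morph _ fD f0) (bigD1 i) //= fM f1 mul1r XE big1 ?addr0 // => k ki.
  by rewrite fM -[f i (c k)]mulr1 -f1 -fM c_orth // f0 mul0r.
exists (Subvs xU); split=> [i|x' x'E]; first exact: xE.
apply/esym/eqP; rewrite -subr_eq0; apply/eqP/val_inj => /=.
set u := _ - _; have uU : u \in U by rewrite memvB ?subvsP.
have : u * e = 0.
  rewrite eE mulr_sumr big1 // => i _; have [[fB fM f1] [_ f_inj _]] := fP i.
  by apply: f_inj; rewrite fB -[f i (vsval x')]/(fm i x') x'E xE subrr.
by move: uU; rewrite UE eC => /eqP ->.
Qed.

End MatrixProduct.

Section QuasiSplit.
Variables (p : nat) (gT : finGroupType).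
Hypothesis Gram : ramification_group p [set: gT].

(** For a generator c of C, t is the l-part of c, H is generated by P and the l'-part, and l^b is
    the order of t. If l does not divide |C| then t = 1 and b = 0, so the case of l prime to |G| is
    included. *)
Lemma ramification_hall_complement l : prime l -> prime p -> l != p ->
  exists (H : {group gT}) (t : gT) (b : nat),
    [/\ ~~ (l %| #|H|)%N, t \in 'N(H)%g, (t ^+ (l ^ b) = 1)%g
      & forall g, exists h k, [/\ h \in H, (k < l ^ b)%N & g = h * t ^+ k]%g].
Proof.
move=> l_pr p_pr lp; have [P [C [PC pP /cyclicP[c cE] Cp]]] := Gram.
have [_ PCE nPC tiPC] := sdprodP PC.
pose t := (c.`_l)%g; pose u := (c.`_(l^'))%g.
have tC : t \in C by rewrite cE mem_cycle // -cycle_subG cycle_subG groupX ?cycle_id.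
have uC : u \in C by rewrite cE -cycle_subG cycle_subG groupX ?cycle_id.
have utc : commute u t by apply: (centsP (cycle_abelian c)); rewrite -cE.
have nPu : <[u]>%g \subset 'N(P)%g by rewrite cycle_subG (subsetP nPC).
have HE : (P <*> <[u]> = P * <[u]>)%g by rewrite norm_joinEr.
exists (P <*> <[u]>)%G, t, (logn l #[c]%g); split.
- rewrite /= HE TI_cardMg; last first.
    by apply/trivgP; rewrite -tiPC setIS // cycle_subG.
  rewrite Euclid_dvdM // negb_or; apply/andP; split.
    have [n ->] := p_natP pP; apply: contra lp.
    by rewrite Euclid_dvdX // dvdn_prime2 // => /andP[].
  rewrite -orderE order_constt; apply/negP => lu.
  by have /(pnatP _ (part_gt0 _ _))/(_ l l_pr lu) := part_pnat l^' #[c]%g; rewrite !inE eqxx.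
- rewrite -cycle_subG normsY ?cycle_subG ?(subsetP nPC) //.
  by rewrite (subsetP (cent_sub _)) // cent_cycle; apply/cent1P/commute_sym.
- by apply/eqP; rewrite -order_dvdn order_constt p_part.
move=> g; have : g \in (P * C)%g by rewrite PCE inE.
case/mulsgP => x y xP; rewrite cE => /cycleP[i ->] ->.
exists (x * u ^+ i)%g, (i %% l ^ logn l #[c]%g)%N; split.
- by rewrite /= HE mem_mulg // mem_cycle.
- by rewrite ltn_pmod // expn_gt0 prime_gt0.
rewrite -{1}(consttC l c) expgMn; last exact: commute_sym.
rewrite -/t -/u -mulgA; congr (_ * _)%g.
rewrite expg_mod; first exact/esym/commuteX2.
by apply/eqP; rewrite -order_dvdn order_constt p_part.
Qed.

Lemma group_algebra_quasi_split : prime p -> quasi_split_outside p (group_algebra rat gT).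
Proof.
move=> p_pr E [E_ideal _] l l_pr lp.
have [H [t [b [lH tH tb genHt]]]] := ramification_hall_complement l_pr p_pr lp.
have charl : l \in [pchar 'F_l] by rewrite pchar_Fp.
have nzH : #|H|%:R != 0 :> 'F_l by rewrite -(dvdn_pcharf charl).
have [N [a [e [x [c [eP sum1]]]]]] := modular_monogenic_idempotents charl nzH tH tb genHt.
have [F [b' [d [v [FP F_full]]]]] := padic_commuting_idempotents l_pr eP sum1.
exists (subvs_of (ideal_extension (padic_of_rat l_pr) E)).
exists (ideal_extension_fun (padic_of_rat l_pr) E_ideal).
split; first exact: ideal_extensionP.
have nzG : #|[set: gT]|%:R != 0 :> padic l_pr.
  by rewrite -(rmorph_nat (padic_of_rat l_pr)) fmorph_eq0 pnatr_eq0 -lt0n cardG_gt0.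
apply: (corner_product_of_matrix_algebras nzG (fun i => proj1 (FP i)) (fun i => proj2 (FP i)) F_full).
exact: (galg_map_central _ (algid_ideal_central E_ideal)).
Qed.

End QuasiSplit.

(** * The positive involution *)

Section PositiveInvolution.
Variable gT : finGroupType.
Local Notation A := (group_algebra rat gT).
Implicit Types x y : A.

Lemma mul_star_coef1 x : (x * star x) 1%g = \sum_g x g ^+ 2.
Proof.
rewrite ffunE; apply: eq_bigr => g _.
by rewrite ffunE mulg1 invgK.
Qed.

Lemma mul_star_eq0 x : x * star x = 0 -> x = 0.
Proof.
move/ffunP/(_ 1%g); rewrite mul_star_coef1 ffunE => /eqP.
rewrite psumr_eq0 => [/allP x0|g _]; last exact: sqr_ge0.
apply/ffunP => g; rewrite ffunE; apply/eqP.
by have := x0 g (mem_index_enum g); rewrite /= sqrf_eq0.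
Qed.

Lemma star_central x : (forall y, x * y = y * x) -> forall y, star x * y = y * star x.
Proof. by move=> xC y; rewrite -[y](@starK rat gT) -!starM xC. Qed.

(** For y = x - x (star x), centrality gives y (star y) = 0, so y = 0 by positivity; then x = x
    (star x) is fixed by [star]. *)
Lemma star_central_idempotent x : x * x = x -> (forall y, x * y = y * x) -> star x = x.
Proof.
move=> xx xC; have sxC := star_central xC.
have f0 : x - x * star x = 0.
  apply: mul_star_eq0; rewrite linearB /= starM starK.
  have ss : star x * star x = star x by rewrite -starM xx.
  have xc : x * (x * star x) = x * star x by rewrite mulrA xx.
  have cs : x * star x * star x = x * star x by rewrite -mulrA ss.
  by rewrite mulrBl !mulrBr xc cs -[x * star x * _]mulrA sxC -!mulrA ss xc !subrr.
move/eqP: f0; rewrite subr_eq0 => /eqP xE.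
by rewrite {1}xE starM starK -xE.
Qed.

Let n := #|gT|.-1.
Let nE : n.+1 = #|gT|.
Proof. by rewrite prednK //; apply/card_gt0P; exists 1%g. Qed.
Let gi (i : 'I_n.+1) : gT := enum_val (cast_ord nE i).
Let gi_bij : bijective gi.
Proof.
exists (fun g => cast_ord (esym nE) (enum_rank g)) => [i|g].
  by rewrite /gi enum_valK cast_ordK.
by rewrite /gi cast_ordKV enum_rankK.
Qed.

Let vec (R : fieldType) (x : group_algebra R gT) : 'rV[R]_n.+1 := \row_i x (gi i).
(** The matrix of right multiplication by x in the basis of group elements, acting on row
    vectors. *)
Let reg_mx (R : fieldType) (x : group_algebra R gT) : 'M[R]_n.+1 :=
  \matrix_(i, k) x ((gi i)^-1 * gi k)%g.

Let vecM R (x y : group_algebra R gT) : vec (x * y) = vec x *m reg_mx y.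
Proof.
apply/rowP => k; rewrite !mxE ffunE (reindex gi) /=; last exact: onW_bij.
by apply: eq_bigr => i _; rewrite !mxE.
Qed.

Let vec_inj R : injective (@vec R).
Proof.
move=> x y /rowP xy; apply/ffunP => g; have [h hK gK] := gi_bij.
by have := xy (h g); rewrite !mxE gK.
Qed.

Let vec_horner x y (q : {poly rat}) : vec (y * horner_alg x q) = vec y *m horner_mx (reg_mx x) q.
Proof.
elim/poly_ind: q y => [|q c IHq] y.
  by rewrite !rmorph0 mulr0 [RHS]mulmx0; apply/rowP => i; rewrite !mxE ffunE.
rewrite !(rmorphD, rmorphM) /= horner_algX horner_algC horner_mx_X horner_mx_C.
rewrite mulrDr mulmxDr mulrA -mulmxE mulmxA -IHq -vecM mulr_algr mul_mx_scalar.
by apply/rowP => i; rewrite !mxE !ffunE.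
Qed.

Lemma mul_star_annihilator y : exists q : {poly rat}, horner_alg (y * star y) q = 0
  /\ forall z : algC, root (map_poly ratr q) z -> 0 <= z.
Proof.
(* reg_mx (star y) is the transpose of reg_mx y, hence the eigenvalues are >= 0. *)
exists (char_poly (reg_mx (y * star y))); split.
  apply: vec_inj; rewrite -[horner_alg _ _]mul1r vec_horner Cayley_Hamilton mulmx0.
  by apply/rowP => i; rewrite !mxE ffunE.
move=> z; rewrite map_char_poly -eigenvalue_root_char => /eigenvalueP[v vM v0].
pose Y := map_mx (ratr : rat -> algC) (reg_mx y).
have MY : map_mx ratr (reg_mx (y * star y)) = Y *m Y^T.
  apply/matrixP => i k; rewrite !mxE ffunE rmorph_sum /=.
  rewrite (reindex_inj (mulgI (gi i)^-1%g)) /= (reindex gi) /=; last exact: onW_bij.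
  apply: eq_bigr => m _; rewrite !mxE !ffunE rmorphM; congr (_ * ratr (y _)).
  by rewrite !invMg !invgK !mulgA mulgK.
pose vc := map_mx Num.conj v.
have norm_ge0 m (w : 'rV[algC]_m) : 0 <= (w *m (map_mx Num.conj w)^T) 0 0.
  by rewrite mxE sumr_ge0 // => i _; rewrite !mxE mul_conjC_ge0.
have vv : 0 < (v *m vc^T) 0 0.
  rewrite lt_def norm_ge0 andbT; apply: contra_neq v0 => /eqP.
  rewrite mxE psumr_eq0 => [/allP v0|i _]; last by rewrite !mxE mul_conjC_ge0.
  apply/rowP => i; rewrite mxE; apply/eqP; have := v0 i (mem_index_enum i).
  by rewrite !mxE mul_conjC_eq0.
have vYYv : 0 <= (v *m Y *m Y^T *m vc^T) 0 0.
  have -> : v *m Y *m Y^T *m vc^T = (v *m Y) *m (map_mx Num.conj (v *m Y))^T.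
    rewrite map_mxM trmx_mul mulmxA; congr (_ *m _^T *m _).
    by apply/matrixP => i k; rewrite !mxE; apply/esym/CrealP; rewrite ?Creal_Crat // Crat_rat.
  exact: norm_ge0.
move: vYYv; rewrite -(mulmxA v) -MY vM -scalemxAl mxE.
by rewrite pmulr_lge0.
Qed.

End PositiveInvolution.

Lemma rmorph_horner_alg (F : fieldExtType rat) (s : {rmorphism F -> algC}) a (q : {poly rat}) :
  s (horner_alg a q) = (map_poly ratr q).[s a].
Proof.
have sZ (c : rat) : s c%:A = ratr c.
  exact: (fmorph_eq_rat (s \o in_alg F)).
elim/poly_ind: q => [|q c IHq]; first by rewrite !rmorph0 horner0.
rewrite !(rmorphD, rmorphM) /= horner_algX horner_algC map_polyX map_polyC /=.
by rewrite hornerMXaddC IHq sZ.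
Qed.

Section StarField.
Variables (gT : finGroupType) (F : fieldExtType rat).
Local Notation A := (group_algebra rat gT).
Variable j : {linear F -> A}.
Hypotheses (jM : {morph j : a b / a * b}) (j_inj : injective j).

(** The image s(a b) is a root of the polynomial that annihilates j(a) star(j(a)). The map j need
    not be unital, as it will embed the center of a factor in Q[G]; hence the factor j 1 in [jq]. *)
Lemma star_embedding_norm_ge0 (s : {rmorphism F -> algC}) a b :
  j b = star (j a) -> 0 <= s (a * b).
Proof.
move=> jb; have [q [q0 q_ge0]] := mul_star_annihilator (j a).
have jq r : j (horner_alg (a * b) r) = j 1 * horner_alg (j (a * b)) r.
  elim/poly_ind: r => [|r c IHr]; first by rewrite !rmorph0 linear0 mulr0.
  rewrite !(rmorphD, rmorphM) /= !horner_algX !horner_algC linearD /= mulrDr.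
  by rewrite [j (horner_alg _ r * _)]jM IHr mulrA linearZ /= -scalerAr mulr1.
apply: q_ge0; rewrite /root -rmorph_horner_alg.
suff -> : horner_alg (a * b) q = 0 by rewrite rmorph0.
by apply: j_inj; rewrite jq jM jb q0 mulr0 linear0.
Qed.

Lemma star_fixed_real (s : {rmorphism F -> algC}) a : star (j a) = j a -> s a \is Num.real.
Proof.
move=> ja; have := star_embedding_norm_ge0 s (esym ja); rewrite rmorphM -expr2 => sa.
have [z z_ge0 zE] : exists2 z : algC, 0 <= z & z ^+ 2 = s a ^+ 2.
  by exists (sqrtC (s a ^+ 2)); rewrite ?sqrtC_ge0 // sqrtCK.
move/eqP: zE; rewrite eq_sym eqf_sqr => /orP[]/eqP ->; rewrite ?rpredN ger0_real //.
Qed.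

(** With b = - a, positivity gives s(a)^2 <= 0, while a real s(a) has s(a)^2 >= 0. *)
Lemma star_skew_not_real (s : {rmorphism F -> algC}) a :
  star (j a) = - j a -> s a \is Num.real -> a = 0.
Proof.
move=> ja sa; have := star_embedding_norm_ge0 (a := a) (b := - a) s _.
rewrite linearN /= ja => /(_ erefl); rewrite mulrN rmorphN oppr_ge0 rmorphM -expr2.
move=> sa2; have sa2' : 0 <= s a ^+ 2 by rewrite real_exprn_even_ge0.
have : s a ^+ 2 == 0 by rewrite eq_le sa2 sa2'.
by rewrite expf_eq0 /= fmorph_eq0 => /eqP.
Qed.

End StarField.

Section StarFieldCM.
Variables (gT : finGroupType) (F : fieldExtType rat).
Local Notation A := (group_algebra rat gT).
Variable j : {linear F -> A}.
Hypotheses (jM : {morph j : a b / a * b}) (j_inj : injective j).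
Variable tau : F -> F.
Hypothesis tauE : forall a, j (tau a) = star (j a).

(** The totally real subfield is the fixed field W of [tau]. The element d = a0 - tau a0 is skew and
    nonzero: it gives F = W + W d, of degree 2, and no embedding can send it to a real number. *)
Lemma star_field_CM : (exists a, tau a != a) -> CM_field F.
Proof.
move=> [a0 ta0].
have tauB : {morph tau : a b / a - b}.
  by move=> a b; apply: j_inj; rewrite linearB /= !tauE !linearB.
have tauM : {morph tau : a b / a * b}.
  by move=> a b; apply: j_inj; rewrite jM !tauE jM starM -!tauE -!jM mulrC.
have tau1 : tau 1 = 1.
  have t10 : tau 1 != 0.
    apply/eqP => t1; have := oner_neq0 F; case/eqP; apply: j_inj.
    by rewrite -[LHS]starK -tauE t1 !linear0.
  by apply: (mulfI t10); rewrite -tauM !mulr1.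
have tauZ (c : rat) a : tau (c *: a) = c *: tau a.
  by apply: j_inj; rewrite linearZ /= !tauE linearZ /= linearZ.
have tauK a : tau (tau a) = a by apply: j_inj; rewrite !tauE starK.
have tau0 : tau 0 = 0 by have := tauB 0 0; rewrite !subrr.
have tau_lin : linear tau.
  move=> c a b; rewrite -[b in LHS]opprK tauB tauZ; congr (_ + _).
  by rewrite -sub0r tauB tau0 sub0r opprK.
have tauD a b : tau (a + b) = tau a + tau b.
  by have := tau_lin 1 a b; rewrite !scale1r.
have tauV a : tau a^-1 = (tau a)^-1.
  have [->|a0'] := eqVneq a 0.
    by rewrite !(invr0, tau0).
  have ta0' : tau a != 0.
    by apply: contra_neq a0' => ta; rewrite -[a]tauK ta tau0.
  by apply: (mulfI ta0'); rewrite -tauM !mulfV ?tau1.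
pose tl : {linear F -> F} := HB.pack tau (GRing.isLinear.Build rat F F _ tau tau_lin).
pose V0 : {vspace F} := lker (linfun tl - \1)%VF.
have V0P a : reflect (tau a = a) (a \in V0).
  by rewrite memv_ker !lfun_simp /= subr_eq0; apply: eqP.
have V0_aspace : is_aspace V0.
  apply/andP; split; first by apply: has_algid1; apply/V0P.
  by apply/prodvP => a b /V0P ta /V0P tb; apply/V0P; rewrite tauM ta tb.
pose W : {subfield F} := ASpace V0_aspace.
exists W; split.
- move=> s x.
  apply: (@star_fixed_real gT (subvs_of W) (j \o vsval : {linear subvs_of W -> A})).
  + by move=> a b; rewrite /= jM.
  + by move=> a b /j_inj/val_inj.
  by rewrite /= -tauE; have /V0P -> : vsval x \in V0 := subvsP x.
- pose d := a0 - tau a0.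
  have d0 : d != 0 by rewrite subr_eq0 eq_sym.
  have td : tau d = - d by rewrite tauB tauK opprB.
  have two0 : 2%:R != 0 :> rat by [].
  have F_sum : {:F}%VS = (V0 + V0 * <[d]>)%VS.
    apply/eqP; rewrite eqEsubv subvf andbT; apply/subvP => x _; apply/memv_addP.
    exists (2%:R^-1 *: (x + tau x)).
      by apply/V0P; rewrite tauZ tauD tauK addrC.
    exists (2%:R^-1 *: (x - tau x)).
      apply/memv_cosetP; exists (2%:R^-1 *: (x - tau x) / d); last by rewrite divfK.
      apply/V0P; rewrite tauM tauZ tauB tauK tauV td.
      by rewrite invrN mulrN -mulNr -scalerN opprB.
    by rewrite -scalerDr addrACA subrr addr0 -mulr2n -scaler_nat scalerA mulVf ?scale1r.
  have dirF : (V0 :&: V0 * <[d]>)%VS = 0%VS.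
    apply/eqP; rewrite -subv0; apply/subvP => x /memv_capP[/V0P tx].
    move=> /memv_cosetP[y /V0P ty xE]; rewrite memv0.
    have : tau x = - x by rewrite xE tauM ty td mulrN.
    by rewrite tx => /eqP; rewrite -addr_eq0 -mulr2n -scaler_nat scaler_eq0 (negbTE two0).
  have : \dim {:F} = (\dim V0 * 2)%N.
    rewrite F_sum dimv_disjoint_sum // dim_cosetv_unit ?unitfE //.
    by rewrite muln2 addnn.
  by move=> ->; rewrite /= mulKn // lt0n dimv_eq0; apply: contraTneq (adim_gt0 W) => /= ->; rewrite dimv0.
move=> s s_real; case/eqP: ta0.
apply/eqP; rewrite eq_sym -subr_eq0; apply/eqP.
apply: (star_skew_not_real jM j_inj (s := s)); last exact: s_real.
by rewrite -tauE tauB tauK -linearN opprB.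
Qed.

End StarFieldCM.

(** * Central characters *)

(** For a nonzero central x the set x D is a two-sided ideal, hence all of D; so x is invertible,
    and its inverse is central. *)
Lemma simple_center_field (K : fieldType) (D : falgType K) : simple_algebra D ->
  exists (F : fieldExtType K) (i : {lrmorphism F -> D}), identifies_center i.
Proof.
move=> Ds; pose Z := center_aspace {:D}%AS.
have ZP z : reflect (forall x, z * x = x * z) (z \in Z).
  apply: (iffP memv_capP) => [[_ /centvP zC] x|zC]; first exact: zC (memvf x).
  by split; [exact: memvf | apply/centvP => x _; apply: zC].
have algZ : algid Z = 1.
  by apply/eqP; rewrite algid_eq1; apply/ZP => x; rewrite mul1r mulr1.
have [||F [phi [phi' phiK phi'K]]] := @aspace_field_exists K D Z.
- by move=> x y /ZP xC _; apply: xC.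
- move=> x /ZP xC x0.
  pose I := limg (amull x).
  have memI z : reflect (exists y, z = x * y) (z \in I).
    apply: (iffP memv_imgP) => [[y _ ->]|[y ->]]; exists y; rewrite ?lfunE ?memvf //.
  have : two_sided_ideal I.
    apply/andP; split; apply/prodvP => u w.
      by move=> _ /memI[y ->]; apply/memI; exists (u * y); rewrite mulrA -xC mulrA.
    by move=> /memI[y ->] _; apply/memI; exists (y * w); rewrite mulrA.
  case/Ds => I_eq.
    have /memI : exists y, x * 1 = x * y by exists 1.
    by rewrite I_eq memv0 mulr1 (negbTE x0).
  have : 1 \in I by rewrite I_eq memvf.
  case/memI => y xy; exists y; last by rewrite -xy algZ.
  apply/ZP => z; have yx : y * x = 1 by rewrite -xC.
  by rewrite -[LHS]mulr1 xy mulrA -(mulrA y z x) -xC mulrA yx mul1r.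
exists F.
pose j (a : F) : D := vsval (phi a).
have j_lin : linear j by move=> c a b; rewrite /j linearP.
have j_mon : monoid_morphism j.
  by split=> [|a b]; rewrite /j ?rmorphM // rmorph1 /= algZ.
pose jm : {lrmorphism F -> D} :=
  HB.pack j (GRing.isLinear.Build K F D _ j j_lin) (GRing.isMonoidMorphism.Build F D j j_mon).
exists jm; split=> [a b /val_inj/(can_inj phiK)//|z]; split=> [zZ|[a ->]]; last exact: subvsP.
by exists (phi' (Subvs (zZ : z \in Z))); rewrite /= /j phi'K.
Qed.

Section CentralCharacter.
Variables (gT : finGroupType) (i : Iirr [set: gT]).
Local Notation A := (group_algebra rat gT).
Implicit Types x y : A.

Definition irr_value x : algC := \sum_g ratr (x g) * 'chi_i g.
(** By Schur's lemma ([rho_central]), a central x acts by this scalar in the representation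
    affording ['chi_i]. *)
Definition central_char x : algC := irr_value x / 'chi_i 1%g.

Let rho x : 'M[algC]_(irr_degree (socle_of_Iirr i)) := \sum_g ratr (x g) *: 'Chi_i g.

Let rhoM x y : rho (x * y) = rho x *m rho y.
Proof.
rewrite /rho mulmx_suml.
under [RHS]eq_bigr do rewrite mulmx_sumr.
transitivity (\sum_g \sum_h (ratr (x h) * ratr (y (h^-1 * g)%g)) *: 'Chi_i g).
  apply: eq_bigr => g _; rewrite ffunE rmorph_sum scaler_suml.
  by apply: eq_bigr => h _; rewrite rmorphM.
rewrite exchange_big; apply: eq_bigr => h _.
rewrite (reindex_inj (mulgI h)); apply: eq_bigr => g _.
by rewrite mulKg repr_mxM ?inE // -scalemxAl -scalemxAr scalerA.
Qed.

Let tr_rho x : \tr (rho x) = irr_value x.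
Proof.
rewrite /rho raddf_sum; apply: eq_bigr => g _; rewrite /= mxtraceZ.
by rewrite -[in RHS]irrRepr cfunE inE mulr1n.
Qed.

Let rho_gelt g : rho (gelt rat g) = 'Chi_i g.
Proof.
rewrite /rho (bigD1 g) //= big1 ?addr0 => [|h /negbTE hg].
  by rewrite ffunE eqxx rmorph1 scale1r.
by rewrite ffunE hg rmorph0 scale0r.
Qed.

Let rho_central x : (forall y, x * y = y * x) -> rho x = (central_char x)%:M.
Proof.
move=> xC; have absirr : mx_absolutely_irreducible 'Chi_i.
  exact/groupC/socle_irr.
have /is_scalar_mxP[a aE] : is_scalar_mx (rho x).
  apply: (mx_abs_irr_cent_scalar absirr); apply/centgmxP => g _.
  by rewrite -rho_gelt -!rhoM xC.
rewrite aE /central_char -tr_rho aE mxtrace_scalar irr1_degree -[a *+ _]mulr_natr mulfK //.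
by rewrite -irr1_degree irr1_neq0.
Qed.

Lemma central_charM x y : (forall z, x * z = z * x) -> (forall z, y * z = z * y) ->
  central_char (x * y) = central_char x * central_char y.
Proof.
move=> xC yC; have xyC z : x * y * z = z * (x * y) by rewrite -mulrA yC mulrA xC mulrA.
have := rhoM x y; rewrite !rho_central // -scalar_mxM => /matrixP eq_mx.
have n_gt0 : (0 < irr_degree (socle_of_Iirr i))%N.
  by rewrite -(ltr0n algC) -irr1_degree irr1_gt0.
by have := eq_mx (Ordinal n_gt0) (Ordinal n_gt0); rewrite !mxE eqxx !mulr1n.
Qed.

Lemma central_char_star x : central_char (star x) = (central_char x)^*.
Proof.
rewrite /central_char /irr_value rmorphM /= fmorphV /= (conj_natr (Cnat_irr1 i)) rmorph_sum /=.
congr (_ / _); rewrite (reindex_inj invg_inj) /=; apply: eq_bigr => g _.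
rewrite ffunE invgK irr_inv rmorphM; congr (_ * _).
by apply/esym/CrealP; rewrite Creal_Crat // Crat_rat.
Qed.

Lemma central_charB : zmod_morphism central_char.
Proof.
move=> x y; rewrite /central_char /irr_value -mulrBl -sumrB; congr (_ / _).
by apply: eq_bigr => g _; rewrite !ffunE rmorphB mulrBl.
Qed.

(** The sum runs over all conjugators, so it is the usual class sum multiplied by the order of the
    centralizer of g. *)
Definition class_sum (g : gT) : A := \sum_h gelt rat (g ^ h)%g.

Lemma class_sum_central g y : class_sum g * y = y * class_sum g.
Proof.
rewrite [y]gelt_sum mulr_sumr mulr_suml; apply: eq_bigr => k _.
rewrite -scalerAl -scalerAr; congr (_ *: _).
rewrite /class_sum mulr_sumr mulr_suml [RHS](reindex_inj (mulIg k)) /=.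
apply: eq_bigr => h _; rewrite -!geltM; congr gelt.
by rewrite conjgM -conjgC.
Qed.

Lemma central_char_class_sum g :
  central_char (class_sum g) = #|gT|%:R * 'chi_i g / 'chi_i 1%g.
Proof.
rewrite /central_char /irr_value; congr (_ / _).
have gE h : \sum_k ratr (gelt rat (g ^ h)%g k) * 'chi_i k = 'chi_i g.
  rewrite (bigD1 (g ^ h)%g) //= big1 ?addr0 => [|k /negbTE kg].
    by rewrite ffunE eqxx rmorph1 mul1r cfunJ ?inE.
  by rewrite ffunE kg rmorph0 mul0r.
transitivity (\sum_(h : gT) \sum_k ratr (gelt rat (g ^ h)%g k) * 'chi_i k).
  rewrite exchange_big; apply: eq_bigr => k _ /=.
  by rewrite /class_sum sum_ffunE rmorph_sum mulr_suml.
by under eq_bigr do rewrite gE; rewrite sumr_const mulr_natl.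
Qed.

End CentralCharacter.

(** Evaluating the regular character on x expresses |G| x(1) as the sum of chi(1) chi(x) over all
    irreducible chi, so these values cannot all vanish. *)
Lemma central_char_neq0 (gT : finGroupType) (x : group_algebra rat gT) :
  x 1%g != 0 -> exists i : Iirr [set: gT], central_char i x != 0.
Proof.
move=> x1; apply: contrapT => noi; case/eqP: x1; apply/eqP.
have irr0 (i : Iirr [set: gT]) : irr_value i x = 0.
  apply/eqP; apply: contrapT => /negP xi; apply: noi; exists i.
  by rewrite mulf_neq0 // invr_eq0 irr1_neq0.
rewrite -(fmorph_eq0 (ratr : rat -> algC)); apply/eqP.
have nG : #|[set: gT]|%:R != 0 :> algC by rewrite pnatr_eq0 -lt0n cardG_gt0.
apply: (mulIf nG); rewrite mul0r.
transitivity (\sum_g ratr (x g) * cfReg [set: gT]%G g).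
  rewrite (bigD1 1%g) //= big1 ?addr0 => [|g /negbTE g1]; rewrite cfRegE ?eqxx //.
  by rewrite g1 mulr0.
rewrite cfReg_sum; under eq_bigr do rewrite sum_cfunE mulr_sumr.
rewrite exchange_big big1 // => i _.
transitivity ('chi_i 1%g * irr_value i x); last by rewrite irr0 mulr0.
by rewrite mulr_sumr; apply: eq_bigr => g _; rewrite cfunE mulrCA.
Qed.

(** * Real characters *)

Lemma expr_coprime_eq1 (F : fieldType) (z : F) m n :
  coprime m n -> z ^+ m = 1 -> z ^+ n = 1 -> z = 1.
Proof.
move=> co_mn zm zn; have [m0|m_gt0] := posnP m.
  by move: co_mn; rewrite m0 /coprime gcd0n => /eqP n1; rewrite n1 expr1 in zn.
have [a b ab _] := egcdnP n m_gt0; rewrite (eqP co_mn) in ab.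
have : z ^+ (a * m) = z ^+ (b * n + 1) by rewrite ab.
by rewrite exprD expr1 mulnC exprM zm expr1n mulnC exprM zn expr1n mul1r.
Qed.

Section GaloisAction.
Variable u : {rmorphism algC -> algC}.

(** On the cyclic group generated by x the character is a sum of linear characters, whose values are
    |H|-th roots of unity and so are fixed by u. *)
Lemma cfAut_fix_char (gT : finGroupType) (H : {group gT}) (phi : 'CF(H)) :
    (forall z, z ^+ #|H| = 1 -> u z = z) -> phi \is a character ->
  cfAut u phi = phi.
Proof.
move=> uH Nphi; apply/cfun_inP => x Hx; rewrite cfunE.
have sxH : (<[x]> \subset H)%g by rewrite cycle_subG.
rewrite -(cfResE phi sxH (cycle_id x)).
rewrite ['Res[<[x]>%G] phi]cfun_sum_cfdot sum_cfunE rmorph_sum; apply: eq_bigr => i _.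
rewrite cfunE rmorphM.
congr (_ * _); first by rewrite /= aut_natr // Cnat_cfdot_char_irr ?cfRes_char.
apply: uH; have lin_i : 'chi_i \is a linear_char.
  by have /char_abelianP := cycle_abelian x; apply.
by rewrite -lin_charX ?cycle_id // (eqP (_ : x ^+ #|H| == 1)%g) ?lin_char1 // -order_dvdn order_dvdG.
Qed.

Lemma cfDet_aut (gT : finGroupType) (G : {group gT}) (phi : 'CF(G)) :
  phi \is a character -> cfDet (cfAut u phi) = cfAut u (cfDet phi).
Proof.
case/char_reprP=> rG ->; rewrite -cfRepr_map !cfDetRepr.
by apply/cfun_inP => x Gx; rewrite !cfunE Gx !mulr1n !trace_mx11 !mxE det_map_mx.
Qed.

End GaloisAction.

(* Let t be a constituent of the restriction of i to P, T its inertia group and s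
   the character of T above t that induces i. Both the Galois conjugate of s and
   s lie above t, so they differ by a linear character mu of T / P. Reality of i
   makes s conjugate in G to its complex conjugate; hence the prime-to-p part of
   det s is real, therefore +1 or -1 and fixed by u, and comparing determinants
   gives mu ^ t(1) = 1 up to p-torsion, that is mu = 1. *)
Section RealCharacter.
Variables (gT : finGroupType) (P G : {group gT}) (u : {rmorphism algC -> algC}).
Hypotheses (nsPG : (P <| G)%g) (abGP : abelian (G / P)%g)
           (coPG : coprime #|P| #|G : P|%g).
Hypothesis uP : forall z, z ^+ #|P| = 1 -> u z = z.

Lemma cfAut_fix_real_irr (i : Iirr G) : ('chi_i)^*%CF = 'chi_i -> cfAut u 'chi_i = 'chi_i.
Proof.
move=> chiR; have [sPG nPG] := andP nsPG.
have [t tP] := constt_cfRes_irr P i.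
have tu : cfAut u 'chi_t = 'chi_t := cfAut_fix_char uP (irr_char t).
pose T := 'I_G['chi_t]%G.
have sTG : T \subset G by apply: Inertia_sub.
have nsPT : (P <| T)%g := normal_Inertia 'chi_t sPG.
have sPT := normal_sub nsPT.
have abTP : abelian (T / P)%g by rewrite (abelianS _ abGP) ?quotientS.
have nsTG : (T <| G)%g by rewrite sub_der1_normal // (subset_trans (der1_min nPG abGP)).
have coPT : coprime #|P| #|T : P|%g by rewrite (coprime_dvdr (indexSg sPT sTG)).
have dvdP : (Num.truncn ('chi_t 1%g) %| #|P|)%N.
  by have := dvd_irr1_cardG t; rewrite -{1}(truncnK (Cnat_irr1 t)) dvdC_nat.
have t_inT : T \subset 'I['chi_t]%g by apply: subsetIr.
have coT : coprime #|T : P|%g ('o('chi_t)%CF * Num.truncn ('chi_t 1%g)).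
  rewrite coprime_sym coprimeMl (coprime_dvdl (cfDet_order_dvdG _) coPT).
  by rewrite (coprime_dvdl dvdP coPT).
(* The index |T : P| is prime to the degree and to the determinantal order of ['chi_t], so this
   T-invariant character extends to T. *)
have [c [c_t _ _]] := extend_solvable_coprime_irr nsPT (abelian_sol abTP) t_inT coT.
have [A_irr A_inj A_im _ _] := constt_Inertia_bijection t nsPG.

have lin_mod (b : Iirr (T / P)) : 'chi_(mod_Iirr b) \is a linear_char.
  have /char_abelianP linTP := abTP.
  by rewrite mod_IirrE // cfMod_lin_char.
have Res_mod (b : Iirr (T / P)) : 'Res[P] 'chi_(mod_Iirr b) = 1.
  rewrite cfRes_sub_ker ?lin_char1 ?scale1r //.
  by rewrite mod_IirrE // cfker_mod.
have gallagher d (d_t : 'Res 'chi[T]_d = 'chi_t) s : s \in irr_constt ('Ind[T] 'chi_t) ->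
    exists b : Iirr (T / P), 'chi_s = 'chi_(mod_Iirr b) * 'chi_d.
  have [bd_irr _ -> _] := constt_Ind_ext nsPT d_t.
  by case/codomP => b ->; exists b; rewrite -(cfIirrE (bd_irr b)).
(* By Gallagher's theorem with T / P abelian, the characters of T above ['chi_t] are exactly its
   extensions. *)
have Res_A s : (s \in irr_constt ('Ind[T] 'chi_t)) = ('Res[P] 'chi_s == 'chi_t).
  apply/idP/eqP => [/(gallagher _ c_t)[b ->]|sE].
    by rewrite rmorphM /= Res_mod mul1r.
  by rewrite constt_Ind_Res sE constt_irr inE.

have [s sA chiE] : exists2 s, s \in irr_constt ('Ind[T] 'chi_t) & 'chi_i = 'Ind[G] 'chi_s.
  move: tP; rewrite -constt_Ind_Res -A_im => /imsetP[s sA ->].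
  by exists s; rewrite // cfIirrE ?A_irr.
have s_t : 'Res 'chi_s = 'chi_t by apply/eqP; rewrite -Res_A.
have inj_A s' : 'Res 'chi[T]_s' = 'chi_t -> 'Ind[G] 'chi_s' = 'chi_i -> s' = s.
  move/eqP; rewrite -Res_A => s'A s'i; apply: A_inj => //.
  by apply: irr_inj; rewrite !cfIirrE ?A_irr // s'i.
(* Since chi is real, the conjugate of ['chi_t] is also a constituent of its restriction to P, and
   by Clifford these constituents form a single G-orbit. *)
have [h Gh tC] : exists2 h, h \in G & 'chi_t = (('chi_t)^* ^ h)%CF.
  apply/(cfclassP G); have tCP : conjC_Iirr t \in irr_constt ('Res[P] 'chi_i).
    rewrite irr_consttE conjC_IirrE -chiR -cfAutRes cfdot_conjC.
    by rewrite fmorph_eq0 -irr_consttE.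
  rewrite -conjC_IirrE; apply/idPn => t_notin; case/negP: tP.
  rewrite (Clifford_Res_sum_cfclass nsPG tCP) cfdotZl cfdot_suml big_seq big1 ?mulr0 // => psi.
  case/cfclassP => h Gh psiE; rewrite psiE -conjg_IirrE cfdot_irr; case: eqP => // ht.
  by case/negP: t_notin; apply/(cfclassP G); exists h; rewrite // -conjg_IirrE ht.
have sC : 'chi_s = (('chi_s)^* ^ h)%CF.
  rewrite -conjC_IirrE -conjg_IirrE; congr 'chi_ _; apply/esym/inj_A.
    rewrite conjg_IirrE conjC_IirrE -(cfConjgRes _ nsTG nsPG Gh) -cfAutRes s_t.
    by rewrite -tC.
  rewrite conjg_IirrE -(cfConjgInd _ (normal_refl G) nsTG Gh) (cfConjg_id _ Gh).
  by rewrite conjC_IirrE -cfAutInd -chiE chiR.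
pose d := cfDet 'chi_s; have lin_d : d \is a linear_char := cfDet_lin_char _.
have dC : d = (d^* ^ h)%CF by rewrite /d {1}sC cfDetConjg cfDet_aut ?irr_char.
have [b sb] : exists b : Iirr (T / P), cfAut u 'chi_s = 'chi_(mod_Iirr b) * 'chi_s.
  rewrite -aut_IirrE; apply: (gallagher s s_t).
  by rewrite Res_A aut_IirrE -cfAutRes s_t tu.
pose mu := 'chi_(mod_Iirr b); have lin_mu : mu \is a linear_char := lin_mod b.
have du : cfAut u d = mu ^+ Num.truncn ('chi_t 1%g) * d.
  rewrite -cfDet_aut ?irr_char // sb cfDet_mul_lin ?irr_char //.
  by rewrite -s_t cfRes1.
have dP x : x \in P -> d x ^+ #|P| = 1.
  move=> Px; have Tx := subsetP sPT x Px.
  by rewrite -lin_charX // (eqP (_ : x ^+ #|P| == 1)%g) ?lin_char1 // -order_dvdn order_dvdG.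
suff mu1 : mu = 1 by rewrite chiE cfAutInd sb -/mu mu1 mul1r.
apply/cfun_inP => x Tx; rewrite cfun1E Tx.
(* The conjugate of x by h^-1 differs from x by a commutator in P, on which d^|P| is trivial. Hence
   d(x)^|P| equals its complex conjugate; being of modulus 1, it is 1 or -1. *)
have uz : u (d x ^+ #|P|) = d x ^+ #|P|.
  have dR : (d x ^+ #|P|)^* = d x ^+ #|P|.
    have Gx := subsetP sTG x Tx; have Th y : y \in T -> (y ^ h^-1)%g \in T.
      by rewrite memJ_norm // groupV (subsetP (normal_norm nsTG)).
    have Px : [~ x, h^-1]%g \in P.
      by apply: (subsetP (der1_min nPG abGP)); rewrite mem_commg ?groupV.
    rewrite [in RHS]dC cfConjgE ?(subsetP (normal_norm nsTG)) // cfunE -rmorphXn /=.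
    by rewrite conjg_mulR (lin_charM lin_d Tx (subsetP sPT _ Px)) exprMn (dP _ Px) mulr1.
  have : d x ^+ #|P| * d x ^+ #|P| = 1.
    by rewrite -{2}dR -normCK normrX normC_lin_char // !expr1n.
  move/eqP; rewrite -expr2 sqrf_eq1 => /orP[]/eqP->; first by rewrite rmorph1.
  by rewrite rmorphN1.
(* The value mu(x) is killed by t(1) |P|, by comparing determinants, and by |T : P|, as mu is
   trivial on P; these exponents are coprime because t(1) divides |P|. *)
apply: (@expr_coprime_eq1 _ _ (Num.truncn ('chi_t 1%g) * #|P|) #|T : P|%g).
- by rewrite coprimeMl coPT (coprime_dvdl dvdP).
- have dx0 : d x ^+ #|P| != 0 by rewrite expf_neq0 ?lin_char_neq0.
  apply: (mulIf dx0); rewrite mul1r -[RHS]uz rmorphXn /=.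
  have -> : u (d x) = cfAut u d x by rewrite cfunE.
  by rewrite du cfunE exp_cfunE // exprMn exprM.
have xP : (x ^+ #|T : P|%g)%g \in P.
  have nPx := subsetP (normal_norm nsPT) x Tx.
  apply: coset_idr; first exact: groupX.
  rewrite morphX //= -card_quotient ?normal_norm //.
  by apply/eqP; rewrite -order_dvdn order_dvdG // mem_quotient.
have Res_mu : 'Res[P] mu = 1 := Res_mod b.
by rewrite -lin_charX // -(cfResE mu sPT xP) Res_mu cfun1E xP.
Qed.

End RealCharacter.

(** Galois theory in a number field containing the character values and a primitive |G|-th root of
    unity w: the values of a real character are fixed by all automorphisms fixing w', a primitive
    |P|-th root of unity, so they lie in Q(w'). *)
Lemma real_irr_in_Qmu (p : nat) (gT : finGroupType) (P G : {group gT}) (i : Iirr G) :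
    (P <| G)%g -> abelian (G / P)%g -> coprime #|P| #|G : P|%g -> (p.-group P)%g ->
    ('chi_i)^*%CF = 'chi_i ->
  exists (k : nat) (w : algC), (p ^ k)%N.-primitive_root w /\
    forall g, exists q : {poly rat}, 'chi_i g = (map_poly ratr q).[w].
Proof.
move=> nsPG abGP coPG pP chiR.
have [Qn galQn [QnC gQnC [w [w_prim _] QnG]]] := group_num_field_exists G.
pose w' := w ^+ (#|G| %/ #|P|).
have w'_prim : #|P|.-primitive_root w'.
  exact: dvdn_prim_root (cardSg (normal_sub nsPG)).
have [k kE] := p_natP pP.
exists k, (QnC w'); split; first by rewrite -kE fmorph_primitive_root.
move=> g; have [Gg|nGg] := boolP (g \in G); last first.
  by exists 0; rewrite cfun0 // rmorph0 horner0.
have [a aE] := QnG _ _ _ (irr_char i) g (order_dvdG Gg).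
have : a \in <<1; w'>>%VS.
  have galw : galois <<1; w'>> {:Qn} by apply: galoisS galQn; rewrite sub1v subvf.
  rewrite -(galois_fixedField galw); apply/fixedFieldP; first exact: memvf.
  move=> nu nu_gal; have [u uE] := gQnC nu.
  apply: (fmorph_inj QnC); rewrite uE aE.
  have <- : cfAut u 'chi_i g = u ('chi_i g) by rewrite cfunE.
  rewrite (@cfAut_fix_real_irr _ P) // => z.
  have w'C : #|P|.-primitive_root (QnC w') by rewrite fmorph_primitive_root.
  move/(prim_rootP w'C) => [j ->]; rewrite rmorphXn /= -uE.
  by rewrite (fixed_gal _ nu_gal) ?subvf // memv_adjoin.
case/Fadjoin_polyP => q /polyOver1P[r ->] aq; exists r.
rewrite -aE aq -horner_map -map_poly_comp; congr (_.[_]).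
by apply: eq_map_poly => c /=; rewrite alg_num_field fmorph_rat.
Qed.

(** * Centers of simple factors *)

Section SimpleFactorCenter.
Variables (gT : finGroupType).
Local Notation A := (group_algebra rat gT).
Variables (E : {aspace A}) (F : fieldExtType rat) (i : {lrmorphism F -> subvs_of E}).
Hypotheses (E_ideal : two_sided_ideal E) (iC : identifies_center i).
Local Notation e := (algid E).

Definition center_in (a : F) : A := vsval (i a).
Local Notation j := center_in.

Lemma center_in_linear : linear j.
Proof. by move=> c a b; rewrite /j linearP. Qed.
HB.instance Definition _ := GRing.isLinear.Build rat F A _ j center_in_linear.

Lemma center_inM : {morph j : a b / a * b}.
Proof. by move=> a b; rewrite /j rmorphM. Qed.

Lemma center_in1 : j 1 = e.
Proof. by rewrite /j rmorph1. Qed.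

Lemma center_in_inj : injective j.
Proof. by move=> a b /val_inj; apply: iC.1. Qed.

Lemma center_in_central a y : j a * y = y * j a.
Proof.
have jE : j a \in E by apply: subvsP.
have /memv_capP[_ /centvP iZ] : i a \in 'Z({:subvs_of E})%VS by apply/iC.2; exists a.
have eyE : e * y \in E by rewrite (mem_ideal_algid E_ideal) mulrA (algidl (memv_algid E)).
have /(congr1 vsval) /= := iZ (Subvs eyE) (memvf _).
by rewrite -/(j a) mulrA (algidr jE) (algid_ideal_central E_ideal y) -mulrA (algidl jE).
Qed.

Lemma center_inP x : x \in E -> (forall y, x * y = y * x) -> exists a, x = j a.
Proof.
move=> xE xC; have [|a xa] := (iC.2 (Subvs xE)).1.
  apply/memv_capP; split; first exact: memvf.
  by apply/centvP => y _; apply: val_inj; rewrite /= xC.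
by exists a; rewrite /j -xa.
Qed.

Lemma star_algid : star e = e.
Proof. by apply: star_central_idempotent (algid_ideal_central E_ideal); rewrite algidl ?memv_algid. Qed.

Lemma center_star_exists : {tau : F -> F | forall a, j (tau a) = star (j a)}.
Proof.
suff /choice[tau tauE] : forall a, exists b, j b = star (j a) by exists tau.
move=> a; have [||b] := @center_inP (star (j a)); last by exists b.
  have jE : j a \in E by apply: subvsP.
  rewrite (mem_ideal_algid E_ideal) -{1}star_algid -starM.
  by rewrite (algidr jE).
exact: star_central (center_in_central a).
Qed.

(** Such a k is a character belonging to the factor E. As e = e (star e), the coefficient of e at 1
    is a nonzero sum of squares, so some central character is nonzero at e; its value there is
    idempotent, hence 1. *)
Lemma exists_central_char_algid : exists k : Iirr [set: gT], central_char k e = 1.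
Proof.
have ee : e * e = e by rewrite algidl ?memv_algid.
have [|k k0] := @central_char_neq0 gT e.
  rewrite -ee -{2}star_algid mul_star_coef1.
  have ge0 g : true -> 0 <= e g ^+ 2 by move=> _; exact: sqr_ge0.
  apply: contraNneq (algid_neq0 E) => /eqP; rewrite psumr_eq0 // => /allP e0.
  apply/eqP/ffunP => g; rewrite ffunE; apply/eqP.
  by have := e0 g (mem_index_enum g); rewrite sqrf_eq0.
exists k; apply: (mulfI k0); rewrite mulr1 -central_charM ?ee //; exact: algid_ideal_central.
Qed.

Lemma central_char_embedding (k : Iirr [set: gT]) : central_char k e = 1 ->
  exists s : {rmorphism F -> algC}, forall a, s a = central_char k (j a).
Proof.
move=> ke; pose s a := central_char k (j a).
have sB : zmod_morphism s by move=> a b; rewrite /s linearB /= central_charB.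
have sM : monoid_morphism s.
  split=> [|a b]; first by rewrite /s center_in1.
  by rewrite /s center_inM central_charM //; exact: center_in_central.
pose s' : {rmorphism F -> algC} :=
  HB.pack s (GRing.isZmodMorphism.Build F algC s sB) (GRing.isMonoidMorphism.Build F algC s sM).
by exists s'.
Qed.

(** The value of chi at g is recovered, up to a positive rational factor, as the central character
    of e times the class sum of g. This element lies in the center of E, so [star] fixes it, and on
    central characters [star] acts as complex conjugation. *)
Lemma real_irr_of_star_fixed (k : Iirr [set: gT]) : central_char k e = 1 ->
  (forall a, star (j a) = j a) -> ('chi_k)^*%CF = 'chi_k.
Proof.
move=> ke starj; have eC := algid_ideal_central E_ideal.
apply/cfunP => g; rewrite cfunE.
have cC : forall y, class_sum g * y = y * class_sum g by apply: class_sum_central.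
have [||a xa] := @center_inP (e * class_sum g).
- by rewrite (mem_ideal_algid E_ideal) mulrA algidl ?memv_algid.
- by move=> y; rewrite -mulrA cC !mulrA eC.
have := central_char_star k (e * class_sum g).
rewrite xa starj -xa central_charM // ke mul1r central_char_class_sum.
rewrite rmorphM /= fmorphV /= (conj_natr (Cnat_irr1 k)) rmorphM /= rmorph_nat.
have nz : #|gT|%:R / 'chi_k 1%g != 0.
  by rewrite mulf_neq0 ?invr_eq0 ?irr1_neq0 // pnatr_eq0 -cardsT -lt0n cardG_gt0.
by move=> eq_chi; apply: (mulfI nz); rewrite mulrAC -eq_chi mulrAC.
Qed.

Lemma center_CM_or_cyclotomic (p : nat) : ramification_group p [set: gT] ->
  CM_field F \/ subfield_of_Qmu_pinfty p F.
Proof.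
move=> [P [C [/sdprodP[_ defG nPC tiPC] pP cycC coC]]].
have [tau tauE] := center_star_exists.
have [tau_id|/existsNP[a /eqP ta]] := pselect (forall a, tau a = a); last first.
  by left; apply: (star_field_CM center_inM center_in_inj tauE); exists a.
right; have [k ke] := exists_central_char_algid.
have kR : ('chi_k)^*%CF = 'chi_k.
  by apply: real_irr_of_star_fixed ke _ => a; rewrite -tauE tau_id.
have nsPG : (P <| [set: gT])%g.
  by rewrite -defG /normal mulG_subl mulG_subG normG.
have cycGP : cyclic ([set: gT] / P)%g by rewrite -defG quotientMidl quotient_cyclic.
have coPG : coprime #|P| #|[set: gT] : P|%g.
  have [n ->] := p_natP pP; rewrite coprimeXl // coprime_sym.
  rewrite (coprime_dvdl _ coC) // -card_quotient ?normal_norm // -defG quotientMidl.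
  exact: dvdn_quotient.
have [n [w [w_prim kQ]]] := real_irr_in_Qmu nsPG (cyclic_abelian cycGP) coPG pP kR.
have [s sE] := central_char_embedding ke.
exists s => a; have [q qE] : exists q : {poly rat}, s a = (map_poly ratr q).[w].
  have [f fE] := choice kQ; rewrite sE /central_char /irr_value.
  exists ((\sum_g (j a g : rat) *: f g) * (Num.truncn ('chi_k 1%g))%:R^-1%:P).
  rewrite rmorphM /= hornerM map_polyC hornerC /= fmorphV rmorph_nat truncnK ?Cnat_irr1 //.
  rewrite rmorph_sum horner_sum; congr (_ / _); apply: eq_bigr => g _ /=.
  by rewrite map_polyZ hornerZ -fE.
by exists n, w, q.
Qed.

End SimpleFactorCenter.

(** * Groups of odd order and type III *)

Lemma odd_real_irr1 (gT : finGroupType) (G : {group gT}) (i : Iirr G) :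
  odd #|G| -> ('chi_i)^*%CF = 'chi_i -> i = 0.
Proof.
move=> oddG chiR; apply/eqP; apply/negPn/negP => i0.
(* Burnside's argument: g and g^-1 are distinct for g nontrivial, and the ranking r selects one
   element of each pair. Orthogonality to the trivial character then reads chi(1) = -2 S with S an
   algebraic integer, so chi(1) is even although it divides |G|. *)
pose r (g : gT) := enum_rank g.
pose S := \sum_(g in G | (r g < r g^-1%g)%N) 'chi_i g.
have chiV g : 'chi_i g^-1%g = 'chi_i g.
  by rewrite irr_inv -[in RHS]chiR cfunE.
have S_int : S \in Aint.
  by apply: rpred_sum => g _; apply: Aint_irr.
have chi_sum : 'chi_i 1%g + (S + S) = 0.
  have : '['chi_i, 'chi_0] = 0 by rewrite cfdot_irr (negbTE i0).
  rewrite cfdotE => /eqP; rewrite mulf_eq0 invr_eq0 (negPf (neq0CG G)) => /eqP <-.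
  rewrite (bigD1 1%g) ?group1 //= irr0 cfun11 rmorph1 mulr1; congr (_ + _).
  rewrite (bigID (fun g => (r g < r g^-1%g)%N)) /=; congr (_ + _).
    apply: eq_big => [g|g /andP[Gg _]]; last by rewrite cfun1E Gg rmorph1 mulr1.
    by rewrite -andbA; congr (_ && _); case: eqP => // ->; rewrite invg1 ltnn.
  rewrite /S (reindex_inj invg_inj) /=; apply: eq_big => [g|g /andP[Gg _]]; last first.
    by rewrite groupV in Gg; rewrite cfun1E Gg rmorph1 mulr1 chiV.
  rewrite groupV invgK -andbA; apply: andb_id2l => Gg; have [->|g1] := eqVneq.
    by rewrite invg1 ltnn.
  rewrite /= -leqNgt [RHS]leq_eqVlt; have [rE|//] := eqVneq (r g^-1%g : nat) (r g).
  have gV : (g^-1 = g)%g by apply/enum_rank_inj/ord_inj.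
  apply: contraNeq g1 => _; have : (#[g]%g %| 2)%N by rewrite order_dvdn expgS expg1 -{1}gV mulVg.
  have : odd #[g]%g := dvdn_odd (order_dvdG Gg) oddG.
  rewrite -order_eq1; case: #[g]%g (order_gt0 g) => [|[|[|n]]] //.
have dvd_chi := dvd_irr1_cardG i.
have /natrP[d dE] := Cnat_irr1 i; rewrite dE dvdC_nat in dvd_chi.
have : ('chi_i 1%g == 0 %[mod 2%N])%A.
  rewrite -(eqAmodDr _ (S + S)) chi_sum add0r eqAmod_sym.
  by rewrite -mulr2n -mulr_natr; apply: eqAmodMl0.
by rewrite dE eqAmod0_nat dvdn2 (dvdn_odd dvd_chi).
Qed.

(** Commuting with scalar matrices makes the entry at (0, 0) central; commuting with the elementary
    matrices of row 0 makes M scalar. *)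
Lemma matrix_center (F : fieldType) (D : falgType F) n (M : 'M[D]_n.+1) :
  (forall N, M * N = N * M) -> exists2 z, z \in 'Z({:D})%VS & M = z%:M.
Proof.
move=> MC; exists (M 0 0).
  apply/memv_capP; split; first exact: memvf.
  apply/centvP => d _; have /matrixP/(_ 0 0) := MC d%:M.
  rewrite -!mulmxE !mxE (bigD1 0) //= big1 => [|k /negbTE k0]; last first.
    by rewrite !mxE k0 mulr0.
  rewrite !mxE eqxx addr0 mulr1n => ->.
  rewrite (bigD1 0) //= big1 => [|k /negbTE k0]; first by rewrite !mxE eqxx addr0.
  by rewrite !mxE eq_sym k0 mul0r.
apply/matrixP => a b; have /matrixP/(_ 0 b) := MC (delta_mx 0 a).
rewrite -!mulmxE !mxE (bigD1 0) //= big1 => [|k /negbTE k0]; last first.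
  by rewrite !mxE k0 mulr0.
rewrite (bigD1 a) //= big1 => [|k /negbTE ka]; last first.
  by rewrite !mxE ka andbF mul0r.
rewrite !mxE !eqxx mul1r !addr0 /= eq_sym => <-.
by case: (a == b); rewrite ?mulr1 ?mulr0.
Qed.

Section TypeThree.
Variables (gT : finGroupType).
Local Notation A := (group_algebra rat gT).
Variables (E : {aspace A}).
Hypotheses (E_ideal : two_sided_ideal E) (E_simple : simple_algebra (subvs_of E)).

(** The sum eps of all group elements lies in E and satisfies x eps = eps x = aug(x) eps, where aug
    is the sum of coefficients. The line spanned by eps is therefore a nonzero two-sided ideal of
    the simple algebra E, hence all of E. *)
Lemma trivial_simple_factor_comm : central_char (0 : Iirr [set: gT]) (algid E) = 1 ->
  forall x y : subvs_of E, x * y = y * x.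
Proof.
move=> e1; pose eps : A := \sum_g gelt rat g.
have nz : #|gT|%:R != 0 :> rat by rewrite pnatr_eq0 -cardsT -lt0n cardG_gt0.
have geps h : gelt rat h * eps = eps.
  by rewrite /eps mulr_sumr [RHS](reindex_inj (mulgI h)); apply: eq_bigr => g _; rewrite geltM.
have epsg h : eps * gelt rat h = eps.
  by rewrite /eps mulr_suml [RHS](reindex_inj (mulIg h)); apply: eq_bigr => g _; rewrite geltM.
have xeps (x : A) : x * eps = (\sum_g (x g : rat)) *: eps.
  by rewrite {1}[x]gelt_sum mulr_suml scaler_suml; apply: eq_bigr => g _; rewrite -scalerAl geps.
have epsx (x : A) : eps * x = (\sum_g (x g : rat)) *: eps.
  by rewrite {1}[x]gelt_sum mulr_sumr scaler_suml; apply: eq_bigr => g _; rewrite -scalerAr epsg.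
have eps0 : eps != 0.
  apply/eqP => /ffunP/(_ 1%g)/eqP; rewrite /eps sum_ffunE ffunE (bigD1 1%g) //= big1.
    by rewrite ffunE eqxx addr0 oner_eq0.
  by move=> g /negbTE g1; rewrite ffunE eq_sym g1.
have sum_e : \sum_g (algid E g : rat) = 1.
  apply: (fmorph_inj (ratr : rat -> algC)); rewrite rmorph1 -e1 /central_char /irr_value.
  rewrite irr0 cfun11 divr1 rmorph_sum; apply: eq_bigr => g _ /=.
  by rewrite cfun1E inE mulr1.
have epsE : eps \in E by rewrite (mem_ideal_algid E_ideal) xeps sum_e scale1r.
have : two_sided_ideal <[Subvs epsE]>%VS.
  apply/andP; split; apply/prodvP => u w.
    move=> _ /vlineP[c ->]; apply/vlineP; exists (c * \sum_g (vsval u g : rat)).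
    by apply: val_inj; rewrite /= -scalerAr xeps scalerA.
  move=> /vlineP[c ->] _; apply/vlineP; exists (c * \sum_g (vsval w g : rat)).
  by apply: val_inj; rewrite /= -scalerAl epsx scalerA.
case/E_simple => [/eqP|lineE].
  rewrite -subv0 -memvE memv0 => /eqP/(congr1 vsval) /= /eqP.
  by rewrite (negbTE eps0).
move=> x y; have := memvf x; have := memvf y; rewrite -lineE.
move=> /vlineP[c ->] /vlineP[d ->].
by rewrite -!scalerAl -!scalerAr !scalerA mulrC.
Qed.

Lemma odd_group_not_type_III (R : realType) : odd #|gT| -> ~ type_III R (subvs_of E).
Proof.
move=> oddG [F' [D [n [f [f_bij F'real [_ ZD dimD] _]]]]].
have f_inj := bij_inj f_bij; have [f' fK f'K] := f_bij.
have [F [i iC]] := simple_center_field E_simple.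
have ZP (x : subvs_of E) : reflect (forall y, x * y = y * x) (x \in 'Z({:subvs_of E})%VS).
  apply: (iffP memv_capP) => [[_ /centvP xC] y|xC]; first exact: xC (memvf y).
  by split; [exact: memvf | apply/centvP => y _; exact: xC].
have /choice[h hE] : forall c : F', exists a, f (i a) = (c%:A)%:M.
  move=> c; have [|a aE] := (iC.2 (f' (c%:A)%:M)).1.
    apply/ZP => y; apply: f_inj; rewrite !rmorphM f'K -!mulmxE.
    apply/matrixP => k l; rewrite !mxE (bigD1 k) //= big1 => [|m /negbTE mk]; last first.
      by rewrite !mxE eq_sym mk mul0r.
    rewrite (bigD1 l) //= big1 => [|m /negbTE mk]; last by rewrite !mxE mk mulr0.
    by rewrite !mxE !eqxx !addr0 !mulr1n -scalerAl -scalerAr mul1r mulr1.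
  by exists a; rewrite -aE f'K.
have fi_inj : injective (fun a => f (i a)) by move=> a b /f_inj/iC.1.
have hB : zmod_morphism h.
  by move=> a b; apply: fi_inj; rewrite /= !rmorphB /= !hE scalerBl raddfB.
have hM : monoid_morphism h.
  split=> [|a b]; apply: fi_inj; rewrite /= ?rmorphM ?rmorph1 !hE ?scale1r //.
  by rewrite -mulmxE -scalar_mxM -scalerAl mul1r scalerA.
pose hm : {rmorphism F' -> F} :=
  HB.pack h (GRing.isZmodMorphism.Build F' F h hB) (GRing.isMonoidMorphism.Build F' F h hM).
have h_surj a : exists c, a = h c.
  have [N|z zZ zE] := @matrix_center _ D n (f (i a)).
    rewrite -[N]f'K -!rmorphM; congr (f _); apply/ZP.
    by apply/iC.2; exists a.
  move: zZ; rewrite ZD => /vlineP[c cE]; exists c; apply: fi_inj.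
  by rewrite /= hE zE cE.
have Freal (s : {rmorphism F -> algC}) a : s a \is Num.real.
  by have [c ->] := h_surj a; apply: (F'real (s \o hm)).
have [k ke] := exists_central_char_algid E_ideal.
have [s sE] := central_char_embedding E_ideal iC ke.
have [tau tauE] := center_star_exists E_ideal iC.
have star_id a : star (center_in i a) = center_in i a.
  rewrite -tauE; congr center_in; apply/eqP; rewrite eq_sym -subr_eq0; apply/eqP.
  apply: (@star_skew_not_real _ _ (center_in i) _ _ s); rewrite ?Freal //.
  - exact: center_inM.
  - exact: (center_in_inj iC).
  by rewrite !linearB /= !tauE starK opprK addrC.
have k0 : k = 0.
  apply: odd_real_irr1; first by rewrite cardsT.
  exact: real_irr_of_star_fixed E_ideal iC _ ke star_id.
rewrite k0 in ke; have comm := trivial_simple_factor_comm ke.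
(* Commutativity of E passes to D through scalar matrices, so D equals its center and has dimension
   1 over F' instead of 4. *)
have DC (x y : D) : x * y = y * x.
  apply: (@raddf_inj _ _ (@scalar_mx D n.+1)) => [z /matrixP/(_ 0 0)|].
    by rewrite !mxE mulr1n.
  by rewrite /= !scalar_mxM !mulmxE -[x%:M]f'K -[y%:M]f'K -!rmorphM comm.
have : ({:D} <= 'Z({:D}))%VS.
  apply/subvP => x _; apply/memv_capP; split; first exact: memvf.
  by apply/centvP => y _; apply: DC.
by move/dimvS; rewrite ZD dimD dimv1.
Qed.

End TypeThree.

(** The group algebra is indexed by a whole group type, so G is replaced by the isomorphic type
    [[subg G]]. *)
Lemma ramification_group_subg (p : nat) (gT : finGroupType) (G : {group gT}) :
  ramification_group p G -> ramification_group p [set: [subg G]].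
Proof.
case=> P [C [defG pP cycC coC]].
have [sPG sCG] : P \subset G /\ C \subset G by case/sdprod_context: defG => /andP[].
exists (subg G @* P)%G, (subg G @* C)%G; split.
- by have := injm_sdprod (subxx G) (injm_subg G) defG; rewrite im_subg.
- exact: morphim_pgroup.
- exact: morphim_cyclic.
by rewrite card_injm ?injm_subg.
Qed.

Theorem mainTheorem2 (R : realType) (p : nat) (gT : finGroupType)
    (G : {group gT}) :
  prime p -> ramification_group p G ->
  [/\ quasi_split_outside p (group_algebra rat [subg G]),
      forall E : {aspace group_algebra rat [subg G]}, simple_factor E ->
        exists (F : fieldExtType rat) (i : {lrmorphism F -> subvs_of E}),
          identifies_center i /\ (CM_field F \/ subfield_of_Qmu_pinfty p F)
    & odd #|G| ->
      forall E : {aspace group_algebra rat [subg G]}, simple_factor E ->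
        ~ type_III R (subvs_of E)].
Proof.
move=> p_pr /ramification_group_subg Gram; split.
- exact: group_algebra_quasi_split.
- move=> E [E_ideal E_simple]; have [F [i iC]] := simple_center_field E_simple.
  by exists F, i; split=> //; exact: (center_CM_or_cyclotomic E_ideal iC Gram).
move=> oddG E [E_ideal E_simple]; apply: odd_group_not_type_III => //.
by rewrite -cardsT -(card_isog (isog_subg G)).
Qed.
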